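(* Let $X$ and $Y$ be Banach spaces, $\alpha<\omega_1$ an ordinal, $T:X\to Y$ a bounded linear operator that is not $\alpha$-Szlenk, and $(\mathcal{T},\preceq)$ a countably infinite, rooted, well-founded tree with $\rho(\mathcal{T})<\omega^{\alpha+1}$. Then $\Sigma_{\mathcal{T}^\star}$ factors through $T$. Moreover, if $\mathcal{T}$ is blossomed and $\rho(\mathcal{T})\geq\omega^\alpha$, then $\Sigma_{\mathcal{T}^\star}$ is universal for the class of all operators that are not $\alpha$-Szlenk. It follows that, for an ordinal $\beta$, the class of all operators that are not $\beta$-Szlenk admits a universal element if and only if $\beta<\omega_1$.
   Context: Banach spaces are over $\mathbb{R}$ or $\mathbb{C}$; ''operator'' means bounded linear operator between Banach spaces; $\omega_1$ is the first uncountable ordinal; ordinal powers are used. Szlenk index. For $\epsilon>0$ and a weak$^*$-compact set $K\subseteq X^*$ let $s_\epsilon(K)=\{x^*\in K : \operatorname{diam}(U\cap K)>\epsilon \text{ for every weak}^*\text{-open } U\ni x^*\}$ (norm diameter). Iterate: $s_\epsilon^0(K)=K$, $s_\epsilon^{\xi+1}(K)=s_\epsilon(s_\epsilon^\xi(K))$, $s_\epsilon^\xi(K)=\bigcap_{\zeta<\xi}s_\epsilon^\zeta(K)$ for limit $\xi$. $Sz(K,\epsilon)$ is the least ordinal $\xi$ with $s_\epsilon^\xi(K)=\emptyset$ if it exists, and is undefined otherwise. If $Sz(K,\epsilon)$ is defined for all $\epsilon>0$, then $Sz(K)=\sup_{\epsilon>0}Sz(K,\epsilon)$; otherwise $Sz(K)$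 is undefined. For an operator $T:X\to Y$, $Sz(T)=Sz(T^*(B_{Y^*}))$, where $B_{Y^*}$ is the closed unit ball of $Y^*$. For an ordinal $\alpha$, $T$ is $\alpha$-Szlenk if $Sz(T)$ is defined and $Sz(T)\leq\omega^\alpha$. Thus $T$ is not $\alpha$-Szlenk if either $Sz(T)$ is undefined or it is defined and exceeds $\omega^\alpha$. Factorization and universality. For operators $T:X\to Y$ and $S:W\to Z$, $S$ factors through $T$ if there are operators $U:W\to X$ and $V:Y\to Z$ with $VTU=S$. For a class $\mathscr{C}$ of operators, $\Upsilon\in\mathscr{C}$ is universal for $\mathscr{C}$ if $\Upsilon$ factors through every element of $\mathscr{C}$. Trees. A tree is a partially ordered set $(\mathcal{T},\preceq)$ such that $\{s\in\mathcal{T}: s\preceq t\}$ is well-ordered for every $t\in\mathcal{T}$; $s\prec t$ means $s\preceq t$, $s\neq t$. $MIN(\cdot)$ and $MAX(\cdot)$ denote sets of minimal and maximal elements. $\mathcal{T}$ is rooted if $|MIN(\mathcal{T})|\leq1$; it is well-founded if it contains no infinite branch (a branch is a maximal totally ordered subset). $\mathcal{T}^\star=\mathcal{T}\setminus MIN(\mathcal{T})$, with the induced order. $\mathcal{T}[t+]$ is the set of minimal elements of $\{s\in\mathcal{T}: t\prec s\}$. Put $\mathcal{T}^{(0)}=\mathcal{T}$, $\mathcal{T}^{(\xi+1)}=\mathcal{T}^{(\xi)}\setminus MAX(\mathcal{T}^{(\xi)})$, and $\mathcal{T}^{(\xi)}=\bigcap_{\xi'<\xi}\mathcal{T}^{(\xi')}$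 for limit $\xi$. For well-founded $\mathcal{T}$, the rank is $\rho(\mathcal{T})=\min\{\xi:\mathcal{T}^{(\xi)}=\emptyset\}$, and $\rho_{\mathcal{T}}(t)$ is the unique ordinal $\xi$ with $t\in\mathcal{T}^{(\xi)}\setminus\mathcal{T}^{(\xi+1)}$. A countable tree $\mathcal{T}$ is blossomed if it is rooted, well-founded, and for each $t\in\mathcal{T}\setminus MAX(\mathcal{T})$ there is a bijection $\psi:\omega\to\mathcal{T}[t+]$ such that $m\leq n<\omega$ implies $\rho_{\mathcal{T}}(\psi(m))\leq\rho_{\mathcal{T}}(\psi(n))$. The operator $\Sigma$. For a tree $(\mathcal{T},\preceq)$, $\Sigma_{\mathcal{T}}:\ell_1(\mathcal{T})\to\ell_\infty(\mathcal{T})$ is defined by $\Sigma_{\mathcal{T}}w=\big(\sum_{s\preceq t}w(s)\big)_{t\in\mathcal{T}}$. *)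

(* Defs.v *)
From HB Require Import structures.
From mathcomp Require Import all_boot all_order all_algebra finmap.
From mathcomp Require Import complex.
From mathcomp Require Import all_classical all_reals all_analysis.
From mathcomp.analysis Require Import showcase.summability.
Set Implicit Arguments.
Unset Strict Implicit.
Unset Printing Implicit Defensive.
Import Order.TTheory GRing.Theory Num.Theory.
Import numFieldNormedType.Exports.
Local Open Scope classical_set_scope.
Local Open Scope ring_scope.

(* Ordinals are generated from 0, successors and suprema of arbitrary small
   families (a limit ordinal is the supremum of any family cofinal in it).  One
   ordinal has many presentations: equality of ordinals is [ord_eq], not [=]. *)
Inductive ord : Type :=
| OZero
| OSucc of ord
| OSup (I : Type) of (I -> ord).

Fixpoint ord_le (a : ord) : ord -> Prop :=
  match a with
  | OZero => fun=> True
  | OSucc a' => fix lt_a' (b : ord) : Prop :=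
      match b with
      | OZero => False
      | OSucc b' => ord_le a' b'
      | OSup _ f => exists i, lt_a' (f i)
      end
  | OSup _ f => fun b => forall i, ord_le (f i) b
  end.

Definition ord_lt (a b : ord) : Prop := ord_le (OSucc a) b.
Definition ord_eq (a b : ord) : Prop := ord_le a b /\ ord_le b a.

Section OrdTheory.

Lemma ord_le0 b : ord_le OZero b. Proof. by []. Qed.

Lemma ord_leSS a b : ord_le (OSucc a) (OSucc b) = ord_le a b. Proof. by []. Qed.

Lemma ord_le_sup a (I : Type) (f : I -> ord) i : ord_le a (f i) -> ord_le a (OSup f).
Proof.
elim: a => [//|a _|J g IH] /=; first by exists i.
by move=> H j; apply: IH.
Qed.

Lemma ord_le_refl a : ord_le a a.
Proof. elim: a => [//|//|I f IH] i /=; exact: ord_le_sup (IH i). Qed.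

Lemma ord_le_trans b a c : ord_le a b -> ord_le b c -> ord_le a c.
Proof.
elim: a b c => [//|a IHa|I f IH] b c.
  elim: b c => [//|b IHb|J g IH] c.
    move=> ab; elim: c => [//|c _|J g IH] /=; first exact: IHa.
    by move=> [j /IH Hj]; exists j.
  by move=> /= [j aj] /(_ j); exact: IH.
by move=> /= fb bc i; apply: IH bc.
Qed.

Lemma ord_leS a : ord_le a (OSucc a).
Proof.
elim: a => [//|a IHa|I f IH] => //= i.
by apply: ord_le_trans (IH i) _; rewrite ord_leSS; apply: ord_le_sup (ord_le_refl _).
Qed.

Lemma ord_ltW a b : ord_lt a b -> ord_le a b.
Proof. by move=> ab; apply: ord_le_trans (ord_leS a) ab. Qed.

Lemma ord_lt_irr a : ~ ord_lt a a.
Proof.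
elim: a => [//|a IHa|I f IH] => // -[j] lt_j.
apply: (IH j); apply: (@ord_le_trans (OSucc (OSup f))); last exact: lt_j.
exact: (@ord_le_sup (f j) I f j (ord_le_refl _)).
Qed.

Lemma ord_total_aux a b :
  (ord_lt a b \/ ord_le b a) /\ (ord_le a b \/ ord_lt b a).
Proof.
rewrite /ord_lt; elim: a b => [|a IHa|I f IH]; elim=> [|b IHb|J g IH'].
- by split; [right|left].
- by split; left.
- split; last by left.
  have [[j Hj]|] := pselect (exists j, ord_lt OZero (g j)); first by left; exists j.
  by move=> /forallNP H; right => j; case: (IH' j) => -[/H|].
- by split; right.
- by rewrite !ord_leSS; have [] := IHa b.
- split.
    have [[j Hj]|] := pselect (exists j, ord_lt (OSucc a) (g j)); first by left; exists j.
    by move=> /forallNP H; right => j; case: (IH' j) => -[/H|].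
  have [[j Hj]|] := pselect (exists j, ord_le (OSucc a) (g j)).
    by left; apply: ord_le_sup Hj.
  move=> /forallNP H; right; rewrite ord_leSS => j.
  by case: (IHa (g j)) => -[/H|].
- split; first by right.
  have [H|] := pselect (forall i, ord_le (f i) OZero); first by left.
  move=> /existsNP[j Hi]; right; apply: (@ord_le_sup _ _ _ j).
  by case: (IH j OZero) => _ [/Hi|].
- split.
    rewrite ord_leSS; have [H|] := pselect (forall i, ord_le (f i) b); first by left.
    move=> /existsNP[j Hi]; right; apply: (@ord_le_sup _ _ _ j).
    by case: (IH j b) => _ [/Hi|].
  have [H|] := pselect (forall i, ord_le (f i) (OSucc b)); first by left.
  move=> /existsNP[j Hi]; right; apply: (@ord_le_sup _ _ _ j).
  by case: (IH j (OSucc b)) => _ [/Hi|].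
- split.
    have [[j Hj]|] := pselect (exists j, ord_lt (OSup f) (g j)); first by left; exists j.
    by move=> /forallNP H; right => j; case: (IH' j) => -[/H|].
  have [H|] := pselect (forall i, ord_le (f i) (OSup g)); first by left.
  move=> /existsNP[j Hi]; right; apply: (@ord_le_sup _ _ _ j).
  by case: (IH j (OSup g)) => _ [/Hi|].
Qed.

Lemma ord_ltVge a b : ord_lt a b \/ ord_le b a.
Proof. by have [] := ord_total_aux a b. Qed.

End OrdTheory.

(* The index [None] gives the right value when the family is empty, in which case
   [OSup f] is 0; otherwise it adds nothing (for powers, of a base >= 1). *)
Fixpoint ord_add (a b : ord) : ord :=
  match b with
  | OZero => a
  | OSucc b' => OSucc (ord_add a b')
  | OSup J f => OSup (fun i : option J => if i is Some j then ord_add a (f j) else a)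
  end.

Fixpoint ord_mul (a b : ord) : ord :=
  match b with
  | OZero => OZero
  | OSucc b' => ord_add (ord_mul a b') a
  | OSup _ f => OSup (fun i => ord_mul a (f i))
  end.

Fixpoint ord_pow (a b : ord) : ord :=
  match b with
  | OZero => OSucc OZero
  | OSucc b' => ord_mul (ord_pow a b') a
  | OSup J f =>
      OSup (fun i : option J => if i is Some j then ord_pow a (f j) else OSucc OZero)
  end.

Definition omega : ord := OSup (fun n : nat => iter n OSucc OZero).

(* Closing 0 under successors and suprema of sequences yields exactly the
   countable ordinals; see [omega1_first_uncountable]. *)
Inductive cord : Type := CZero | CSucc of cord | CSup of (nat -> cord).
Fixpoint ord_of_cord (c : cord) : ord :=
  match c with
  | CZero => OZero
  | CSucc c' => OSucc (ord_of_cord c')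
  | CSup f => OSup (fun n => ord_of_cord (f n))
  end.
Definition omega1 : ord := OSup ord_of_cord.

(* Enumeration up to [ord_eq], since [ord] has redundant presentations. *)
Definition ord_countable (a : ord) : Prop :=
  exists g : nat -> ord, forall z, ord_lt z a -> exists n, ord_eq z (g n).

Lemma omega1_first_uncountable :
  ~ ord_countable omega1 /\ forall a, ord_lt a omega1 -> ord_countable a.
Proof.
split.
  move=> [g gP].
  have ltc c : ord_lt (ord_of_cord c) omega1.
    by exists (CSucc c); exact: ord_le_refl.
  have /choice[c cP] : forall n, exists c, ord_lt (g n) omega1 -> ord_le (g n) (ord_of_cord c).
    move=> n; have [[c Hc]|] := pselect (ord_lt (g n) omega1); last by exists CZero.
    by exists c => _; apply: ord_ltW.
  have [n [zg gz]] := gP _ (ltc (CSucc (CSup c))).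
  apply: (@ord_lt_irr (ord_of_cord (CSup c))).
  apply: ord_le_trans zg _; apply: (@ord_le_sup _ _ _ n).
  by apply: cP; apply: ord_le_trans (ltc (CSucc (CSup c))).
have H c : ord_countable (ord_of_cord c).
  elim: c => [|c [g gP]|f /choice[g gP]].
  - by exists (fun=> OZero) => z [].
  - exists (fun n => if n is m.+1 then g m else ord_of_cord c) => z zc.
    have [/gP[n Hn]|cz] := ord_ltVge z (ord_of_cord c); first by exists n.+1.
    by exists 0%N.
  - pose h (n : nat) := if choice.unpickle n is Some p then g p.1 p.2 else OZero.
    exists h => z [n] /gP[m Hm].
    by exists (choice.pickle (n, m)); rewrite /h choice.pickleK.
move=> a [c ac]; have [g gP] := H c; exists g => z za.
by apply: gP; apply: ord_le_trans (ord_ltW ac).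
Qed.

Variant scalar_kind := RealScalars | ComplexScalars.

Definition scalar_field (R : realType) (k : scalar_kind) : numFieldType :=
  match k with RealScalars => R | ComplexScalars => (R[i])%C end.

(* The library's norms take values in the scalar field, so the real number [rnorm x]
   is [`|x|] read back in R. *)
Definition of_real (R : realType) (k : scalar_kind) : R -> scalar_field R k :=
  match k with
  | RealScalars => fun x => x
  | ComplexScalars => fun x => (x%:C)%C
  end.

Definition to_real (R : realType) (k : scalar_kind) : scalar_field R k -> R :=
  match k with
  | RealScalars => fun x => x
  | ComplexScalars => fun x => complex.Re x
  end.

Arguments of_real {R} k x.
Arguments to_real {R k} x.

Definition rnorm (R : realType) (k : scalar_kind)
  (V : normedModType (scalar_field R k)) (x : V) : R := to_real `|x|.

Section Scalars.
Variables (R : realType) (k : scalar_kind).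
Local Notation K := (scalar_field R k).

Lemma to_realK (x : K) : x \is Num.real -> of_real k (to_real x) = x.
Proof. by case: k x => //= x; exact: RRe_real. Qed.
Lemma of_realK (x : R) : to_real (of_real k x) = x.
Proof. by case: k. Qed.
Lemma of_realD (x y : R) : of_real k (x + y) = of_real k x + of_real k y.
Proof. by case: k => //=; rewrite raddfD. Qed.
Lemma of_realM (x y : R) : of_real k (x * y) = of_real k x * of_real k y.
Proof. by case: k => //=; rewrite rmorphM. Qed.
Lemma of_real0 : of_real k (0 : R) = 0. Proof. by case: k. Qed.
Lemma of_real_le (x y : R) : (of_real k x <= of_real k y) = (x <= y).
Proof. by case: k => //=; rewrite lecR. Qed.
Lemma of_real_lt (x y : R) : (of_real k x < of_real k y) = (x < y).
Proof. by case: k => //=; rewrite ltcR. Qed.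
Lemma of_real_norm_real (x : R) : of_real k x \is Num.real.
Proof.
by rewrite realE -of_real0 !of_real_le le_total.
Qed.
End Scalars.

Section Rnorm.
Variables (R : realType) (k : scalar_kind) (V : normedModType (scalar_field R k)).
Implicit Types x y : V.

Lemma rnormK x : of_real k (rnorm x) = `|x|.
Proof. by rewrite to_realK// normr_real. Qed.
Lemma rnorm_ge0 x : 0 <= rnorm x.
Proof. by rewrite -(of_real_le k) of_real0 rnormK. Qed.
Lemma rnormD x y : rnorm (x + y) <= rnorm x + rnorm y.
Proof. by rewrite -(of_real_le k) of_realD !rnormK ler_normD. Qed.
Lemma rnormN x : rnorm (- x) = rnorm x.
Proof. by rewrite /rnorm normrN. Qed.
Lemma rnormB x y : rnorm (x - y) = rnorm (y - x).
Proof. by rewrite /rnorm distrC. Qed.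
Lemma rnorm0 : rnorm (0 : V) = 0.
Proof. by rewrite /rnorm normr0 -(of_real0 R k) of_realK. Qed.
Lemma rnorm0_eq0 x : rnorm x = 0 -> x = 0.
Proof.
move=> x0; apply/eqP; rewrite -normr_eq0; apply/eqP.
by rewrite -rnormK x0 of_real0.
Qed.
End Rnorm.

Lemma rnormZ (R : realType) (k : scalar_kind) (V : normedModType (scalar_field R k))
  (a : scalar_field R k) (x : V) : rnorm (a *: x) = rnorm (a : (scalar_field R k)^o) * rnorm x.
Proof.
rewrite -[LHS](of_realK k) -[RHS](of_realK k) of_realM rnormK (rnormK x).
by rewrite (rnormK (a : (scalar_field R k)^o)) normrZ.
Qed.

Section ScalarComplete.
Variables (R : realType) (k : scalar_kind).
Local Notation K := (scalar_field R k).

Lemma scalar_complete (F : set_system K^o) : ProperFilter F -> cauchy F -> cvg F.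
Proof.
case: k F => F FF Fc; first exact: (@R_complete R).
have re_c (g : R[i] -> R) : (forall x y, `|g x - g y|%:C%C <= `|x - y|) ->
   cvg (g @ F).
  move=> gP; apply: (@R_complete R); apply/cauchy_exP => e e0.
  have /cauchyP /(_ (e%:C)%C) := Fc; rewrite -[0]/((0 : R)%:C)%C ltcR => /(_ e0)[x Fx].
  have xg : ball x (e%:C)%C `<=` g @^-1` (ball (g x) e).
    move=> y; rewrite /= -!ball_normE /= => xy.
    by rewrite -ltcR; exact: le_lt_trans xy.
  by exists (g x); exact: filterS xg Fx.
have /cvg_ex[a Fa] : cvg (@complex.Re R @ F).
  apply: re_c => x y; rewrite -raddfB; exact: normc_ge_Re.
have /cvg_ex[b Fb] : cvg (@complex.Im R @ F).
  apply: re_c => x y; rewrite -raddfB -normrN -ReiNIm.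
  apply: le_trans (normc_ge_Re _) _; rewrite normrM.
  by rewrite (_ : `|'i%C : R[i]| = 1) ?mulr1// normc_def/= expr0n expr1n add0r sqrtr1.
apply/cvg_ex; exists (a +i* b)%C => /=.
apply/cvg_ballP => /= e e0.
have eE : e = ((complex.Re e)%:C)%C by rewrite RRe_real// gtr0_real.
have {}e0 : 0 < complex.Re e / 2 by rewrite divr_gt0// -ltcR -eE.
have Na : \forall z \near F, `|a - complex.Re z| < complex.Re e / 2.
  exact: Fa _ (nbhsx_ballx a _ e0).
have Nb : \forall z \near F, `|b - complex.Im z| < complex.Re e / 2.
  exact: Fb _ (nbhsx_ballx b _ e0).
near=> z; rewrite -ball_normE /= eE (splitr (complex.Re e)) raddfD/=.
have -> : (a +i* b)%C - z = ((a - complex.Re z)%:C)%C + 'i%C * ((b - complex.Im z)%:C)%C.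
  by case: (z) => x y; simpc.
apply: le_lt_trans (ler_normD _ _) _; rewrite normrM.
rewrite (_ : `|'i%C : R[i]| = 1) ?mul1r; last first.
  by rewrite normc_def/= expr0n expr1n add0r sqrtr1.
rewrite ltrD// normc_def/= expr0n addr0 sqrtr_sqr ltcR; near: z.
- exact: Na.
- exact: Nb.
Unshelve. all: by end_near. Qed.
End ScalarComplete.

Section FunctionSpaces.
Variables (R : realType) (k : scalar_kind) (I : choiceType).
Local Notation K := (scalar_field R k)^o.

(* An extended-valued norm on all functions I -> K.  [fnorm_fatou] is lower
   semicontinuity for pointwise convergence along nets; with the domination
   [fnorm_pt] of point evaluations it makes the functions of finite norm a Banach
   space. *)
Record fnorm := FNorm {
  fnorm_fun :> (I -> K) -> \bar R;
  fnorm0 : fnorm_fun 0 = 0%E;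
  fnormD : forall f g, (fnorm_fun (f + g)%R <= fnorm_fun f + fnorm_fun g)%E;
  fnormZ_le : forall (a : K) f, (fnorm_fun (a *: f)%R <= (rnorm a)%:E * fnorm_fun f)%E;
  fnorm_ge0 : forall f, (0 <= fnorm_fun f)%E;
  fnorm_pt : forall f i, ((rnorm (f i))%:E <= fnorm_fun f)%E;
  fnorm_fatou : forall g (M : R),
    (forall (A : seq I) (e : R), 0 < e -> exists2 f, (fnorm_fun f <= M%:E)%E &
       forall i, i \in A -> rnorm (f i - g i) <= e) ->
    (fnorm_fun g <= M%:E)%E
}.

Lemma fnormZ (N : fnorm) (a : K) f : N (a *: f) = ((rnorm a)%:E * N f)%E.
Proof.
apply/eqP; rewrite eq_le fnormZ_le/=.
have [->|a0] := eqVneq a 0; first by rewrite rnorm0 mul0e fnorm_ge0.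
have aa : rnorm a * rnorm (a^-1 : K) = 1.
  rewrite -(rnormZ a (a^-1 : K)) -[RHS](of_realK k); congr to_real.
  by rewrite [_ *: _]mulfV// normr1; case: (k).
rewrite -{1}(scale1r f) -(mulVf a0) -scalerA.
apply: (@le_trans _ _ ((rnorm a)%:E * ((rnorm (a^-1 : K))%:E * N (a *: f)))%E).
  by rewrite lee_wpmul2l ?lee_fin ?rnorm_ge0// fnormZ_le.
by rewrite muleA -EFinM aa mul1e.
Qed.

Definition finite_fnorm (N : fnorm) : {pred I -> K} := [pred f | (N f < +oo)%E].

Lemma finite_fnorm_submod (N : fnorm) : submod_closed (finite_fnorm N).
Proof.
split; first by rewrite inE fnorm0 ltry.
move=> a f g; rewrite !inE => Nf Ng; apply: le_lt_trans (fnormD _ _ _) _.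
rewrite fnormZ lte_add_pinfty//.
by rewrite lte_mul_pinfty// lee_fin rnorm_ge0.
Qed.

HB.instance Definition _ (N : fnorm) :=
  GRing.isSubmodClosed.Build _ _ (finite_fnorm N) (finite_fnorm_submod N).

Record fnspace (N : fnorm) := FnSpace {
  fnspace_fun :> I -> K;
  fnspaceP : fnspace_fun \in finite_fnorm N }.

HB.instance Definition _ (N : fnorm) := [isSub for @fnspace_fun N].
HB.instance Definition _ (N : fnorm) := [Choice of fnspace N by <:].
HB.instance Definition _ (N : fnorm) := [SubChoice_isSubLmodule of fnspace N by <:].

Section Norm.
Variable N : fnorm.
Implicit Types x y : fnspace N.

Definition fnspace_norm x : scalar_field R k := of_real k (fine (N x)).

Lemma fnspace_finE x : ((fine (N x))%:E = N x)%E.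
Proof. by rewrite fineK// ge0_fin_numE ?fnorm_ge0//; exact: (fnspaceP x). Qed.

Lemma fnspace_normD x y : fnspace_norm (x + y) <= fnspace_norm x + fnspace_norm y.
Proof.
rewrite /fnspace_norm -of_realD of_real_le -lee_fin EFinD !fnspace_finE.
exact: fnormD.
Qed.

Lemma fnspace_normZ (a : scalar_field R k) x : fnspace_norm (a *: x) = `|a| * fnspace_norm x.
Proof.
rewrite -(rnormK (a : K)) -of_realM; congr of_real; apply: EFin_inj.
by rewrite EFinM !fnspace_finE -fnormZ.
Qed.

Lemma fnspace_norm0_eq0 x : fnspace_norm x = 0 -> x = 0.
Proof.
move=> x0; apply: val_inj; apply/funext => i /=; apply: rnorm0_eq0.
apply/eqP; rewrite eq_le rnorm_ge0 andbT.
have -> : 0 = fine (N x) by rewrite -(of_realK k (fine _)) [of_real _ _]x0 -(of_real0 R k) of_realK.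
by rewrite -lee_fin fnspace_finE fnorm_pt.
Qed.

HB.instance Definition _ := Lmodule_isNormed.Build (scalar_field R k) (fnspace N)
  fnspace_normD fnspace_normZ fnspace_norm0_eq0.

Lemma fnspace_rnormE x : (rnorm x)%:E = N x.
Proof. by rewrite /rnorm [X in to_real X](_ : _ = fnspace_norm x)// of_realK fnspace_finE. Qed.

Lemma fnspace_pt x i : rnorm (x i) <= rnorm x.
Proof. by rewrite -lee_fin fnspace_rnormE fnorm_pt. Qed.

Lemma fnspace_complete (F : set_system (fnspace N)) :
  ProperFilter F -> cauchy F -> cvg F.
Proof.
move=> FF Fc.
have cv i : cvg ((fun x : fnspace N => (x : I -> K) i) @ F).
  apply: scalar_complete; apply/cauchy_exP => e e0.
  have /cauchyP /(_ e e0)[x Fx] := Fc; exists (x i).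
  have xi : ball x e `<=` (fun y : fnspace N => (y : I -> K) i) @^-1` ball (x i) e.
    move=> y; rewrite /= -!ball_normE /=; apply: le_lt_trans.
    rewrite -(rnormK (x i - y i)) -(rnormK (x - y)) of_real_le.
    exact: (fnspace_pt (x - y)).
  exact: filterS xi Fx.
have /choice[g gP] : forall i, exists l : K, (fun x : fnspace N => (x : I -> K) i) @ F --> l.
  by move=> i; exact/cvg_ex.
have near_g (A : seq I) (e : R) : 0 < e ->
    F [set y : fnspace N | forall i, i \in A -> rnorm (y i - g i) <= e].
  move=> e0; elim: A => [|j A IH]; first by apply: filterE => y i.
  have /cvg_ballP/(_ (of_real k e)) := gP j.
  rewrite -[0](of_real0 R k) of_real_lt => /(_ e0) Fj.
  apply: filterS2 IH Fj => y yA yj i; rewrite inE => /orP[/eqP ->|/yA//].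
  move: yj; rewrite -ball_normE /= -(rnormK (_ : K)) of_real_lt rnormB.
  exact: ltW.
have near_x (x : fnspace N) (e : R) : F (ball x (of_real k e)) ->
    (N ((x : I -> K) - g)%R <= e%:E)%E.
  move=> Fx; apply: fnorm_fatou => A e' e'0.
  have /filter_ex[y [yA]] : F ([set y : fnspace N |
      forall i, i \in A -> rnorm (y i - g i) <= e'] `&` ball x (of_real k e)).
    by apply: filterI; [exact: near_g | exact: Fx].
  rewrite -ball_normE /= -(rnormK (x - y)) of_real_lt => /ltW xy.
  exists ((x : I -> K) - y).
    by have := fnspace_rnormE (x - y) => /= <-; rewrite lee_fin.
  move=> i /yA; rewrite rnormB; congr (_ <= _); congr rnorm.
  by rewrite !fctE opprB [RHS]addrC [RHS]addrA subrK.
have gN : g \in finite_fnorm N.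
  have e0 : 0 < of_real k (1 : R) by rewrite -(of_real0 R k) of_real_lt.
  have /cauchyP /(_ _ e0)[x /near_x xg] := Fc.
  rewrite -[g](subKr (x : I -> K)) rpredB ?fnspaceP//.
  by rewrite inE; apply: le_lt_trans xg _; rewrite ltry.
apply/cvg_ex; exists (FnSpace gN); apply/cvg_ballP => e e0.
have eE : of_real k (to_real e) = e by rewrite to_realK// gtr0_real.
have {}e0 : 0 < to_real e / 2.
  by rewrite divr_gt0// -(of_real_lt k) of_real0 eE.
have e0' : 0 < of_real k (to_real e / 2) by rewrite -(of_real0 R k) of_real_lt.
have /cauchyP /(_ _ e0')[x Fx] := Fc; have xg := near_x _ _ Fx.
apply: filterS Fx => y; rewrite -!ball_normE /= => xy.
rewrite -eE (splitr (to_real e)) of_realD -(subrKA x).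
apply: le_lt_trans (ler_normD _ _) _; rewrite ler_ltD//.
rewrite -(rnormK (_ - x)) of_real_le rnormB -lee_fin fnspace_rnormE.
exact: xg.
Qed.

HB.instance Definition _ := Uniform_isComplete.Build (fnspace N) fnspace_complete.
End Norm.
End FunctionSpaces.

Section EllSpaces.
Variables (R : realType) (k : scalar_kind) (I : choiceType).
Local Notation K := (scalar_field R k)^o.
Implicit Types f g : I -> K.

Lemma esum_leP (a : I -> R) (x : \bar R) : (forall i, 0 <= a i) ->
  (\esum_(i in [set: I]) (a i)%:E <= x)%E <->
  (forall A : {fset I}, ((\sum_(i <- A) a i)%:E <= x)%E).
Proof.
move=> a0; split=> [le_x A|le_x].
  apply: le_trans le_x; apply: esum_ge; exists [set` A]; first by split.
  by rewrite -sumEFin -fsbig_seq.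
apply: ge_ereal_sup => _ /= [A [Afin _] <-].
by rewrite fsbig_finite//= sumEFin.
Qed.

Definition ell1_norm f : \bar R := \esum_(i in [set: I]) (rnorm (f i))%:E.

(* The element 0 only matters when I is empty. *)
Definition ellinf_norm f : \bar R :=
  ereal_sup (0%E |` range (fun i => (rnorm (f i))%:E)).

Lemma ell1_normP f x : (ell1_norm f <= x)%E <->
  (forall A : {fset I}, ((\sum_(i <- A) rnorm (f i))%:E <= x)%E).
Proof. by apply: esum_leP => i; exact: rnorm_ge0. Qed.

Lemma ell1_sum_le f (A : {fset I}) : ((\sum_(i <- A) rnorm (f i))%:E <= ell1_norm f)%E.
Proof. by move: A; apply/ell1_normP. Qed.

Lemma ell1_norm_ge0 f : (0 <= ell1_norm f)%E.
Proof. by apply: esum_ge0 => i _; rewrite lee_fin rnorm_ge0. Qed.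

Lemma ellinf_normP f x : (0 <= x)%E -> (ellinf_norm f <= x)%E <->
  (forall i, ((rnorm (f i))%:E <= x)%E).
Proof.
move=> x0; split=> [/ereal_supP H i|H].
  by apply: H; right; exists i.
by apply/ereal_supP => _ [->//|[i _ <-]].
Qed.

Lemma ellinf_norm_ge0 f : (0 <= ellinf_norm f)%E.
Proof. by apply: ereal_sup_ubound; left. Qed.

Lemma ellinf_pt f i : ((rnorm (f i))%:E <= ellinf_norm f)%E.
Proof. by apply: ereal_sup_ubound; right; exists i. Qed.

Lemma le_addeps (x M : R) (n : nat) : 
  (forall e, 0 < e -> x <= M + n%:R * e) -> x <= M.
Proof.
move=> H; apply/ler_addgt0Pr => e e0.
apply: le_trans (H (e / n.+1%:R) _) _; first by rewrite divr_gt0// ltr0n.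
rewrite lerD2l mulrCA ger_pMr// ler_pdivrMr ?ltr0n// mul1r ler_nat//.
Qed.

Definition ell1_fnorm : fnorm R k I.
Proof.
apply: (@FNorm _ _ _ ell1_norm).
- by apply: esum1 => i _; rewrite rnorm0.
- move=> f g; rewrite /ell1_norm -esumD; last 2 first.
  + by move=> i _; rewrite lee_fin rnorm_ge0.
  + by move=> i _; rewrite lee_fin rnorm_ge0.
  by apply: le_esum => i _; rewrite -EFinD lee_fin rnormD.
- move=> a f; apply/ell1_normP => A.
  under eq_bigr do rewrite fctE rnormZ.
  rewrite -mulr_sumr EFinM lee_wpmul2l ?lee_fin ?rnorm_ge0//.
  exact: ell1_sum_le.
- exact: ell1_norm_ge0.
- by move=> f i; have := ell1_sum_le f [fset i]%fset; rewrite big_seq_fset1.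
- move=> g M H; apply/ell1_normP => A; rewrite lee_fin.
  apply: (@le_addeps _ _ (size A)) => e e0.
  have [f fM fg] := H A e e0.
  apply: (@le_trans _ _ (\sum_(i <- A) (rnorm (f i) + e))).
    rewrite big_seq [leRHS]big_seq; apply: ler_sum => i iA.
    rewrite -lerBlDl -[leLHS]opprB.
    have := rnormD (f i) (g i - f i); rewrite addrCA subrr addr0 => h.
    have := fg i iA; rewrite rnormB => h'.
    by rewrite opprB lerBlDl (le_trans h)// lerD2l.
  rewrite big_split/= big_const_seq count_predT iter_addr_0 mulr_natl lerD2r.
  by rewrite -lee_fin; apply: le_trans fM; exact: ell1_sum_le.
Defined.

Definition ellinf_fnorm : fnorm R k I.
Proof.
apply: (@FNorm _ _ _ ellinf_norm).
- apply/eqP; rewrite eq_le ellinf_norm_ge0 andbT.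
  by apply/ellinf_normP => // i; rewrite rnorm0.
- move=> f g; apply/ellinf_normP => [|i]; first by rewrite adde_ge0// ellinf_norm_ge0.
  apply: (@le_trans _ _ ((rnorm (f i))%:E + (rnorm (g i))%:E)%E).
    by rewrite -EFinD lee_fin rnormD.
  by apply: leeD; exact: ellinf_pt.
- move=> a f; apply/ellinf_normP => [|i].
    by rewrite mule_ge0// ?lee_fin ?rnorm_ge0// ellinf_norm_ge0.
  by rewrite fctE rnormZ EFinM lee_wpmul2l ?lee_fin ?rnorm_ge0// ellinf_pt.
- exact: ellinf_norm_ge0.
- exact: ellinf_pt.
- move=> g M H.
  have M0 : 0 <= M.
    have [f fM _] := H [::] 1 ltr01; rewrite -lee_fin; apply: le_trans fM.
    exact: ellinf_norm_ge0.
  apply/ellinf_normP => // i; rewrite lee_fin; apply/ler_addgt0Pr => e e0.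
  have [f fM /(_ i)] := H [:: i] e e0; rewrite mem_head => /(_ isT) fg.
  rewrite -[g i](subrK (f i)) addrC; apply: le_trans (rnormD _ _) _.
  by rewrite rnormB lerD// -lee_fin; apply: le_trans fM; exact: ellinf_pt.
Defined.

End EllSpaces.

Notation ell1 R k I := (fnspace (ell1_fnorm R k I)).
Notation ellinf R k I := (fnspace (ellinf_fnorm R k I)).

Section UnconditionalSum.
Variables (R : realType) (k : scalar_kind) (I : choiceType).
Local Notation K := (scalar_field R k)^o.
Implicit Types f g : I -> K.

Lemma partial_sumE f (A : {fset I}) : partial_sum f A = \sum_(i <- A) f i.
Proof. by rewrite /partial_sum big_seq_fsetE. Qed.

Lemma rnorm_sum (s : seq I) f : rnorm (\sum_(i <- s) f i) <= \sum_(i <- s) rnorm (f i).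
Proof.
elim: s => [|i s IH]; first by rewrite !big_nil rnorm0.
by rewrite !big_cons; apply: le_trans (rnormD _ _) _; rewrite lerD2l.
Qed.

Lemma sum_cvg f : (ell1_norm f < +oo)%E -> cvg (partial_sum f @ totally).
Proof.
move=> f_fin; have TF : ProperFilter (@totally I) := totally_filter.
apply: scalar_complete; apply/cauchy_exP => e e0.
have eE : of_real k (to_real e) = e by rewrite to_realK// gtr0_real.
have {}e0 : 0 < to_real e by rewrite -(of_real_lt k) of_real0 eE.
have Nfin : ell1_norm f \is a fin_num by rewrite ge0_fin_numE// ell1_norm_ge0.
have [_ [B [Bfin _] <-]] := ub_ereal_sup_adherent e0 Nfin.
rewrite fsbig_finite//= sumEFin; set A := fset_set B => HA.
exists (partial_sum f A); exists A => // C /= AC.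
rewrite -ball_normE /= -(rnormK (_ : K)) -eE of_real_lt rnormB !partial_sumE.
have split_C (V : zmodType) (h : I -> V) : \sum_(i <- C) h i =
    \sum_(i <- A) h i + \sum_(i <- [fset i in C | i \notin A]%fset) h i.
  rewrite (big_fsetID _ (mem A))/=; congr (_ + _).
  by apply: eq_fbigl => i; rewrite !inE andb_idl//; exact: (fsubsetP AC).
rewrite split_C addrC addKr; apply: le_lt_trans (rnorm_sum _ _) _.
have := ell1_sum_le f C; rewrite split_C => HC.
have {}HA : (ell1_norm f < (\sum_(i <- A) rnorm (f i))%:E + (to_real e)%:E)%E.
  by rewrite -lteBlDr.
have := le_lt_trans HC HA.
by rewrite -EFinD !lte_fin ltrD2l.
Qed.

Lemma rnorm_sum_le f (M : R) : (ell1_norm f <= M%:E)%E ->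
  rnorm (summability.sum f : K) <= M.
Proof.
move=> fM; have TF : ProperFilter (@totally I) := totally_filter.
have /cvg_ballP cf : partial_sum f @ totally --> (summability.sum f : K).
  by apply: sum_cvg; apply: le_lt_trans fM _; rewrite ltry.
apply/ler_addgt0Pr => e e0.
have /cf/filter_ex[A] : 0 < of_real k e by rewrite -(of_real0 R k) of_real_lt.
rewrite -ball_normE /= -(rnormK (_ : K)) of_real_lt => /ltW fA.
rewrite -[X in rnorm X](subrK (partial_sum f A)) addrC.
apply: le_trans (rnormD _ _) _; rewrite lerD// partial_sumE.
apply: le_trans (rnorm_sum _ _) _; rewrite -lee_fin.
by apply: le_trans fM; exact: ell1_sum_le.
Qed.

Lemma sum_linear (a : K) f g : (ell1_norm f < +oo)%E -> (ell1_norm g < +oo)%E ->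
  summability.sum (a *: f + g : I -> K) = a *: summability.sum f + summability.sum g.
Proof.
move=> /sum_cvg cf /sum_cvg cg.
have TF : ProperFilter (@totally I) := totally_filter.
apply: cvg_lim => //.
rewrite (_ : partial_sum _ = (a \*: partial_sum f) \+ partial_sum g).
  by apply: cvgD => //; exact: cvgZr.
apply/funext => A /=; rewrite !partial_sumE scaler_sumr -big_split/=.
by apply: eq_bigr => i _; rewrite !fctE.
Qed.
End UnconditionalSum.

Record operator (K : numFieldType) (V W : normedModType K) := Operator {
  op_fun :> {linear V -> W};
  op_bounded : exists M : K, forall x, `|op_fun x| <= M * `|x|
}.

HB.instance Definition _ (K : numFieldType) (V W : normedModType K) :=
  gen_eqMixin (operator V W).
HB.instance Definition _ (K : numFieldType) (V W : normedModType K) :=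
  gen_choiceMixin (operator V W).

Section Sigma.
Variables (R : realType) (k : scalar_kind) (d : Order.disp_t) (T : porderType d).
Local Notation K := (scalar_field R k)^o.
Implicit Types w : ell1 R k T.

(* [summability.sum] is the limit of the finite partial sums along the directed set
   of finite subsets. *)
Definition Sigma_fun w (t : T) : K :=
  summability.sum (fun s : T => if (s <= t)%O then w s else 0).

Lemma ell1_norm_if w (p : pred T) :
  (ell1_norm (fun s : T => if p s then w s else 0 : K)%R <= (rnorm w)%:E)%E.
Proof.
rewrite fnspace_rnormE; apply: le_esum => i _; case: ifP => _ //.
by rewrite rnorm0 lee_fin rnorm_ge0.
Qed.

Lemma Sigma_norm_le w : (ellinf_norm (Sigma_fun w) <= (rnorm w)%:E)%E.
Proof.
apply/ellinf_normP => [|t]; first by rewrite lee_fin rnorm_ge0.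
by rewrite lee_fin; apply: rnorm_sum_le; exact: ell1_norm_if.
Qed.

Lemma Sigma_fun_ellinf w : Sigma_fun w \in finite_fnorm (ellinf_fnorm R k T).
Proof. by rewrite inE; apply: le_lt_trans (Sigma_norm_le w) _; rewrite ltry. Qed.

Definition Sigma_map w : ellinf R k T := FnSpace (Sigma_fun_ellinf w).

Lemma Sigma_linear : linear Sigma_map.
Proof.
move=> a v w; apply: val_inj; apply/funext => t /=.
have fin (u : ell1 R k T) : (ell1_norm (fun s : T => if (s <= t)%O then u s else 0 : K)%R < +oo)%E.
  exact: le_lt_trans (ell1_norm_if u (fun s => (s <= t)%O)) (ltry _).
rewrite !fctE -(sum_linear a (fin v) (fin w)) /Sigma_fun; congr summability.sum.
apply/funext => s; rewrite !fctE; case: ifP => // _.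
by rewrite scaler0 addr0.
Qed.

HB.instance Definition _ :=
  GRing.isLinear.Build (scalar_field R k) (ell1 R k T) (ellinf R k T) _ Sigma_map Sigma_linear.

Lemma Sigma_bounded : exists M : scalar_field R k, forall w, `|Sigma_map w| <= M * `|w|.
Proof.
exists 1 => w; rewrite mul1r -(rnormK w) -(rnormK (Sigma_map w)) of_real_le.
by rewrite -lee_fin fnspace_rnormE; exact: Sigma_norm_le.
Qed.

Definition Sigma : operator (ell1 R k T) (ellinf R k T) := Operator Sigma_bounded.
End Sigma.

(* Least ordinal satisfying P; only meaningful when some ordinal satisfies P. *)
Definition ord_least (P : ord -> Prop) : ord :=
  if pselect (exists a, P a /\ forall b, P b -> ord_le a b) is left h
  then projT1 (cid h) else OZero.

Section Szlenk.
Variables (R : realType) (k : scalar_kind).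
Local Notation K := (scalar_field R k).

Definition op_norm (V W : normedModType K) (f : V -> W) : \bar R :=
  ereal_sup [set (rnorm (f x))%:E | x in [set x | rnorm x <= 1]].

Definition dual_space (V : normedModType K) := operator V K^o.

(* The topology of pointwise convergence, pulled back from V -> K. *)
Definition weak_star (V : normedModType K) :=
  initial_topology (fun f : dual_space V => (f : V -> K^o) : {ptws V -> K^o}).
HB.instance Definition _ (V : normedModType K) := Topological.on (weak_star V).

Definition dual_ball (V : normedModType K) : set (dual_space V) :=
  [set f | (op_norm f <= 1)%E].

Definition dual_diam (V : normedModType K) (A : set (dual_space V)) : \bar R :=
  ereal_sup [set op_norm (fun x => f x - g x) | f in A & g in A].

Definition szlenk_der (V : normedModType K) (e : R) (A : set (dual_space V)) :
    set (dual_space V) :=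
  [set f | A f /\ forall U : set (weak_star V),
    open U -> U f -> (e%:E < dual_diam (U `&` A))%E].

(* The iterates decrease, so at a limit ordinal the intersection over a cofinal
   family is the intersection over all smaller ordinals; [A] is there for the empty
   family.  Likewise for [tree_der]. *)
Fixpoint szlenk_iter (V : normedModType K) (e : R) (A : set (dual_space V))
    (xi : ord) : set (dual_space V) :=
  match xi with
  | OZero => A
  | OSucc z => szlenk_der e (szlenk_iter e A z)
  | OSup _ z => A `&` \bigcap_i szlenk_iter e A (z i)
  end.

Definition Sz_eps_defined (V : normedModType K) (A : set (dual_space V)) (e : R) :=
  exists xi, szlenk_iter e A xi = set0.

Definition Sz_eps (V : normedModType K) (A : set (dual_space V)) (e : R) : ord :=
  ord_least (fun xi => szlenk_iter e A xi = set0).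

Definition Sz_defined (V : normedModType K) (A : set (dual_space V)) :=
  forall e : R, 0 < e -> Sz_eps_defined A e.

Definition Sz (V : normedModType K) (A : set (dual_space V)) : ord :=
  OSup (fun e : {e : R | 0 < e} => Sz_eps A (sval e)).

Section Adjoint.
Variables (V W : normedModType K) (T : operator V W) (f : dual_space W).

Lemma adjoint_bounded : exists M : K, forall x, `|(f \o T) x : K^o| <= M * `|x|.
Proof.
have [M MT] := op_bounded T; have [N Nf] := op_bounded f.
exists (`|N| * M) => x /=; apply: le_trans (Nf _) _.
apply: (@le_trans _ _ (`|N| * `|T x|)); last by rewrite -mulrA ler_wpM2l.
have := normr_ge0 (f (T x)); have := Nf (T x) => /le_trans h /[dup] h0 _.
rewrite -[leLHS]ger0_norm; first by rewrite normrM normr_id.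
exact: le_trans (normr_ge0 _) (Nf _).
Qed.

Definition adjoint : dual_space V := Operator adjoint_bounded.
End Adjoint.

Definition op_Sz_defined (V W : normedModType K) (T : operator V W) :=
  Sz_defined (adjoint T @` @dual_ball W).

Definition op_Sz (V W : normedModType K) (T : operator V W) : ord :=
  Sz (adjoint T @` @dual_ball W).

Definition is_szlenk (alpha : ord) (V W : normedModType K) (T : operator V W) :=
  op_Sz_defined T /\ ord_le (op_Sz T) (ord_pow omega alpha).

Definition factors_through (W Z X Y : normedModType K)
    (S : operator W Z) (T : operator X Y) : Prop :=
  exists (U : operator W X) (V : operator Y Z), forall w, V (T (U w)) = S w.

Definition op_class :=
  forall X Y : completeNormedModType K, operator X Y -> Prop.

Definition non_szlenk (alpha : ord) : op_class :=
  fun X Y T => ~ is_szlenk alpha T.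

Definition universal (C : op_class) (W Z : completeNormedModType K)
    (Ups : operator W Z) : Prop :=
  C W Z Ups /\ forall (X Y : completeNormedModType K) (T : operator X Y),
    C X Y T -> factors_through Ups T.
End Szlenk.

Section Trees.
Variables (d : Order.disp_t) (T : porderType d).
Implicit Types (A B : set T) (s t : T).

Definition tree_min A : set T :=
  [set t | A t /\ forall s, A s -> (s <= t)%O -> s = t].
Definition tree_max A : set T :=
  [set t | A t /\ forall s, A s -> (t <= s)%O -> s = t].

Definition is_tree : Prop :=
  forall t, wochoice.wo_chain (fun x y : T => (x <= y)%O) [pred s | (s <= t)%O].

Definition rooted : Prop := is_subset1 (tree_min [set: T]).

Definition tree_chain A : Prop := total_on A (fun s t => (s <= t)%O).

Definition branch A : Prop :=
  tree_chain A /\ forall B, tree_chain B -> A `<=` B -> B = A.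

Definition well_founded_tree : Prop := forall A, branch A -> finite_set A.

Definition tree_next t : set T := tree_min [set s | (t < s)%O].

Fixpoint tree_der (xi : ord) : set T :=
  match xi with
  | OZero => setT
  | OSucc z => tree_der z `\` tree_max (tree_der z)
  | OSup _ z => \bigcap_i tree_der (z i)
  end.

Definition tree_rank : ord := ord_least (fun xi => tree_der xi = set0).

(* The ordinal below is unique up to [ord_eq]. *)
Definition node_rank t : ord :=
  ord_least (fun xi => (tree_der xi `\` tree_der (OSucc xi)) t).

Definition blossomed : Prop :=
  [/\ is_tree, countable [set: T], rooted, well_founded_tree &
    forall t, ~ tree_max [set: T] t ->
      exists psi : nat -> T, set_bij [set: nat] (tree_next t) psi /\
        forall m n, (m <= n)%N -> ord_le (node_rank (psi m)) (node_rank (psi n))].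

Definition star : Type := set_type (~` tree_min [set: T]).
HB.instance Definition _ := SubChoice.on star.
HB.instance Definition _ := [SubChoice_isSubPOrder of star by <: with d].
End Trees.

(* Main.v *)
Require Import Defs.
From HB Require Import structures.
From mathcomp Require Import all_boot all_order all_algebra finmap.
From mathcomp Require Import complex.
From mathcomp Require Import all_classical all_reals all_analysis.
From mathcomp.analysis Require Import showcase.summability.
From mathcomp Require Import zify ring lra.
Set Implicit Arguments.
Unset Strict Implicit.
Unset Printing Implicit Defensive.
Import Order.TTheory GRing.Theory Num.Theory.
Import numFieldNormedType.Exports.
Local Open Scope classical_set_scope.
Local Open Scope ring_scope.

(** Let [S] be an operator that is not alpha-Szlenk and [K] the image of the dual
    ball under its adjoint. Some point of [K] survives [omega ^ alpha] derivations
    for some distance [e]. Since [K] is closed under midpoints, the same point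
    survives [omega ^ alpha * n] derivations for the distance [e / 2 ^ n]
    ([szlenk_iter_mul]), which exceeds the rank of the given tree for some n. One
    then walks down the tree: at each node [t] there is a point [F t] of the
    derived set whose order is the rank of [t], weak* close to the point at the
    parent but at a definite norm distance from it, and this distance is witnessed
    by a vector [x t]. Treating the nodes in an order of type omega that extends
    the tree order, the increments [F t - F (par t)] and the vectors [x t] can be
    made almost biorthogonal ([tree_selection]). The selected vectors define an
    operator from [ell1], the selected points an operator into [ellinf], and
    between them [S] induces the summation operator composed with a small
    perturbation of the identity of [ell1], which is invertible
    ([Sigma_factors]). Vectors of bounded norm that nearly annihilate finitely many
    given functionals come from a pigeonhole argument ([szlenk_der_select]).

    Conversely, the functional [w |-> \sum_(s <= t) w s] lies in the image of the
    dual ball under the adjoint of the summation operator. If [t] has infinitely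
    many children, the functionals of the children converge weak* to that of [t]
    and stay at distance 1 from it, so the functional of [t] survives as many
    derivations as the rank of [t] ([segment_szlenk]). For a blossomed tree this
    gives the universality of its summation operator, and for a countable ordinal
    beta a blossomed tree whose root has rank [omega ^ beta] exists
    ([monotone_wtree_exists]).

    Let beta be uncountable and suppose that [Ups] is universal. Two operators
    that are not beta-Szlenk are tested. The first is the summation operator of a
    huge well-founded tree, in which every subtree is repeated infinitely often.
    Its functionals have antichain sums bounded by a constant, which yields, by
    induction along the tree, relatively weak* open pieces of small diameter in
    every set of them ([fragmented_all]). With weak* compactness this passes to
    everything that factors through it, so the Szlenk index of [Ups] is defined
    ([factor_Sz_defined]). The second is the summation operator of the tree of all
    finite sequences of natural numbers, whose domain is separable. Hence the
    weak* topology on the image of the dual ball under the adjoint of [Ups] is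
    second countable, a decreasing family of relatively closed sets is stationary
    from a countable ordinal on, and the index of [Ups] is at most omega1
    ([separable_Sz_le_omega1]), hence at most [omega ^ beta]: [Ups] is
    beta-Szlenk after all. *)

(** * Ordinal arithmetic *)

Lemma ord_lt_le_trans b a c : ord_lt a b -> ord_le b c -> ord_lt a c.
Proof. exact: ord_le_trans. Qed.

Lemma ord_le_lt_trans b a c : ord_le a b -> ord_lt b c -> ord_lt a c.
Proof. by move=> ab; apply: (@ord_le_trans (OSucc b)). Qed.

Lemma ord_lt_sup a (J : Type) (f : J -> ord) i : ord_lt a (f i) -> ord_lt a (OSup f).
Proof. exact: ord_le_sup. Qed.

Lemma ord_ltNge a b : ord_lt a b <-> ~ ord_le b a.
Proof.
split=> [ab ba|]; first exact: (@ord_lt_irr a (ord_lt_le_trans ab ba)).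
by have [//|] := ord_ltVge a b.
Qed.

Lemma ord_lt_wf : well_founded ord_lt.
Proof.
suff H a : forall b, ord_le b a -> Acc ord_lt b.
  by move=> a; apply: H; exact: ord_le_refl.
elim: a => [|a IH|J f IH] b ba; constructor=> c cb.
- by have := ord_lt_le_trans cb ba.
- by apply: IH; have := ord_lt_le_trans cb ba.
- have [i ci] := ord_lt_le_trans cb ba.
  exact: IH (ord_ltW ci).
Qed.

Lemma ord_leastP (P : ord -> Prop) : (exists a, P a) ->
  P (ord_least P) /\ forall b, P b -> ord_le (ord_least P) b.
Proof.
move=> [a Pa]; rewrite /ord_least; case: pselect => [h|]; first by case: (cid h).
move=> N; exfalso; elim/(well_founded_ind ord_lt_wf): a Pa => a IH Pa; apply: N.
by exists a; split=> // b Pb; apply: contrapT => /ord_ltNge/IH; exact.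
Qed.

(** Stated for functions that are continuous at suprema and have a monotone step at
    successors, so that it covers addition and powers in their right argument;
    both include their value at 0 in every supremum. *)
Lemma ord_mono (g : ord -> ord) :
  (forall b, ord_le (g OZero) (g b)) ->
  (forall a, ord_le (g a) (g (OSucc a))) ->
  (forall a b, ord_le (g a) (g b) -> ord_le (g (OSucc a)) (g (OSucc b))) ->
  (forall J (f : J -> ord) x, ord_le (g OZero) x -> (forall i, ord_le (g (f i)) x) ->
     ord_le (g (OSup f)) x) ->
  (forall J (f : J -> ord) i, ord_le (g (f i)) (g (OSup f))) ->
  forall a b, ord_le a b -> ord_le (g a) (g b).
Proof.
move=> g0 gS gSS sup_le le_sup; elim=> [//|a IHa|J f IH] b ab.
  elim: b ab => [//|b IHb|J f IH] ab.
  - exact/gSS/IHa.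
  - by case: ab => i /IH; move/ord_le_trans; apply; exact: le_sup.
by apply: sup_le => // i; apply: IH; exact: ab.
Qed.

Lemma ord_add_ge a b : ord_le a (ord_add a b).
Proof.
elim: b => [|b IH|J f IH] /=; first exact: ord_le_refl.
- exact: ord_le_trans IH (ord_leS _).
- by apply: (@ord_le_sup _ _ _ None); exact: ord_le_refl.
Qed.

Lemma ord_add_monor a b b' : ord_le b b' -> ord_le (ord_add a b) (ord_add a b').
Proof.
move: b b'; apply: ord_mono => //=.
- exact: ord_add_ge.
- by move=> b; exact: ord_leS.
- by move=> J f x ax H [i|].
- move=> J f i; apply: (@ord_le_sup _ _ _ (Some i)); exact: ord_le_refl.
Qed.

Lemma ord_add_monol a a' b : ord_le a a' -> ord_le (ord_add a b) (ord_add a' b).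
Proof.
move=> aa'; elim: b => [//|b IH|J f IH] //= [i|].
- exact: (@ord_le_sup _ _ _ (Some i)).
- exact: (@ord_le_sup _ _ _ None).
Qed.

Lemma ord_lt_add a b : ord_lt OZero b -> ord_lt a (ord_add a b).
Proof. by move=> /(ord_add_monor a). Qed.

Lemma ord_mul_monol a a' b : ord_le a a' -> ord_le (ord_mul a b) (ord_mul a' b).
Proof.
move=> aa'; elim: b => [//|b IH|J f IH] //=.
  by apply: ord_le_trans (ord_add_monol _ IH) _; exact: ord_add_monor.
by move=> i; apply: (@ord_le_sup _ _ _ i).
Qed.

Lemma ord_pow_omega_gt0 a : ord_lt OZero (ord_pow omega a).
Proof.
elim: a => [//|a IH|J f IH] /=; last by exists None.
by exists 1%N => /=; apply: ord_lt_le_trans IH _; elim: (ord_pow _ _) => //= J f IH i;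
  apply: (@ord_le_sup _ _ _ (Some i)).
Qed.

Lemma ord_add0 a : ord_le a (ord_add OZero a).
Proof.
by elim: a => //= J f IH i; apply: (@ord_le_sup _ _ _ (Some i)).
Qed.

Lemma ord_powS_gt a : ord_lt (ord_pow omega a) (ord_pow omega (OSucc a)).
Proof.
exists 2%N => /=; have a0 := ord_pow_omega_gt0 a.
apply: ord_lt_le_trans (ord_lt_add _ a0) _.
by apply: ord_add_monol; exact: ord_add0.
Qed.

Lemma ord_pow_mono a b : ord_le a b -> ord_le (ord_pow omega a) (ord_pow omega b).
Proof.
move: a b; apply: ord_mono.
- exact: ord_pow_omega_gt0.
- by move=> a; apply: ord_ltW; exact: ord_powS_gt.
- by move=> a b ab; exact: (ord_mul_monol omega ab).
- by move=> J f x x1 H [i|] //; exact: H.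
- by move=> J f i; apply: (@ord_le_sup _ _ _ (Some i)); exact: ord_le_refl.
Qed.

Lemma ord_le_pow a : ord_le a (ord_pow omega a).
Proof.
elim: a => [//|a IH|J f IH].
- exact: (ord_le_lt_trans IH (ord_powS_gt a)).
- by move=> i; apply: (@ord_le_sup _ _ _ (Some i)).
Qed.

(** A power of omega other than 1 is a limit: a multiple of omega never has a
    last element, and suprema preserve this. *)
Lemma ord_pow_limit a : ord_le (ord_pow omega a) (OSucc OZero) \/
  forall z, ord_lt z (ord_pow omega a) -> ord_lt (OSucc z) (ord_pow omega a).
Proof.
elim: a => [|a IH|J f IH]; first by left.
  right=> z [n zn]; exists n.+1.
  have zn' : ord_lt z (ord_mul (ord_pow omega a) (iter n OSucc OZero)) by [].
  exact: (ord_le_lt_trans zn' (ord_lt_add _ (ord_pow_omega_gt0 a))).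
have [[i Hi]|/forallNP H] := pselect (exists i, ~ ord_le (ord_pow omega (f i)) (OSucc OZero)).
  right; have L : forall z, ord_lt z (ord_pow omega (f i)) ->
      ord_lt (OSucc z) (ord_pow omega (f i)) by case: (IH i).
  have small z : ord_lt z (OSucc OZero) -> ord_lt (OSucc z) (ord_pow omega (OSup f)).
    move=> z1; apply: (@ord_lt_sup _ _ _ (Some i)); apply: L.
    exact: ord_le_lt_trans (z1 : ord_le z OZero) (ord_pow_omega_gt0 _).
  move=> z [[j|]] zj; last exact: small.
  have [fj1|{}L] := IH j; first by apply: small; exact: ord_lt_le_trans fj1.
  by apply: (@ord_lt_sup _ _ _ (Some j)); exact: L.
by left=> -[i|] //; apply: contrapT; exact: H.
Qed.

(** ** Countable ordinals *)

(** Boundedness by a presented countable ordinal is easier to carry through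
    arithmetic than enumerability: it is visibly stable under suprema of
    sequences. *)
Definition ord_cbound (a : ord) := exists c, ord_le a (ord_of_cord c).

Lemma cbound_sup (f : nat -> ord) : (forall n, ord_cbound (f n)) -> ord_cbound (OSup f).
Proof.
move=> /choice[c cP]; exists (CSup c) => n.
exact: (@ord_le_sup _ nat (fun n => ord_of_cord (c n)) n).
Qed.

Lemma cbound_le a b : ord_le a b -> ord_cbound b -> ord_cbound a.
Proof. by move=> ab [c bc]; exists c; exact: ord_le_trans bc. Qed.

Lemma cbound_add a b : ord_cbound a -> ord_cbound b -> ord_cbound (ord_add a b).
Proof.
move=> a1 [c /(ord_add_monor a)/cbound_le]; apply.
elim: c => [//|c [c' H]|f /choice[c H]] /=; first by exists (CSucc c').
have [a' aa'] := a1.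
exists (CSup (fun n => if n is m.+1 then c m else a')) => -[n|].
  exact: (@ord_le_sup _ _ _ n.+1).
exact: (@ord_le_sup _ _ _ 0%N).
Qed.

Lemma cbound_pow a : ord_cbound a -> ord_cbound (ord_pow omega a).
Proof.
move=> [c /ord_pow_mono/cbound_le]; apply.
elim: c => [|c IH|f /choice[c H]] /=; first by exists (CSucc CZero).
- apply: cbound_sup => n; elim: n => [|n IHn] /=; first by exists CZero.
  exact: cbound_add.
- exists (CSup (fun n => if n is m.+1 then c m else CSucc CZero)) => -[n|].
    exact: (@ord_le_sup _ _ _ n.+1).
  by exists 0%N.
Qed.

Lemma lt_omega1P a : ord_lt a omega1 <-> ord_cbound a.
Proof.
split=> [[c ac]|[c ac]]; first by exists c; exact: ord_ltW.
by exists (CSucc c).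
Qed.

Lemma lt_omega1_pow a : ord_lt a omega1 -> ord_lt (ord_pow omega a) omega1.
Proof. by move=> /lt_omega1P/cbound_pow/lt_omega1P. Qed.

(** * Ranks of trees *)

Lemma wf_minimal (A : Type) (r : A -> A -> Prop) (P : A -> Prop) : well_founded r ->
  (exists x, P x) -> exists2 x, P x & forall y, r y x -> ~ P y.
Proof.
move=> rwf [x Px]; apply: contrapT => N.
elim/(well_founded_ind rwf): x Px => x IH Px; apply: N.
by exists x => // y yx Py; exact: IH yx Py.
Qed.

(** The rank of the nodes, by its universal property: its value at a node is the
    supremum of the successors of its values strictly above. The equivalence
    determines it up to [ord_eq], which is all that derived trees can see. *)
Definition rank_fun d (T : porderType d) (q : T -> ord) :=
  forall t z, ord_lt z (q t) <-> exists2 s, (t < s)%O & ord_le z (q s).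

Section Rank.
Variables (d : Order.disp_t) (T : porderType d).
Implicit Types (q : T -> ord) (s t : T).

Lemma rank_fun_lt q s t : rank_fun q -> (t < s)%O -> ord_lt (q s) (q t).
Proof. by move=> qP ts; apply/qP; exists s => //; exact: ord_le_refl. Qed.

Lemma rank_fun_le q s t : rank_fun q -> (t <= s)%O -> ord_le (q s) (q t).
Proof.
move=> qP; rewrite le_eqVlt => /predU1P[->|/(rank_fun_lt qP)/ord_ltW //].
exact: ord_le_refl.
Qed.

Lemma rank_fun_exists : well_founded (fun s t : T => (t < s)%O) -> exists q, rank_fun q.
Proof.
move=> wf.
pose F t (rec : forall s, (t < s)%O -> ord) : ord :=
  OSup (fun s : {s | (t < s)%O} => OSucc (rec (sval s) (svalP s))).
exists (Fix wf _ F) => t z; rewrite Fix_eq; last first.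
  by move=> x f g fg; congr OSup; apply/funext => s; rewrite fg.
by split=> [[[s ts] zs]|[s ts zs]]; [exists s|exists (exist _ s ts)].
Qed.

Lemma tree_derP q xi t : rank_fun q -> @tree_der _ T xi t <-> ord_le xi (q t).
Proof.
move=> qP; elim: xi t => [//|z IH|J f IH] t; last first.
  by split=> [H i|H i _]; apply/IH; exact: H.
split=> [[Dt nmax]|/qP[s ts zs]].
  apply/qP; apply: contrapT => N; apply: nmax; split=> // s Ds ts.
  apply: contrapT => /eqP st; apply: N; exists s; first by rewrite lt_neqAle eq_sym st.
  exact/IH.
split; first by apply/IH; exact: ord_le_trans zs (rank_fun_le qP (ltW ts)).
move=> [_ /(_ s)]; rewrite (ltW ts) => /(_ _ isT) st.
by move: ts; rewrite st ?ltxx//; exact/IH.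
Qed.

Lemma node_rankE q t : rank_fun q -> ord_eq (node_rank t) (q t).
Proof.
move=> qP; have [|[]] := @ord_leastP (fun xi => (@tree_der _ T xi `\` @tree_der _ T (OSucc xi)) t).
  exists (q t); split; first by apply/(tree_derP _ _ qP); exact: ord_le_refl.
  by move/(tree_derP _ _ qP); exact: ord_lt_irr.
move=> /(tree_derP _ _ qP) le1 N _; split=> //.
by have [/(tree_derP _ _ qP)/N|] := ord_ltVge (node_rank t) (q t).
Qed.

Lemma tree_rankP q : rank_fun q -> @tree_der _ T (tree_rank T) = set0 /\
  forall xi, @tree_der _ T xi = set0 -> ord_le (tree_rank T) xi.
Proof.
move=> qP; apply: ord_leastP; exists (OSup (fun t => OSucc (q t))).
by apply/seteqP; split=> // t /(tree_derP _ _ qP)/(_ t)/ord_lt_irr.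
Qed.

Lemma lt_tree_rank q t : rank_fun q -> ord_lt (q t) (tree_rank T).
Proof.
move=> qP; apply/ord_ltNge => /(tree_derP _ _ qP).
by rewrite (tree_rankP qP).1.
Qed.

Lemma tree_rank_le q b : rank_fun q -> (forall t, ord_lt (q t) b) ->
  ord_le (tree_rank T) b.
Proof.
move=> qP qb; apply: (tree_rankP qP).2; apply/seteqP; split=> // t.
by move=> /(tree_derP _ _ qP) bq; case: (@ord_lt_irr b); exact: ord_le_lt_trans bq (qb t).
Qed.

End Rank.

Section WellFoundedTree.
Variables (d : Order.disp_t) (T : porderType d).
Hypothesis T_tree : is_tree T.
Implicit Types (s t : T) (A B : set T).

Lemma chain_below r s t : (r <= t)%O -> (s <= t)%O -> (r <= s)%O \/ (s <= r)%O.
Proof.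
move=> rt st; have := wochoice.wo_chainW (@T_tree t).
by move=> /(_ r s); rewrite !inE rt st => /(_ isT isT)/orP.
Qed.

Lemma tree_minimal A : A !=set0 -> exists2 t, A t & forall s, A s -> ~ (s < t)%O.
Proof.
move=> [x Ax]; have := @T_tree x => /(_ [pred s | (s <= x)%O && `[< A s >]])[].
- by move=> s; rewrite !inE => /andP[].
- by exists x; rewrite inE lexx; exact/asboolP.
move=> z [[]]; rewrite inE => /andP[zx /asboolP Az] zmin _; exists z => // s As sz.
have := zmin s; rewrite inE (le_trans (ltW sz) zx) => /(_ (asboolT As)) zs.
by have := le_lt_trans zs sz; rewrite ltxx.
Qed.

Lemma tree_root : rooted T -> T -> exists r, forall t, (r <= t)%O.
Proof.
have minT t : exists2 m, tree_min [set: T] m & (m <= t)%O.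
  have [|m mt mmin] := @tree_minimal [set s | (s <= t)%O]; first by exists t => /=.
  exists m => //; split=> // s _ sm; apply/eqP; apply: contrapT => /negP sm'.
  by apply: (mmin s); rewrite /= ?(le_trans sm)// lt_neqAle sm'.
move=> T_rooted t0; have [r rmin _] := minT t0; exists r => t.
by have [m mmin mt] := minT t; rewrite (T_rooted _ _ rmin mmin).
Qed.

Lemma tree_nextP s t : (t < s)%O -> exists2 c, tree_next t c & (c <= s)%O.
Proof.
move=> ts; have [|c [tc cs] cmin] := @tree_minimal [set c | (t < c)%O /\ (c <= s)%O].
  by exists s => /=.
exists c => //; split=> // r tr rc; apply/eqP; apply: contrapT => /negP rc'.
by apply: (cmin r); rewrite /= ?(le_trans rc)// lt_neqAle rc'.
Qed.

Hypothesis T_wf : well_founded_tree T.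

(** Zorn's lemma extends the chain to a branch, and branches are finite. *)
Lemma chain_finite A : tree_chain A -> finite_set A.
Proof.
move=> Ach.
have [F Fch|B [Bch Bmax]] := @Zorn_bigcup _ (fun B => tree_chain (A `|` B)).
  move=> Ftot s t [As|[B FB Bs]] [At|[C FC Ct]].
  - exact: Ach.
  - by apply: (Fch _ FC); [left|right].
  - by apply: (Fch _ FB); [right|left].
  - have [BC|CB] := Ftot _ _ FB FC.
      by apply: (Fch _ FC); right => //; exact: BC.
    by apply: (Fch _ FB); right => //; exact: CB.
apply: (@sub_finite_set _ _ (A `|` B)) => //.
apply: T_wf; split=> // C Cch ABC; apply/seteqP; split=> // x Cx; right.
apply: contrapT => nBx; apply: (Bmax C).
  by split=> [y By|/(_ _ Cx)//]; apply: ABC; right.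
by rewrite setUidr// => y Ay; apply: ABC; left.
Qed.

Lemma finite_below t : finite_set [set s | (s <= t)%O].
Proof. by apply: chain_finite => r s; exact: chain_below. Qed.

Lemma tree_gt_wf : well_founded (fun s t : T => (t < s)%O).
Proof.
move=> t0; apply: contrapT => N0.
have step (x : {t | ~ Acc (fun s t : T => (t < s)%O) t}) :
    exists y : {t | ~ Acc (fun s t : T => (t < s)%O) t}, (sval x < sval y)%O.
  case: x => t Nt /=; apply: contrapT => N; apply: Nt; constructor=> s ts.
  by apply: contrapT => Ns; apply: N; exists (exist _ s Ns).
have [h hP] := choice step.
pose f n := sval (iter n h (exist _ t0 N0)).
have f_lt m n : (m < n)%N -> (f m < f n)%O.
  elim: n => // n IH; rewrite ltnS leq_eqVlt => /predU1P[->|/IH mn]; first exact: hP.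
  exact: lt_trans mn (hP _).
have : finite_set (range f).
  apply: chain_finite => _ _ [m _ <-] [n _ <-].
  by have [/f_lt/ltW|/f_lt/ltW|->] := ltngtP m n; [left|right|left].
rewrite (eq_finite_set (inj_card_eq _)); first exact: infinite_nat.
move=> m n _ _ fmn; have [/f_lt|/f_lt|//] := ltngtP m n; by rewrite fmn ltxx.
Qed.

Lemma tree_parent s t : (s < t)%O ->
  exists2 p, (p < t)%O & forall r, (r < t)%O -> (r <= p)%O.
Proof.
move=> st; have [|p pt pmax] := wf_minimal tree_gt_wf (P := fun s => (s < t)%O).
  by exists s.
exists p => // r rt; have [//|] := chain_below (ltW rt) (ltW pt).
by rewrite le_eqVlt => /predU1P[->//|/pmax].
Qed.

(** Weighting a node by the codes of its predecessors grows strictly along the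
    order, and the code is kept as the lower part between consecutive squares. *)
Lemma tree_enum : countable [set: T] -> exists h : T -> nat,
  injective h /\ forall s t, (s < t)%O -> (h s < h t)%N.
Proof.
move=> /countable_injP[c cinj].
(* [D t] is the set of predecessors of [t], and [g t] their total weight. *)
pose D t := fset_set [set s | (s <= t)%O].
have inD s t : (s \in D t) = (s <= t)%O.
  rewrite in_fset_set; last exact: finite_below.
  by apply/idP/idP; rewrite inE.
pose g t := (\sum_(s <- D t) (c s).+1)%N.
have gS s t : (s < t)%O -> (g s < g t)%N.
  move=> st; rewrite /g (big_fsetID _ (mem (D s)) (D t))/=.
  rewrite (_ : [fset x in D t | x \in D s]%fset = D s); last first.
    apply/fsetP => x; rewrite !inE !inD andb_idl// => xs.
    exact: le_trans xs (ltW st).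
  rewrite [X in (_ < _ + X)%N](big_fsetD1 t)/=; last by rewrite !inE !inD lexx (lt_geF st).
  by rewrite addSn addnS ltnS leq_addr.
have cg t : (c t <= g t)%N.
  by rewrite /g (big_fsetD1 t) ?inD//= addSn leqW// leq_addr.
have sq_lt a b x : (a < b -> x <= a -> a ^ 2 + x < b ^ 2)%N.
  rewrite -(leq_exp2r _ _ (isT : 0 < 2)%N) -[a.+1]addn1 sqrnD => ab xa.
  by apply: leq_trans ab; lia.
exists (fun t => g t ^ 2 + c t)%N; split=> [s t|s t /gS st].
  move: (sq_lt (g s) (g t) (c s)) (sq_lt (g t) (g s) (c t)) (cg s) (cg t).
  have [_|_|->] := ltngtP (g s) (g t).
  - by move=> /(_ isT) + _ xs _ => /(_ xs); lia.
  - by move=> _ /(_ isT) + _ xt => /(_ xt); lia.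
  - by move=> _ _ _ _ /eqP; rewrite eqn_add2l => /eqP; apply: cinj; rewrite ?inE.
exact: leq_trans (sq_lt _ _ _ st (cg s)) (leq_addr _ _).
Qed.

End WellFoundedTree.

(** * Szlenk derivations *)

Section PointwiseTopology.
Variables (R : realType) (k : scalar_kind).
Local Notation K := (scalar_field R k)^o.

Lemma of_real_gt0 (e : R) : 0 < e -> 0 < of_real k e.
Proof. by rewrite -(of_real_lt k) of_real0. Qed.

Lemma ptws_basis (J : choiceType) (O : set {ptws J -> K}) (f : J -> K) : open O -> O f ->
  exists (s : seq J) (c : R), 0 < c /\
    forall g : J -> K, (forall i, i \in s -> rnorm (g i - f i) < c) -> O g.
Proof.
move=> Oopen Of.
pose D := [set p : seq J * R | 0 < p.2].
pose W (p : seq J * R) := [set g : J -> K | forall i, i \in p.1 -> rnorm (g i - f i) < p.2].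
have FF : Filter (filter_from D W).
  apply: filter_from_filter; first by exists ([::], 1); rewrite /D /= ltr01.
  move=> [s c] [s' c'] /= c0 c0'; exists (s ++ s', Num.min c c') => /=.
    by rewrite /D/= lt_min c0.
  move=> g gW; split=> i /= iS.
    by have := gW i; rewrite mem_cat iS => /(_ isT); rewrite lt_min => /andP[].
  by have := gW i; rewrite mem_cat iS orbT => /(_ isT); rewrite lt_min => /andP[].
have : (filter_from D W) --> (f : {ptws J -> K}).
  apply/cvg_sup => i A; rewrite nbhsE => -[B [[C Copen <-] Cf] CA].
  have /nbhs_ballP[e /= e0 eC] : nbhs (f i) C by exact: open_nbhs_nbhs.
  have eE : of_real k (to_real e) = e by rewrite to_realK// gtr0_real.
  exists ([:: i], to_real e).
    by rewrite /D /= -(of_real_lt k) of_real0 eE.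
  move=> g /= /(_ i); rewrite mem_head => /(_ isT) gi; apply: CA; apply: eC.
  by rewrite -ball_normE /= -rnormK -eE of_real_lt rnormB.
move=> /(_ O); rewrite nbhsE => H.
have [|[s c] c0 sO] := H; first by exists O => //; split.
by exists s, c; split=> // g gs; exact: sO.
Qed.

Lemma ptws_ball_open (J : choiceType) (i : J) (a : K) (c : R) :
  open [set g : {ptws J -> K} | rnorm (g i - a) < c].
Proof.
rewrite (_ : [set _ | _] = (fun g : {ptws J -> K} => g i) @^-1` ball a (of_real k c)).
  apply: open_comp; last exact: ball_open.
  by move=> g _; exact: (@proj_continuous J (fun=> K) i g).
apply/seteqP; split=> g /=; rewrite -ball_normE /= -rnormK of_real_lt rnormB //.
Qed.

Lemma ptws_near_open (J : choiceType) (s : seq J) (f : J -> K) (c : R) :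
  open [set g : {ptws J -> K} | forall i, i \in s -> rnorm (g i - f i) < c].
Proof.
elim: s => [|i s IH].
  by rewrite (_ : [set _ | _] = setT); [exact: openT|apply/seteqP; split].
rewrite (_ : [set _ | _] = [set g : {ptws J -> K} | rnorm (g i - f i) < c] `&`
   [set g : {ptws J -> K} | forall j, j \in s -> rnorm (g j - f j) < c]).
  by apply: openI IH; exact: ptws_ball_open.
apply/seteqP; split=> [g H|g [H1 H2] j]; last by rewrite inE => /predU1P[->|/H2].
by split=> [|j js]; apply: H; rewrite inE ?eqxx ?js ?orbT.
Qed.

End PointwiseTopology.

Section WeakStar.
Variables (R : realType) (k : scalar_kind).
Local Notation K := (scalar_field R k).
Implicit Types V : normedModType K.

Definition wball V (f : dual_space V) (s : seq V) (c : R) : set (dual_space V) :=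
  [set g | forall v, v \in s -> rnorm (g v - f v : K^o) < c].

Lemma wball_center V (f : dual_space V) s c : 0 < c -> wball f s c f.
Proof. by move=> c0 v _; rewrite subrr rnorm0. Qed.

Lemma wball_open V (f : dual_space V) s c : open (wball f s c : set (weak_star V)).
Proof.
exists [set g : {ptws V -> K^o} | forall v, v \in s -> rnorm (g v - f v) < c] => //.
exact: ptws_near_open.
Qed.

Lemma wball_basis V (U : set (weak_star V)) f : open U -> U f ->
  exists s c, 0 < c /\ wball f s c `<=` U.
Proof.
move=> [B Bopen <-] /= /(ptws_basis Bopen)[s [c [c0 H]]].
by exists s, c; split=> // g gs; exact: H.
Qed.

Definition far V (e : R) (g h : dual_space V) :=
  exists2 x : V, rnorm x <= 1 & e < rnorm (g x - h x : K^o).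

Lemma lt_dual_diam V (A : set (dual_space V)) e : (e%:E < dual_diam A)%E <->
  exists g h, [/\ A g, A h & far e g h].
Proof.
split=> [/ereal_sup_gt[_ [g Ag [h Ah <-]]]|[g [h [Ag Ah [x x1 egh]]]]].
  move=> /ereal_sup_gt[_ [x x1 <-]]; rewrite lte_fin => egh.
  by exists g, h; split=> //; exists x.
apply: (@lt_le_trans _ _ (rnorm (g x - h x : K^o))%:E); first by rewrite lte_fin.
apply: (@le_trans _ _ (op_norm (fun x => g x - h x : K^o))).
  by apply: ereal_sup_ubound; exists x.
by apply: ereal_sup_ubound; exists g => //; exists h.
Qed.

(** Derivations can be tested on finitely many evaluations at a time. *)
Lemma szlenk_derP V e (A : set (dual_space V)) f : szlenk_der e A f <->
  A f /\ forall s c, 0 < c -> exists g h,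
    [/\ A g, A h, wball f s c g, wball f s c h & far e g h].
Proof.
split=> -[Af H]; split=> //.
  move=> s c c0; have := H _ (wball_open f s c) (@wball_center _ f s c c0).
  by move=> /lt_dual_diam[g [h [[gs Ag] [hs Ah] gh]]]; exists g, h.
move=> U /wball_basis bU /bU[s [c [c0 sU]]].
have [g [h [Ag Ah gs hs gh]]] := H s c c0.
by apply/lt_dual_diam; exists g, h; split=> //; split=> //; exact: sU.
Qed.

(** Derivations are functorial along weak*-continuous maps that control
    distances from below; this is used for inclusions and for midpoints. *)
Lemma szlenk_iter_map V V' (Phi : dual_space V -> dual_space V') e e' A A' :
  (forall f, A f -> A' (Phi f)) ->
  (forall f s c, 0 < c -> exists s' c', 0 < c' /\
     forall g, wball f s' c' g -> wball (Phi f) s c (Phi g)) ->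
  (forall g h, far e g h -> far e' (Phi g) (Phi h)) ->
  forall xi f, szlenk_iter e A xi f -> szlenk_iter e' A' xi (Phi f).
Proof.
move=> AA' Pcont Pfar; elim=> [//|xi IH|J z IH] f /=.
  move=> /szlenk_derP[/IH fxi H]; apply/szlenk_derP; split=> // s c c0.
  have [s' [c' [c0' ss']]] := Pcont f s c c0.
  have [g [h [/IH Ag /IH Ah /ss' gs /ss' hs /Pfar gh]]] := H s' c' c0'.
  by exists (Phi g), (Phi h).
by move=> [/AA' Af H]; split=> // j _; apply: IH; exact: H.
Qed.

Lemma szlenk_iter_subset V e e' (A A' : set (dual_space V)) xi : e' <= e ->
  A `<=` A' -> szlenk_iter e A xi `<=` szlenk_iter e' A' xi.
Proof.
move=> ee' AA' f; apply: (@szlenk_iter_map _ _ id) => //.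
  by move=> g s c c0; exists s, c.
by move=> g h [x x1 gh]; exists x => //; exact: le_lt_trans gh.
Qed.

Lemma szlenk_iter_sub V e (A : set (dual_space V)) xi : szlenk_iter e A xi `<=` A.
Proof. by elim: xi => [//|xi IH|J z IH] f /= [// /IH]. Qed.

Lemma szlenk_iter_le V e (A : set (dual_space V)) a b : ord_le a b ->
  szlenk_iter e A b `<=` szlenk_iter e A a.
Proof.
elim: a b => [|a IHa|J z IH] b; first by move=> _; exact: szlenk_iter_sub.
  elim: b => [//|b _ ab|J z IH [j /IH zj]] f /=.
    exact: (@szlenk_iter_subset _ _ _ _ _ (OSucc OZero) (lexx e) (IHa b ab)).
  by move=> [_ /(_ j I)/zj].
by move=> zb f fb; split=> [|j _]; [exact: szlenk_iter_sub fb|exact: (IH j b)].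
Qed.

Lemma szlenk_iter_add V e (A : set (dual_space V)) a b :
  szlenk_iter e (szlenk_iter e A a) b `<=` szlenk_iter e A (ord_add a b).
Proof.
elim: b => [//|b IH|J z IH] f /=.
  exact: (@szlenk_iter_subset _ _ _ _ _ (OSucc OZero) (lexx e) IH).
move=> [fa fz]; split=> [|[j|] _]; [exact: szlenk_iter_sub fa| |exact: fa].
by apply: IH; exact: fz.
Qed.

Lemma half_norm : rnorm (2^-1 : K^o) = 2^-1.
Proof.
rewrite /rnorm (_ : 2^-1 = of_real k 2^-1).
  by rewrite ger0_norm ?of_realK// -(of_real0 R k) of_real_le invr_ge0.
by case: (k) => //=; rewrite rmorphV ?unitfE// rmorph_nat.
Qed.

Section Combination.
Variables (V W : normedModType K) (a b : K) (f g : operator V W).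

Definition op_comb_fun x := a *: f x + b *: g x.

Lemma op_comb_linear : linear op_comb_fun.
Proof.
move=> c x y; rewrite /op_comb_fun (linearP f) (linearP g) !scalerDr !scalerA.
by rewrite (mulrC a) (mulrC b) addrACA.
Qed.

HB.instance Definition _ := GRing.isLinear.Build K V W _ op_comb_fun op_comb_linear.

Lemma op_comb_bounded : exists M, forall x, `|op_comb_fun x| <= M * `|x|.
Proof.
have [M Mf] := op_bounded f; have [N Ng] := op_bounded g.
exists (`|a| * M + `|b| * N) => x; apply: le_trans (ler_normD _ _) _.
by rewrite !normrZ mulrDl -!mulrA lerD// ler_wpM2l.
Qed.

Definition op_comb : operator V W := Operator op_comb_bounded.
End Combination.

Lemma operator_ext (V W : normedModType K) (f g : operator V W) : f =1 g -> f = g.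
Proof.
case: f g => [f fP] [g gP] /= /funext fg.
have {}fg : f = g.
  case: f g fg {fP gP} => [f [[fA] [fB]]] [g [[gA] [gB]]] /= fg.
  by move: fA fB gA gB; rewrite fg => fA fB gA gB; do 3 f_equal; exact: Prop_irrelevance.
by move: fP gP; rewrite fg => fP gP; congr Operator; exact: Prop_irrelevance.
Qed.

Definition mid V (f g : dual_space V) : dual_space V := op_comb 2^-1 2^-1 f g.

Lemma midE V (f g : dual_space V) x : mid f g x = (2^-1 * (f x + g x))%R.
Proof. by rewrite mulrDr. Qed.

Lemma mid_id V (f : dual_space V) : mid f f = f.
Proof.
by apply: operator_ext => x; rewrite -[RHS]scale1r (splitr 1) !div1r scalerDl.
Qed.

Lemma midC V (f g : dual_space V) : mid f g = mid g f.
Proof. by apply: operator_ext => x; rewrite !midE addrC. Qed.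

Lemma szlenk_iter_mid V e (A B : set (dual_space V)) y xi f :
  (forall g, A g -> B (mid g y)) -> szlenk_iter e A xi f ->
  szlenk_iter (e / 2) B xi (mid f y).
Proof.
have midB (g h : dual_space V) x : rnorm (mid g y x - mid h y x : K^o) =
    2^-1 * rnorm (g x - h x : K^o).
  rewrite !midE -mulrBr opprD addrACA subrr addr0.
  by rewrite -half_norm -(rnormZ (V := K^o)).
move=> AB; move: xi f; apply: (@szlenk_iter_map V V (fun f => mid f y) e (e / 2) A B) => //.
  move=> f s c c0; exists s, c; split=> // g gs x xs; rewrite midB.
  apply: le_lt_trans (gs x xs); rewrite ler_piMl ?rnorm_ge0//.
  by rewrite invf_le1 ?ler1n.
by move=> g h [x x1 gh]; exists x => //; rewrite midB mulrC ltr_pM2l// invr_gt0.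
Qed.

(** The translates [mid y f0] of the set all lie in the derived set of order xi
    as soon as [f0] does; deriving them once more as a copy of the whole set
    adds up the orders, at the price of halving the distance. *)
Lemma szlenk_iter_double V e (A : set (dual_space V)) f0 xi zeta :
  (forall f g, A f -> A g -> A (mid f g)) ->
  szlenk_iter e A xi f0 -> szlenk_iter e A zeta f0 ->
  szlenk_iter (e / 2) A (ord_add xi zeta) f0.
Proof.
move=> Amid fxi fzeta; apply: szlenk_iter_add.
have Af := szlenk_iter_sub fxi.
pose A1 := [set mid y f0 | y in A].
apply: (@szlenk_iter_subset _ (e / 2) (e / 2) A1) => //.
  move=> _ [y Ay <-]; rewrite midC.
  by apply: szlenk_iter_mid fxi => g Ag; exact: Amid.
by rewrite -(mid_id f0); apply: szlenk_iter_mid fzeta => g Ag; exists g.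
Qed.

(** Each doubling halves the distance, whence the power of 2. *)
Lemma szlenk_iter_mul V e (A : set (dual_space V)) f0 xi n : 0 < e ->
  (forall f g, A f -> A g -> A (mid f g)) -> szlenk_iter e A xi f0 ->
  szlenk_iter (e / 2 ^+ n) A (ord_mul xi (iter n OSucc OZero)) f0.
Proof.
move=> e0 Amid fxi; elim: n => [|n IH]; first exact: szlenk_iter_sub fxi.
rewrite exprS invfM (mulrC 2^-1) mulrA; apply: szlenk_iter_double => //.
apply: szlenk_iter_subset fxi => //.
by rewrite ler_pdivrMr ?exprn_gt0// ler_peMr ?(ltW e0)// exprn_ege1// ler1n.
Qed.

Lemma op_norm_le1 (V W : normedModType K) (f : V -> W) : (op_norm f <= 1)%E <->
  forall x, rnorm x <= 1 -> rnorm (f x) <= 1.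
Proof.
split=> [/ereal_supP H x x1|H]; first by rewrite -lee_fin; apply: H; exists x.
by apply/ereal_supP => _ [x x1 <-]; rewrite lee_fin; exact: H.
Qed.

Lemma adjoint_ball_mid (V W : normedModType K) (T : operator V W) f g :
  (adjoint T @` @dual_ball R k W) f -> (adjoint T @` @dual_ball R k W) g ->
  (adjoint T @` @dual_ball R k W) (mid f g).
Proof.
move=> [y /op_norm_le1 y1 <-] [z /op_norm_le1 z1 <-]; exists (mid y z); last exact: operator_ext.
apply/op_norm_le1 => x x1; rewrite midE.
rewrite [X in rnorm X](_ : _ = 2^-1 *: (y x + z x : K^o))// rnormZ half_norm.
rewrite mulrC ler_pdivrMr// mul1r; apply: le_trans (rnormD _ _) _.
by rewrite -[leRHS]/(1 + 1) lerD ?y1 ?z1.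
Qed.

(** If every distance lost all points by the stage [omega ^ alpha], then all the
    indices would exist and be at most [omega ^ alpha]. *)
Lemma non_szlenkP (V W : normedModType K) (T : operator V W) alpha :
  ~ is_szlenk alpha T -> exists e, 0 < e /\ exists f,
    szlenk_iter e (adjoint T @` @dual_ball R k W) (ord_pow omega alpha) f.
Proof.
apply: contra_notP => /forallNP H.
have emp e : 0 < e ->
    szlenk_iter e (adjoint T @` @dual_ball R k W) (ord_pow omega alpha) = set0.
  move=> e0; apply/seteqP; split=> // f fe; apply: (H e); split=> //; by exists f.
split=> [e e0|[e e0]]; first by exists (ord_pow omega alpha); exact: emp.
apply: (ord_leastP _).2; last exact: emp.
by exists (ord_pow omega alpha); exact: emp.
Qed.

Lemma non_szlenk_iter (V W : normedModType K) (T : operator V W) alpha e f : 0 < e ->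
  szlenk_iter e (adjoint T @` @dual_ball R k W) (ord_pow omega alpha) f ->
  ~ is_szlenk alpha T.
Proof.
move=> e0 fe [Tdef /(_ (exist _ e e0)) le_a].
have [S0 _] := ord_leastP (Tdef e e0).
by have := szlenk_iter_le le_a fe; rewrite [szlenk_iter _ _ _]S0.
Qed.

End WeakStar.

(** * The space of summable families *)

Section Operators.
Variables (R : realType) (k : scalar_kind).
Local Notation K := (scalar_field R k).

(** The bound of an operator is a scalar that need not be real or positive; its
    absolute value serves as well. *)
Lemma op_rbound (V W : normedModType K) (f : operator V W) :
  exists2 M : R, 0 < M & forall x, rnorm (f x) <= M * rnorm x.
Proof.
have [M Mf] := op_bounded f; exists (rnorm (M : K^o) + 1).
  by rewrite ltr_pwDr// rnorm_ge0.
move=> x; apply: (@le_trans _ _ (rnorm (M : K^o) * rnorm x)); last first.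
  by rewrite ler_wpM2r ?rnorm_ge0// lerDl.
rewrite -(of_real_le k) of_realM !rnormK (le_trans (Mf x))//.
rewrite -[leLHS]ger0_norm; first by rewrite normrM normr_id.
exact: le_trans (normr_ge0 _) (Mf x).
Qed.

Lemma real_bounded (V W : normedModType K) (f : V -> W) (M : R) :
  (forall x, rnorm (f x) <= M * rnorm x) -> exists M' : K, forall x, `|f x| <= M' * `|x|.
Proof.
by move=> Mf; exists (of_real k M) => x; rewrite -!rnormK -of_realM of_real_le.
Qed.

Definition op_id (V : normedModType K) : operator V V.
Proof.
apply: (@Operator _ _ _ (@idfun V)).
by exists 1 => x; rewrite mul1r.
Defined.

Definition op_zero (V W : normedModType K) : operator V W.
Proof.
apply: (@Operator _ _ _ (\0 : {linear V -> W})).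
by exists 0 => x; rewrite normr0 mul0r.
Defined.

Lemma op_idE (V : normedModType K) (x : V) : op_id V x = x.
Proof. by []. Qed.

Definition op_comp (V W Z : normedModType K) (g : operator W Z) (f : operator V W) :
  operator V Z.
Proof.
refine (@Operator _ _ _ (g \o f) _).
have [M M0 Mf] := op_rbound f; have [N N0 Ng] := op_rbound g.
apply: (@real_bounded _ _ _ (N * M)) => x /=; apply: le_trans (Ng _) _.
by rewrite -mulrA ler_wpM2l// ltW.
Defined.

Lemma op_compE (V W Z : normedModType K) (g : operator W Z) (f : operator V W) x :
  op_comp g f x = g (f x).
Proof. by []. Qed.

(** The contraction [y |-> x - E y] has a fixed point. *)
Lemma near_identity_solve (V : completeNormedModType K) (E : operator V V) :
  (forall x, rnorm (E x) <= 2^-1 * rnorm x) ->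
  forall x, exists2 y, rnorm y <= 2 * rnorm x & y + E y = x.
Proof.
move=> E12 x; pose y n := iter n (fun y => x - E y) (0 : V).
have yS n : rnorm (y n.+1 - y n) <= rnorm x * 2^-1 ^+ n.
  elim: n => [|n IH]; first by rewrite /y /= linear0 subr0 subr0 mulr1.
  have -> : y n.+2 - y n.+1 = E (y n - y n.+1).
    rewrite (linearB E); transitivity ((x - E (y n.+1)) - (x - E (y n))) => //.
    by rewrite opprB addrC subrKA.
  apply: le_trans (E12 _) _; rewrite rnormB exprS mulrCA ler_wpM2l ?invr_ge0//.
have yD n m : rnorm (y (n + m)%N - y n) <= 2 * rnorm x * (2^-1 ^+ n - 2^-1 ^+ (n + m)).
  elim: m => [|m IH]; first by rewrite addn0 !subrr rnorm0 mulr0.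
  rewrite addnS -(subrKA (y (n + m)%N)).
  apply: le_trans (rnormD _ _) _; apply: le_trans (lerD (yS _) IH) _.
  by rewrite exprS; have := rnorm_ge0 x; nra.
have y0 n : rnorm (y n) <= 2 * rnorm x.
  have := yD 0%N n; rewrite add0n subr0 expr0 => /le_trans; apply.
  rewrite ler_piMr ?mulr_ge0 ?rnorm_ge0// gerBl exprn_ge0 ?invr_ge0//.
have tail (e : R) : 0 < e -> exists N, forall n, (N <= n)%N -> rnorm (y n - y N) < e.
  move=> e0; have [N xN] : exists N, 2 * rnorm x * 2^-1 ^+ N < e.
    exists (Num.bound (2 * rnorm x / e)); rewrite exprVn ltr_pdivrMr ?exprn_gt0//.
    by rewrite -ltr_pdivrMl// [_^-1 * _]mulrC upper_nthrootP.
  exists N => n Nn; rewrite -(subnKC Nn); apply: le_lt_trans (yD _ _) _.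
  apply: le_lt_trans xN; rewrite ler_wpM2l ?mulr_ge0 ?rnorm_ge0//.
  by rewrite gerBl exprn_ge0 ?invr_ge0.
have /cvg_ex[z yz] : cvg (y @ \oo).
  apply: cauchy_cvg; apply/cauchy_exP => e e0.
  have eE : of_real k (to_real e) = e by rewrite to_realK// gtr0_real.
  have {}e0 : 0 < to_real e by rewrite -(of_real_lt k) of_real0 eE.
  have [N yN] := tail _ e0; exists (y N); exists N => // n /= Nn.
  by rewrite -ball_normE /= -rnormK -eE of_real_lt rnormB yN.
have near_z (e : R) : 0 < e -> exists N, forall n, (N <= n)%N -> rnorm (z - y n) < e.
  move=> e0; have /cvg_ballP/(_ (of_real k e)) := yz.
  move=> /(_ (of_real_gt0 k e0))[N _ yN]; exists N => n /yN.
  by rewrite /= -ball_normE /= -rnormK of_real_lt.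
have zE e : 0 < e -> rnorm (z + E z - x) <= e.
  move=> e0; have [N zN] := near_z (e / 2) (divr_gt0 e0 (ltr0Sn _ 1)).
  have -> : z + E z - x = (z - y N.+1) + E (z - y N).
    rewrite (linearB E) (_ : y N.+1 = x - E (y N))//.
    by rewrite opprB [E (y N) - x]addrC [z + (_ + _)]addrA -[RHS]addrA subrKC addrAC.
  apply: le_trans (rnormD _ _) _; have := zN N.+1 (leqnSn _).
  have := le_lt_trans (E12 _) (_ : _ < e / 2); have := zN N (leqnn _).
  have := E12 (z - y N); have := rnorm_ge0 (z - y N); lra.
exists z.
  apply/ler_addgt0Pr => e e0; have [N /(_ N (leqnn _)) zN] := near_z e e0.
  rewrite -(subrK (y N) z) addrC; apply: le_trans (rnormD _ _) _.
  by rewrite lerD// ltW.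
apply/eqP; rewrite -subr_eq0; apply/eqP; apply: rnorm0_eq0; apply/eqP.
rewrite eq_le rnorm_ge0 andbT; apply/ler_addgt0Pr => e e0.
by rewrite add0r zE.
Qed.

End Operators.

Section Ell1.
Variables (R : realType) (k : scalar_kind) (I : choiceType).
Local Notation K := (scalar_field R k).
Implicit Types (i j : I) (w : ell1 R k I).

Lemma fncoord_linear (N : fnorm R k I) i :
  linear (fun f : fnspace N => f i : K^o).
Proof. by []. Qed.

Definition fncoord (N : fnorm R k I) i : operator (fnspace N) K^o.
Proof.
pose L := GRing.isLinear.Build _ _ _ _ _ (@fncoord_linear N i).
pose F : {linear fnspace N -> K^o} := HB.pack (fun f : fnspace N => f i : K^o) L.
apply: (@Operator _ _ _ F).
by apply: (@real_bounded _ _ _ _ _ 1) => x; rewrite mul1r fnspace_pt.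
Defined.

Lemma rnorm1 : rnorm (1 : K^o) = 1.
Proof.
rewrite /rnorm normr1 -[RHS](of_realK k); congr to_real; by case: (k).
Qed.

Lemma ell1_rnorm_le w x : rnorm w <= x <->
  forall A : {fset I}, \sum_(i <- A) rnorm (w i) <= x.
Proof.
rewrite -lee_fin fnspace_rnormE; split=> [/ell1_normP H A|H].
  by rewrite -lee_fin.
by apply/ell1_normP => A; rewrite lee_fin.
Qed.

Lemma unit_vector_fin i :
  (fun j => if j == i then 1 else 0 : K^o) \in finite_fnorm (ell1_fnorm R k I).
Proof.
rewrite inE; apply: (@le_lt_trans _ _ 1%:E); last exact: ltry.
apply/ell1_normP => A; rewrite lee_fin.
have [iA|iA] := boolP (i \in A).
  rewrite (big_fsetD1 i)//= eqxx rnorm1 big1_seq ?addr0// => j.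
  by rewrite !inE => /and3P[_ /negPf-> _]; rewrite rnorm0.
rewrite big1_seq ?ler01// => j /andP[_ jA]; case: eqP => [ji|_]; last exact: rnorm0.
by move: iA; rewrite -ji jA.
Qed.

Definition unit_vector i : ell1 R k I := FnSpace (unit_vector_fin i).
Arguments unit_vector : simpl never.

Lemma unit_vectorE i j : unit_vector i j = if j == i then 1 else 0.
Proof. by []. Qed.

Lemma unit_vector_norm i : rnorm (unit_vector i) <= 1.
Proof.
apply/ell1_rnorm_le => A; have [iA|iA] := boolP (i \in A).
  rewrite (big_fsetD1 i)//= eqxx rnorm1 big1_seq ?addr0// => j.
  by rewrite !inE => /and3P[_ ji _]; rewrite /= (negPf ji) rnorm0.
rewrite big1_seq ?ler01// => j /andP[_ jA]; rewrite unit_vectorE.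
case: eqP => [ji|_]; last exact: rnorm0.
by move: iA; rewrite -ji jA.
Qed.

Lemma ell1_tail w (e : R) : 0 < e -> exists A : {fset I}, forall C : {fset I},
  (forall i, i \in C -> i \notin A) -> \sum_(i <- C) rnorm (w i) <= e.
Proof.
move=> e0; have [A HA] : exists A : {fset I}, rnorm w - e < \sum_(i <- A) rnorm (w i).
  apply: contrapT => /forallNP N; have : rnorm w <= rnorm w - e.
    by apply/ell1_rnorm_le => A; have /negP := N A; rewrite -leNgt.
  by rewrite lerBrDr gerDl leNgt e0.
exists A => C CA; have := (ell1_rnorm_le w _).1 (lexx _) (A `|` C)%fset.
rewrite (big_fsetID _ (mem A))/=.
rewrite [X in X + _](_ : _ = \sum_(i <- A) rnorm (w i)); last first.
  by apply: eq_fbigl => i; rewrite !inE andb_orl andbb; case: (i \in A); rewrite ?andbF.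
rewrite [X in _ + X](_ : _ = \sum_(i <- C) rnorm (w i)); last first.
  apply: eq_fbigl => i; rewrite !inE; have := CA i.
  by case: (i \in A); case: (i \in C) => //= /(_ isT).
by move: HA; lra.
Qed.

Definition ell1_trunc w (A : {fset I}) : ell1 R k I :=
  \sum_(i <- A) w i *: unit_vector i.

Lemma ell1_truncE w A j : ell1_trunc w A j = if j \in A then w j else 0.
Proof.
have -> : ell1_trunc w A j = \sum_(i <- A) (if j == i then w i else 0).
  rewrite /ell1_trunc; elim: (enum_fset A) => [|i s IH]; first by rewrite !big_nil.
  rewrite !big_cons -IH.
  rewrite [LHS](_ : _ = w i * unit_vector i j + (\sum_(i <- s) w i *: unit_vector i) j)//.
  by rewrite unit_vectorE; case: eqP => _; rewrite ?mulr1 ?mulr0.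
have [jA|jA] := boolP (j \in A).
  rewrite (big_fsetD1 j)//= eqxx big1_seq ?addr0// => i.
  by rewrite !inE => /and3P[_ ij _]; rewrite eq_sym (negPf ij).
rewrite big1_seq// => i /andP[_ iA]; case: eqP => // ji.
by move: jA; rewrite ji iA.
Qed.

Lemma ell1_trunc_cvg w (e : R) : 0 < e -> exists A : {fset I},
  rnorm (w - ell1_trunc w A) <= e.
Proof.
move=> e0; have [A HA] := ell1_tail w e0; exists A; apply/ell1_rnorm_le => C.
have E i : (w - ell1_trunc w A) i = if i \in A then 0 else w i.
  rewrite [LHS](_ : _ = w i - ell1_trunc w A i)// ell1_truncE.
  by case: ifP; rewrite ?subrr ?subr0.
under eq_bigr do rewrite E.
rewrite (big_fsetID _ (mem A))/= big1_seq ?add0r; last first.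
  by move=> i; rewrite !inE => /and3P[_ _ ->]; rewrite rnorm0.
apply: le_trans (HA [fset i in C | i \notin A]%fset _); last first.
  by move=> i; rewrite !inE => /andP[].
by rewrite big_seq [leRHS]big_seq; apply: ler_sum => i; rewrite !inE => /andP[_ /negPf ->].
Qed.

(** Finite truncations are dense, and on them the estimate is the triangle
    inequality. *)
Lemma ell1_op_bound (V : normedModType K) (f : operator (ell1 R k I) V) (M : R) :
  0 <= M -> (forall i, rnorm (f (unit_vector i)) <= M) ->
  forall w, rnorm (f w) <= M * rnorm w.
Proof.
move=> M0 fM w; have [N N0 fN] := op_rbound f.
apply/ler_addgt0Pr => e e0.
have [A wA] := ell1_trunc_cvg w (divr_gt0 e0 N0).
rewrite -(subrK (ell1_trunc w A) w) (linearD f) addrC.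
apply: le_trans (rnormD _ _) _; apply: lerD; last first.
  by apply: le_trans (fN _) _; rewrite -ler_pdivlMl// mulrC.
rewrite subrK /ell1_trunc.
apply: (@le_trans _ _ (\sum_(i <- A) rnorm (w i) * M)).
  elim: (enum_fset A) => [|i s IH]; first by rewrite !big_nil (linear0 f) rnorm0.
  rewrite !big_cons (linearD f); apply: le_trans (rnormD _ _) _; rewrite lerD//.
  by rewrite (linearZ_LR f) rnormZ ler_wpM2l ?rnorm_ge0.
by rewrite -mulr_suml mulrC ler_wpM2l//; apply: (ell1_rnorm_le w _).1.
Qed.

Lemma ell1_op_ext (V : normedModType K) (f g : operator (ell1 R k I) V) :
  (forall i, f (unit_vector i) = g (unit_vector i)) -> forall w, f w = g w.
Proof.
move=> fg w; have := @ell1_op_bound _ (op_comb 1 (-1) f g) 0 (lexx _).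
have E x : op_comb 1 (-1) f g x = f x - g x by rewrite /= /op_comb_fun scale1r scaleN1r.
have H i : rnorm (op_comb 1 (-1) f g (unit_vector i)) <= 0.
  by rewrite E fg subrr rnorm0.
move=> /(_ H w); rewrite mul0r E => le0; apply/eqP; rewrite -subr_eq0; apply/eqP.
by apply: rnorm0_eq0; apply/eqP; rewrite eq_le le0 rnorm_ge0.
Qed.

Section Extension.
Variables (X : completeNormedModType K) (x : I -> X) (M : R).
Hypothesis x_le : forall i, rnorm (x i) <= M.

Let term w i : X := w i *: x i.

Lemma partial_sum_termE w (A : {fset I}) :
  partial_sum (term w) A = \sum_(i <- A) w i *: x i.
Proof. by rewrite /partial_sum big_seq_fsetE. Qed.

Lemma rnorm_sum_term w (A : {fset I}) :
  rnorm (partial_sum (term w) A) <= M * \sum_(i <- A) rnorm (w i).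
Proof.
rewrite partial_sum_termE mulr_sumr.
elim: (enum_fset A) => [|i s IH]; first by rewrite !big_nil rnorm0.
rewrite !big_cons; apply: le_trans (rnormD _ _) _; rewrite lerD//.
by rewrite rnormZ mulrC ler_wpM2r ?rnorm_ge0.
Qed.

Lemma term_cvg w : cvg (partial_sum (term w) @ totally).
Proof.
have TF : ProperFilter (@totally I) := totally_filter.
apply: cauchy_cvg; apply/cauchy_exP => e e0.
have eE : of_real k (to_real e) = e by rewrite to_realK// gtr0_real.
have {}e0 : 0 < to_real e by rewrite -(of_real_lt k) of_real0 eE.
(* [M] need not be positive, since the family may be empty. *)
pose N := Num.max M 0 + 1.
have N0 : 0 < N by rewrite ltr_pwDr// le_max lexx orbT.
have [A HA] := ell1_tail w (divr_gt0 e0 (mulr_gt0 (ltr0Sn R 1) N0)).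
exists (partial_sum (term w) A); exists A => // C /= AC.
rewrite -ball_normE /= -rnormK -eE of_real_lt rnormB.
have -> : partial_sum (term w) C - partial_sum (term w) A =
    partial_sum (term w) [fset i in C | i \notin A]%fset.
  rewrite !partial_sum_termE (big_fsetID _ (mem A) C)/= addrC.
  rewrite [X in _ + X - _](_ : _ = \sum_(i <- A) w i *: x i) ?addrK//.
  by apply: eq_fbigl => i; rewrite !inE andb_idl//; exact: (fsubsetP AC).
apply: le_lt_trans (rnorm_sum_term _ _) _.
have H : \sum_(i <- [fset i in C | i \notin A]%fset) rnorm (w i) <= to_real e / (2 * N).
  by apply: HA => i; rewrite !inE => /andP[].
apply: (@le_lt_trans _ _ (N * (to_real e / (2 * N)))).
  apply: (@le_trans _ _ (N * \sum_(i <- [fset i in C | i \notin A]%fset) rnorm (w i))).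
    rewrite ler_wpM2r ?sumr_ge0// => [i _|]; first exact: rnorm_ge0.
    by rewrite /N ler_wpDr ?le_max ?lexx ?ler01.
  by rewrite ler_wpM2l// ltW.
rewrite (_ : N * _ = to_real e / 2); first by move: e0; lra.
by field; rewrite gt_eqF.
Qed.

Definition ell1_ext_fun w : X := summability.sum (term w).

Lemma ell1_ext_linear : linear ell1_ext_fun.
Proof.
have TF : ProperFilter (@totally I) := totally_filter.
move=> a v w; apply: cvg_lim; first exact: norm_hausdorff.
rewrite (_ : partial_sum _ = (a \*: partial_sum (term v)) \+ partial_sum (term w)).
  by apply: cvgD; [apply: cvgZr|]; exact: term_cvg.
apply/funext => A /=; rewrite /partial_sum scaler_sumr -big_split/=.
apply: eq_bigr => i _; rewrite /term.
by rewrite (_ : (a *: v + w) _ = a * v (val i) + w (val i))// scalerDl scalerA.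
Qed.

HB.instance Definition _ :=
  GRing.isLinear.Build K (ell1 R k I) X _ ell1_ext_fun ell1_ext_linear.

Lemma ell1_ext_near w (e : R) (A0 : {fset I}) : 0 < e -> exists A,
  (A0 `<=` A)%fset /\ rnorm (ell1_ext_fun w - partial_sum (term w) A) <= e.
Proof.
have TF : ProperFilter (@totally I) := totally_filter.
move=> e0; have /cvg_ballP/(_ (of_real k e) (of_real_gt0 k e0)) := @term_cvg w.
move=> H; have [A [HA AA]] : exists A, ball (lim (partial_sum (term w) @ totally)) 
    (of_real k e) (partial_sum (term w) A) /\ (A0 `<=` A)%fset.
  apply: (@filter_ex _ (@totally I)); apply: filterI; first exact: H.
  by exists A0.
exists A; split=> //; move: HA; rewrite -ball_normE /= -rnormK of_real_lt => /ltW.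
by [].
Qed.

Lemma ell1_ext_bounded : exists N : K, forall w, `|ell1_ext_fun w| <= N * `|w|.
Proof.
apply: (@real_bounded _ _ _ _ _ (Num.max M 0)) => w; apply/ler_addgt0Pr => e e0.
have [A [_ HA]] := ell1_ext_near w fset0 e0.
rewrite -(subrK (partial_sum (term w) A) (ell1_ext_fun w)) addrC.
apply: le_trans (rnormD _ _) _; rewrite lerD//.
apply: le_trans (rnorm_sum_term _ _) _.
have wA : \sum_(i <- A) rnorm (w i) <= rnorm w by apply: (ell1_rnorm_le w _).1.
apply: (@le_trans _ _ (Num.max M 0 * \sum_(i <- A) rnorm (w i))).
  rewrite ler_wpM2r ?sumr_ge0// => [i _|]; first exact: rnorm_ge0.
  by rewrite le_max lexx.
by rewrite ler_wpM2l// le_max lexx orbT.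
Qed.

(** [ell1] is the free Banach space on its unit vectors: every bounded family
    extends to an operator. *)
Definition ell1_ext : operator (ell1 R k I) X := Operator ell1_ext_bounded.

Lemma ell1_ext_unit i : ell1_ext (unit_vector i) = x i.
Proof.
apply/eqP; rewrite -subr_eq0; apply/eqP; apply: rnorm0_eq0; apply/eqP.
rewrite eq_le rnorm_ge0 andbT; apply/ler_addgt0Pr => e e0; rewrite add0r.
have [A [iA]] := ell1_ext_near (unit_vector i) [fset i]%fset e0.
rewrite (_ : partial_sum _ _ = x i)// partial_sum_termE.
rewrite (big_fsetD1 i)/=; last by rewrite (fsubsetP iA)// inE.
rewrite eqxx scale1r big1_seq ?addr0// => j.
by rewrite !inE => /and3P[_ ji _]; rewrite (negPf ji) scale0r.
Qed.

End Extension.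
End Ell1.

(** * Trees inside the derived sets *)

(** Dependent choice along a measure: the choice at a node may depend on all the
    choices made at nodes of smaller measure. *)
Lemma strong_choice (T D : Type) (h : T -> nat) (d0 : D)
    (Good : T -> (T -> D) -> D -> Prop) :
  (forall t g g' d, (forall s, (h s < h t)%N -> g s = g' s) -> Good t g d -> Good t g' d) ->
  (forall t g, (forall s, (h s < h t)%N -> Good s g (g s)) -> exists d, Good t g d) ->
  exists g, forall t, Good t g (g t).
Proof.
move=> Gext Gex.
have wf : well_founded (fun s t : T => (h s < h t)%N).
  by apply: (@Wf_nat.well_founded_lt_compat _ h) => s t /ssrnat.ltP.
pose below t (rec : forall s, (h s < h t)%N -> D) s :=
  if @idP (h s < h t)%N is ReflectT st then rec s st else d0.
pose pick t g := if pselect (exists d, Good t g d) is left E then projT1 (cid E) else d0.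
pose G := Fix wf (fun=> D) (fun t rec => pick t (below t rec)).
have GE t : G t = pick t (fun s => if (h s < h t)%N then G s else d0).
  rewrite /G Fix_eq; last first.
    move=> x f g fg; congr pick; apply/funext => s; rewrite /below.
    by case: {-}_ / idP.
  congr pick; apply/funext => s; rewrite /below.
  by case: {-}_ / idP => [->|/negP/negPf ->].
exists G => t; elim/(well_founded_ind wf): t => t IH.
have low s : (h s < h t)%N -> (if (h s < h t)%N then G s else d0) = G s by move=> ->.
apply: (Gext _ _ _ _ low); rewrite [X in Good _ _ X]GE /pick.
case: pselect => [E|[]]; first by case: (cid E).
have [d Gd] : exists d, Good t G d.
  by apply: Gex => s st; exact: IH.
by exists d; apply: Gext Gd => s st; rewrite low.
Qed.

Section Selection.
Variables (R : realType) (k : scalar_kind).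
Local Notation K := (scalar_field R k).

(** Real and imaginary parts for both scalar fields at once; over the reals the
    second one is 0. *)
Lemma scalar_parts : exists re im : K -> R,
  [/\ forall a b, re (a - b) = re a - re b, forall a b, im (a - b) = im a - im b &
   forall a : K, [/\ `|re a| <= rnorm (a : K^o), `|im a| <= rnorm (a : K^o) &
     rnorm (a : K^o) <= `|re a| + `|im a|]].
Proof.
case: k.
  exists id, (fun=> 0); split=> // [a b|a]; first by rewrite subr0.
  by rewrite normr0 addr0 /rnorm /=; split.
exists (@complex.Re R), (@complex.Im R); split=> [a b|a b|[a b]]; try exact: raddfB.
have i1 : `|('i : R[i])%C| = 1 by rewrite normc_def/= expr0n expr1n add0r sqrtr1.
have ofr (x : R) : `|(x%:C)%C : R[i]| = (`|x|%:C)%C.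
  by rewrite normc_def/= expr0n addr0 sqrtr_sqr.
have le_rnorm (x : R) (z : R[i]) :
    (rnorm (z : (scalar_field R ComplexScalars)^o) <= x) = (`|z| <= (x%:C)%C).
  by rewrite -(of_real_le ComplexScalars) rnormK.
have ge_rnorm (x : R) (z : R[i]) :
    (x <= rnorm (z : (scalar_field R ComplexScalars)^o)) = ((x%:C)%C <= `|z|).
  by rewrite -(of_real_le ComplexScalars) rnormK.
split.
- by rewrite ge_rnorm; exact: (normc_ge_Re (a +i* b)%C).
- rewrite ge_rnorm -normrN.
  have := normc_ge_Re ((a +i* b)%C * 'i%C); rewrite normrM i1 mulr1.
  by rewrite /= mulr0 mulr1 sub0r.
- rewrite le_rnorm [X in `|X| <= _](_ : (a +i* b)%C = (a%:C)%C + 'i%C * (b%:C)%C); last by simpc.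
  by apply: le_trans (ler_normD _ _) _; rewrite normrM i1 mul1r !ofr raddfD.
Qed.

Lemma real_coloring (C e : R) : 0 < e -> exists n (q : R -> 'I_n.+1),
  forall a b, `|a| <= C -> `|b| <= C -> q a = q b -> `|a - b| <= e.
Proof.
move=> e0; pose t (a : R) := Num.truncn ((a + C) / e).
exists (Num.truncn (2 * C / e)), (fun a => inord (t a)) => a b aC bC.
have pos (x : R) : `|x| <= C -> 0 <= (x + C) / e.
  by rewrite ler_norml => /andP[x1 _]; rewrite divr_ge0 ?(ltW e0)//; lra.
have small (x : R) : `|x| <= C -> (t x < (Num.truncn (2 * C / e)).+1)%N.
  rewrite ler_norml => /andP[_ x1]; rewrite ltnS; apply: le_truncn.
  by rewrite ler_pM2r ?invr_gt0//; lra.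
move=> /(congr1 val) /=; rewrite !inordK ?small// => tab.
have /truncn_itv := pos a aC; have /truncn_itv := pos b bC.
rewrite -/(t a) -/(t b) tab !ler_pdivlMr// !ltr_pdivrMr// -!natr1.
move: (t b)%:R => n /andP[b1 b2] /andP[a1 a2]; rewrite ler_norml.
by apply/andP; split; lra.
Qed.

(** Total boundedness of discs, in the form used by pigeonhole, ultrafilter and
    coding arguments. *)
Lemma scalar_coloring (C e : R) : 0 < e -> exists (F : finType) (q : K -> F),
  forall a b : K, rnorm (a : K^o) <= C -> rnorm (b : K^o) <= C ->
    q a = q b -> rnorm (a - b : K^o) <= e.
Proof.
move=> e0; have [re [im [reB imB parts]]] := scalar_parts.
have [n [q qP]] := real_coloring C (divr_gt0 e0 (ltr0Sn R 1)).
exists ('I_n.+1 * 'I_n.+1)%type, (fun a => (q (re a), q (im a))) => a b aC bC [qre qim].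
have [ra ia _] := parts a; have [rb ib _] := parts b.
have [_ _] := parts (a - b); rewrite reB imB.
have := qP _ _ (le_trans ra aC) (le_trans rb bC) qre.
have := qP _ _ (le_trans ia aC) (le_trans ib bC) qim.
by lra.
Qed.

Lemma finite_collision (F : finType) (f : nat -> F) : exists i j, (i < j)%N /\ f i = f j.
Proof.
apply: contrapT => N; have /leq_card : injective (fun i : 'I_#|F|.+1 => f i).
  move=> i j fij; apply: val_inj; have [ij|ij|//] := ltngtP i j.
    by case: N; exists i, j.
  by case: N; exists j, i.
by rewrite card_ord ltnn.
Qed.

Section Space.
Variable X : normedModType K.
Implicit Types (f g : dual_space X) (x : X).

Lemma close_pair (D : seq (dual_space X)) (z : nat -> X) (e : R) : 0 < e ->
  (forall n, rnorm (z n) <= 1) -> exists i j, (i < j)%N /\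
  forall d, d \in D -> rnorm (d (z j) - d (z i) : K^o) <= e.
Proof.
move=> e0 z1; have [C DC] : exists C, forall d, d \in D -> forall x, rnorm x <= 1 ->
    rnorm (d x : K^o) <= C.
  elim: D => [|d D [C DC]]; first by exists 0.
  have [M M0 dM] := op_rbound d; exists (Num.max M C) => d'.
  rewrite inE => /predU1P[->|d'D] x x1; rewrite le_max.
    by rewrite (le_trans (dM x))// ger_pMr.
  by rewrite DC ?orbT.
have [F [q qP]] := scalar_coloring C e0.
pose color n := map_tuple (fun d : dual_space X => q (d (z n))) (in_tuple D).
have [i [j [ij cij]]] := finite_collision color; exists i, j; split=> // d dD.
apply: qP; rewrite ?DC//.
have /eq_in_map H := congr1 val cij; exact: esym (H d dD).
Qed.

(** Of two distant points near [f], one is distant from [f]. *)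
Lemma szlenk_der_far e A f s c : szlenk_der e A f -> 0 < c ->
  exists g x, [/\ A g, wball f s c g, rnorm x <= 1 & e / 2 < rnorm (g x - f x : K^o)].
Proof.
move=> /szlenk_derP[_ H] c0; have [g [h [Ag Ah gs hs [x x1 gh]]]] := H s c c0.
have [gf|fg] := ltP (e / 2) (rnorm (g x - f x : K^o)); first by exists g, x.
exists h, x; split=> //; rewrite rnormB.
have := rnormD (g x - f x : K^o) (f x - h x); rewrite subrKA; lra.
Qed.

(** Almost annihilating given functionals costs only a factor of two in norm:
    among infinitely many candidates [z i], each chosen after its predecessors,
    two are nearly indistinguishable to the functionals, and their difference is
    still seen by the later one. *)
Lemma szlenk_der_select e A f (D : seq (dual_space X)) (s : seq X) c :
  0 < e -> szlenk_der e A f -> 0 < c ->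
  exists p : dual_space X * X, [/\ A p.1, wball f s c p.1, rnorm p.2 <= 2,
    forall d, d \in D -> rnorm (d p.2 : K^o) <= c &
    e / 4 < rnorm (p.1 p.2 - f p.2 : K^o)].
Proof.
move=> e0 fA c0; pose c' := Num.min c (e / 4).
have c'0 : 0 < c' by rewrite lt_min c0 divr_gt0.
have /choice[h hP] : forall r : seq X, exists p : dual_space X * X,
    [/\ A p.1, wball f (s ++ r) c' p.1, rnorm p.2 <= 1 &
        e / 2 < rnorm (p.1 p.2 - f p.2 : K^o)].
  by move=> r; have [g [x H]] := szlenk_der_far (s ++ r) fA c'0; exists (g, x).
(* [hist n] collects the candidate vectors before the n-th one. *)
pose hist n := iter n (fun r => (h r).2 :: r) [::].
pose z n := (h (hist n)).2.
have zhist i j : (i < j)%N -> z i \in hist j.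
  elim: j => // j IH; rewrite ltnS leq_eqVlt => /predU1P[->|/IH ij].
    by rewrite [hist _]/= mem_head.
  by rewrite [hist _]/= inE ij orbT.
have z1 n : rnorm (z n) <= 1 by case: (hP (hist n)).
have [i [j [ij Dij]]] := close_pair D c0 z1.
have [Ag gs _ gz] := hP (hist j); exists ((h (hist j)).1, z j - z i); split=> //=.
- move=> v vs; apply: lt_le_trans (gs v _) _; first by rewrite mem_cat vs.
  by rewrite ge_min lexx.
- apply: le_trans (rnormD _ _) _; rewrite rnormN.
  by rewrite -[leRHS]/(1 + 1) lerD.
- by move=> d dD; rewrite (linearB d) Dij.
- have gi : rnorm ((h (hist j)).1 (z i) - f (z i) : K^o) < e / 4.
    apply: lt_le_trans (gs (z i) _) _; first by rewrite mem_cat zhist ?orbT.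
    by rewrite ge_min lexx orbT.
  rewrite (linearB (h (hist j)).1) (linearB f).
  set a := (h (hist j)).1 (z j); set b := (h (hist j)).1 (z i).
  have -> : a - b - (f (z j) - f (z i)) = (a - f (z j)) - (b - f (z i)).
    by rewrite !opprB addrACA [RHS]addrACA; congr (_ + _); rewrite addrC.
  have := rnormD (a - f (z j) - (b - f (z i)) : K^o) (b - f (z i)).
  rewrite subrK; move: gz; rewrite -/(z j) -/a; move: gi; rewrite -/b; lra.
Qed.

End Space.

Section TreeSelection.
Variables (X : normedModType K) (d : Order.disp_t) (T : porderType d).
Variables (r : T) (par : T -> T) (q : T -> ord) (h : T -> nat).
Hypothesis par_lt : forall t, t != r -> (par t < t)%O.
Hypothesis q_rank : rank_fun q.
Hypothesis h_inj : injective h.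
Hypothesis h_lt : forall s t, (s < t)%O -> (h s < h t)%N.
Variables (e : R) (A : set (dual_space X)) (f0 : dual_space X) (c : nat -> R).
Hypothesis e_gt0 : 0 < e.
Hypothesis c_gt0 : forall n, 0 < c n.
Hypothesis f0_root : szlenk_iter e A (q r) f0.

(** The nodes are treated in the order of [h]. At a new node the point is chosen
    close to the point of the parent on all earlier vectors, and the vector is
    almost annihilated by all earlier increments; so both halves of the matrix of
    increments against vectors are small off the diagonal. *)
Lemma tree_selection : exists (F : T -> dual_space X) (x : T -> X),
  (forall t, A (F t)) /\ forall t, t != r ->
  [/\ rnorm (x t) <= 2, e / 4 < rnorm (F t (x t) - F (par t) (x t) : K^o) &
     forall s, s != r -> s != t ->
       rnorm (F t (x s) - F (par t) (x s) : K^o) <= c (maxn (h s) (h t))].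
Proof.
pose diff (g : T -> dual_space X * X) s := op_comb 1 (-1) (g s).1 (g (par s)).1.
have diffE g s x : diff g s x = (g s).1 x - (g (par s)).1 x.
  by rewrite [LHS](_ : _ = 1 * (g s).1 x + -1 * (g (par s)).1 x)// mul1r mulN1r.
pose Good t (g : T -> dual_space X * X) (p : dual_space X * X) :=
  szlenk_iter e A (q t) p.1 /\ (t != r ->
  [/\ rnorm p.2 <= 2, e / 4 < rnorm (p.1 p.2 - (g (par t)).1 p.2 : K^o),
    forall s, (h s < h t)%N -> s != r ->
      rnorm (p.1 (g s).2 - (g (par t)).1 (g s).2 : K^o) <= c (h t) &
    forall s, (h s < h t)%N -> s != r -> rnorm (diff g s p.2 : K^o) <= c (h t)]).
have [|t g goodg|g gP] := @strong_choice T _ h (f0, 0 : X) Good.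
- move=> t g g' p gg' [pt H]; split=> // tr; have [p2 pfar p_s d_s] := H tr.
  have gpar : g (par t) = g' (par t) by apply: gg'; apply/h_lt/par_lt.
  split=> // [|s st sr|s st sr]; first by rewrite -gpar.
    by rewrite -gpar -gg'//; exact: p_s.
  have := d_s s st sr; rewrite !diffE -!gg'//.
  exact: ltn_trans (h_lt (par_lt sr)) st.
- have [->|tr] := eqVneq t r; first by exists (f0, 0); split=> //=; rewrite eqxx.
  have pt := par_lt tr; have [gp _] := goodg (par t) (h_lt pt).
  have gp' : szlenk_iter e A (OSucc (q t)) (g (par t)).1.
    by apply: szlenk_iter_le gp; exact: rank_fun_lt.
  have [E EE] : exists E : seq T, forall s, (h s < h t)%N -> s \in E.
    have /finite_seqP[E EE] : finite_set (h @^-1` `I_(h t)).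
      by apply: finite_preimage => // a b _ _; exact: h_inj.
    exists E => s st; have : (h @^-1` `I_(h t)) s by [].
    by rewrite EE.
  have [p [p1 ps p2 pd pfar]] := szlenk_der_select [seq diff g s | s <- E]
    [seq (g s).2 | s <- E] e_gt0 gp' (c_gt0 (h t)).
  exists p; split=> // _; split=> // s /EE sE sr.
    by apply/ltW/ps; exact: map_f.
  by apply: pd; apply: map_f.
exists (fun t => (g t).1), (fun t => (g t).2); split.
  by move=> t; have [/szlenk_iter_sub] := gP t.
move=> t tr; have [_ /(_ tr)[g2 gfar g_s d_s]] := gP t; split=> // s sr st.
have [st'|ts|/h_inj/eqP] := ltngtP (h s) (h t); last by rewrite (negPf st).
  exact: g_s.
by have [_ /(_ sr)[_ _ _ /(_ t ts tr)]] := gP s; rewrite diffE.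
Qed.

End TreeSelection.
End Selection.

(** * Factorization of the summation operator *)

Section SigmaFacts.
Variables (R : realType) (k : scalar_kind) (d : Order.disp_t) (P : porderType d).
Local Notation K := (scalar_field R k).

Lemma sum_single (f : P -> K^o) s : (forall t, t != s -> f t = 0) ->
  summability.sum f = f s.
Proof.
have TF : ProperFilter (@totally P) := totally_filter.
move=> f0; apply: cvg_lim; first exact: norm_hausdorff.
apply: cvg_near_cst; exists [fset s]%fset => // A sA; rewrite partial_sumE.
rewrite (big_fsetD1 s)/=; last by apply: (fsubsetP sA); rewrite inE.
by rewrite big1_seq ?addr0// => t; rewrite !inE => /and3P[_ ts _]; exact: f0.
Qed.

Lemma Sigma_unit (s t : P) : Sigma R k P (unit_vector _ _ s) t = if (s <= t)%O then 1 else 0.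
Proof.
rewrite [LHS](_ : _ = Sigma_fun (unit_vector R k s) t)// /Sigma_fun (@sum_single _ s).
  by rewrite unit_vectorE eqxx.
by move=> s' s's; rewrite unit_vectorE (negPf s's); case: ifP.
Qed.

Lemma Sigma_op (u : P) : exists L : operator (ell1 R k P) K^o,
  forall w, L w = Sigma R k P w u.
Proof. by exists (op_comp (fncoord (ellinf_fnorm R k P) u) (Sigma R k P)). Qed.

End SigmaFacts.

(** Injectivity of [h] bounds the sum by a geometric series. *)
Lemma sum_pow2_le (R : realType) (I : choiceType) (h : I -> nat) (A : {fset I}) :
  injective h -> \sum_(i <- A) (2^-1 : R) ^+ (h i).+1 <= 1.
Proof.
move=> h_inj; pose s := map h A.
have [n sn] : exists n, {subset s <= iota 0 n}.
  exists (\max_(i <- s) i).+1 => i iS; rewrite mem_iota /= ltnS.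
  exact: (@leq_bigmax_seq _ s xpredT id i).
rewrite -(big_map h xpredT (fun m => 2^-1 ^+ m.+1)) -/s.
rewrite (perm_big [seq i <- iota 0 n | i \in s]) /=; last first.
  apply: uniq_perm; rewrite ?filter_uniq ?iota_uniq ?map_inj_uniq ?fset_uniq//.
  by move=> i; rewrite mem_filter andb_idr//; exact: sn.
rewrite big_filter; apply: (@le_trans _ _ (\sum_(i <- iota 0 n) 2^-1 ^+ i.+1)).
  by rewrite big_mkcond; apply: ler_sum => i _; case: ifP.
have -> : \sum_(i <- iota 0 n) (2^-1 : R) ^+ i.+1 = 1 - 2^-1 ^+ n.
  elim: n {sn} => [|n IH]; first by rewrite big_nil subrr.
  by rewrite -addn1 iotaD big_cat /= IH big_seq1 add0n addn1 !exprS; lra.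
by rewrite gerBl exprn_ge0 ?invr_ge0.
Qed.

Section Star.
Variables (d : Order.disp_t) (T : porderType d) (r : T).
Hypothesis r_le : forall t, (r <= t)%O.
Implicit Types u v : star T.

Definition node u : T := val u.

Lemma node_inj : injective node.
Proof. exact: val_inj. Qed.

Lemma tree_min_root t : tree_min [set: T] t <-> t = r.
Proof.
split=> [[_ /(_ r I (r_le t))->//]|->]; split=> // s _ sr.
by apply/eqP; rewrite eq_le sr r_le.
Qed.

Lemma star_neq u : node u != r.
Proof.
by apply/eqP => /tree_min_root; have := set_valP u.
Qed.

Lemma star_exists t : t != r -> exists u : star T, node u = t.
Proof.
move=> /eqP tr; have nt : t \in ~` tree_min [set: T].
  by rewrite inE => /tree_min_root.
by exists (SigSub nt : star T).
Qed.

Lemma star_le u v : (u <= v)%O = (node u <= node v)%O.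
Proof. by []. Qed.

End Star.

Section DualBall.
Variables (R : realType) (k : scalar_kind).
Local Notation K := (scalar_field R k).

Lemma dual_ball_le (Y : normedModType K) (y : dual_space Y) : dual_ball y ->
  forall z, rnorm (y z : K^o) <= rnorm z.
Proof.
move=> /op_norm_le1 y1 z; have [z0|z_neq0] := eqVneq (rnorm z) 0.
  by rewrite (rnorm0_eq0 z0) (linear0 y) !rnorm0.
have z_gt0 : 0 < rnorm z by rewrite lt_neqAle eq_sym z_neq0 rnorm_ge0.
have nr : rnorm (of_real k (rnorm z)^-1 : K^o) = (rnorm z)^-1.
  rewrite /rnorm ger0_norm ?of_realK// -(of_real0 R k) of_real_le invr_ge0.
  exact: rnorm_ge0.
have := y1 (of_real k (rnorm z)^-1 *: z); rewrite rnormZ nr mulVf// => /(_ (lexx _)).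
by rewrite (linearZ_LR y) rnormZ nr ler_pdivrMl// mulr1.
Qed.

Lemma ellinf_family (Y : normedModType K) (P : choiceType) (y : P -> dual_space Y)
    (M : R) : 0 <= M -> (forall u z, rnorm (y u z : K^o) <= M * rnorm z) ->
  exists V : operator Y (ellinf R k P), forall z u, V z u = y u z.
Proof.
move=> M0 yM.
have fin_le z : (ellinf_norm (fun u => y u z : K^o) <= (M * rnorm z)%:E)%E.
  apply/ellinf_normP => [|u]; rewrite lee_fin; last exact: yM.
  by rewrite mulr_ge0 ?rnorm_ge0.
have fin z : (fun u => y u z : K^o) \in finite_fnorm (ellinf_fnorm R k P).
  by rewrite inE; apply: le_lt_trans (fin_le z) (ltry _).
pose g z : ellinf R k P := FnSpace (fin z).
have g_linear : linear g.
  by move=> a z z'; apply: val_inj; apply/funext => u; exact: (linearP (y u)).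
pose gL := GRing.isLinear.Build _ _ _ _ _ g_linear.
pose G : {linear Y -> ellinf R k P} := HB.pack g gL.
have Gb : exists N : K, forall z, `|G z| <= N * `|z|.
  by apply: (@real_bounded _ _ _ _ _ M) => z; rewrite -lee_fin fnspace_rnormE fin_le.
by exists (Operator Gb).
Qed.

End DualBall.

Section Assembly.
Variables (R : realType) (k : scalar_kind).
Local Notation K := (scalar_field R k).
Variables (d : Order.disp_t) (T : porderType d) (r : T) (par : T -> T) (h : T -> nat).
Hypothesis r_le : forall t, (r <= t)%O.
Hypothesis par_lt : forall t, t != r -> (par t < t)%O.
Hypothesis par_max : forall s t, t != r -> (s < t)%O -> (s <= par t)%O.
Hypothesis h_inj : injective h.
Hypothesis h_lt : forall s t, (s < t)%O -> (h s < h t)%N.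

(** Summation undoes taking differences with the parent. *)
Lemma Sigma_telescope (m : ell1 R k (star T)) (g : T -> K) :
  (forall u, m u = g (node u) - g (par (node u))) ->
  forall u, Sigma R k (star T) m u = g (node u) - g r.
Proof.
move=> mg u; have [n] := ubnP (h (node u)).
elim: n u => [|n IH] u; rewrite ?ltn0// ltnS => un.
have [L LE] := Sigma_op R k u.
pose C := fncoord (ell1_fnorm R k (star T)) u.
have le_par s : (s <= u)%O = (s == u) || (node s <= par (node u))%O.
  rewrite star_le le_eqVlt; congr (_ || _).
  apply/idP/idP => [|su]; first exact/par_max/star_neq.
  exact: le_lt_trans su (par_lt (star_neq r_le u)).
have npar : (node u <= par (node u))%O = false.
  by rewrite lt_geF// par_lt// star_neq.
have [pr|pr] := eqVneq (par (node u)) r.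
  have -> : Sigma R k (star T) m u = m u.
    rewrite -LE -[RHS]/(C m); apply: ell1_op_ext => s.
    rewrite LE Sigma_unit le_par -[RHS]/(unit_vector _ _ s u) unit_vectorE eq_sym.
    case: eqVneq => //= us; rewrite pr ifN//.
    by apply/negP => sr; have := star_neq r_le s; rewrite eq_le sr r_le.
  by rewrite mg pr.
have [v vp] := star_exists r_le pr.
have [L' LE'] := Sigma_op R k v.
have -> : Sigma R k (star T) m u = Sigma R k (star T) m v + m u.
  rewrite -LE -LE' -[m u]/(C m) -[RHS](_ : op_comb 1 1 L' C m = _); last first.
    by rewrite /= /op_comb_fun !scale1r.
  apply: ell1_op_ext => s.
  rewrite [RHS](_ : _ = L' (unit_vector R k s) + unit_vector R k s u); last first.
    by rewrite /= /op_comb_fun !scale1r.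
  rewrite LE LE' !Sigma_unit le_par star_le vp unit_vectorE eq_sym.
  by case: eqVneq => [<-|_] /=; rewrite ?npar ?add0r ?addr0.
rewrite IH; last by rewrite vp (leq_trans (h_lt (par_lt (star_neq r_le u))))// -ltnS.
by rewrite mg vp addrC subrKA.
Qed.

Variables (X Y : completeNormedModType K) (S : operator X Y).
Variables (q : T -> ord) (e : R) (f0 : dual_space X).
Hypothesis q_rank : rank_fun q.
Hypothesis e_gt0 : 0 < e.
Hypothesis f0_root : szlenk_iter e (adjoint S @` @dual_ball R k Y) (q r) f0.


(* Dividing by the diagonal entries, which exceed [e / 4], leaves entries of size
   [2^-1 ^+ n.+2], whose sum over distinct n is at most 1/2. *)
Let c n : R := e / 4 * 2^-1 ^+ n.+2.

(** Normalizing the selected vectors gives an almost biorthogonal system, so that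
    the operator it induces is the summation operator up to a perturbation of the
    identity of [ell1], which is then inverted. *)
Lemma Sigma_factors : factors_through (Sigma R k (star T)) S.
Proof.
have c_gt0 n : 0 < c n by rewrite mulr_gt0 ?divr_gt0 ?exprn_gt0 ?invr_gt0.
have [F [x [Fball xP]]] := tree_selection par_lt q_rank h_inj h_lt e_gt0 c_gt0 f0_root.
have /choice[y yP] : forall t, exists y : dual_space Y, dual_ball y /\ adjoint S y = F t.
  by move=> t; have [y By yF] := Fball t; exists y.
pose D t z := F t z - F (par t) z : K^o.
have DZ t a z : D t (a *: z) = a * D t z.
  by rewrite /D (linearZ_LR (F t)) (linearZ_LR (F (par t))) mulrBr.
pose x' (u : star T) := (D (node u) (x (node u)))^-1 *: x (node u).
have D_gt u : e / 4 < rnorm (D (node u) (x (node u))).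
  by case: (xP _ (star_neq r_le u)).
have D_neq0 u : D (node u) (x (node u)) != 0.
  by apply: contraTneq (D_gt u) => ->; rewrite rnorm0 -leNgt divr_ge0 ?(ltW e_gt0).
have Dinv u : rnorm ((D (node u) (x (node u)))^-1 : K^o) <= 4 / e.
  have := D_gt u; have := D_neq0 u; move: (D _ _) => a a0 ea.
  have a_gt0 : 0 < rnorm a by apply: lt_trans ea; rewrite divr_gt0.
  have : rnorm (a^-1 : K^o) * rnorm a = 1 by rewrite -rnormZ [_ *: _]mulVf// rnorm1.
  move=> /(canRL (mulfK (lt0r_neq0 a_gt0))) ->; rewrite mul1r -[leRHS]invrK invf_div.
  by rewrite lef_pV2 ?posrE ?divr_gt0// ltW.
have x'_le u : rnorm (x' u) <= 4 / e * 2.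
  rewrite rnormZ; apply: ler_pM; rewrite ?rnorm_ge0//.
  by case: (xP _ (star_neq r_le u)).
have Dx'_diag u : D (node u) (x' u) = 1 by rewrite DZ mulVf.
have Dx' u v : u != v -> rnorm (D (node u) (x' v)) <= 2^-1 ^+ (h (node u)).+2.
  move=> uv; rewrite DZ [X in rnorm X](_ : _ = (D (node v) (x (node v)))^-1 *: D (node u) (x (node v)))//.
  rewrite rnormZ; apply: (@le_trans _ _ (4 / e * c (h (node u)))).
    apply: ler_pM; rewrite ?rnorm_ge0//.
    have [_ _ H] := xP _ (star_neq r_le u).
    apply: le_trans (H _ (star_neq r_le v) _) _.
      by apply: contra uv => /eqP vu; apply/eqP/node_inj.
    rewrite /c ler_wpM2l ?divr_ge0 ?(ltW e_gt0)//.
    rewrite ler_wiXn2l ?invr_ge0 ?invf_le1 ?ler1n//.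
    by rewrite !ltnS leq_maxr.
  by rewrite /c mulrA (_ : 4 / e * (e / 4) = 1) ?mul1r//; field; rewrite gt_eqF.
have row_le v (A : {fset star T}) : \sum_(u <- A) rnorm (D (node u) (x' v) - (u == v)%:R : K^o) <= 2^-1.
  apply: (@le_trans _ _ (\sum_(u <- A) 2^-1 * 2^-1 ^+ (h (node u)).+1)).
    apply: ler_sum => u _; rewrite -exprS; have [->|uv] := eqVneq u v.
      by rewrite Dx'_diag subrr rnorm0 exprn_ge0 ?invr_ge0.
    by rewrite subr0 Dx'.
  rewrite -mulr_sumr ler_piMr ?invr_ge0//.
  apply: (@sum_pow2_le R _ (fun u : star T => h (node u))) => u v' /h_inj; exact: node_inj.
have fin v : (fun u : star T => D (node u) (x' v) - (u == v)%:R : K^o) \in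
    finite_fnorm (ell1_fnorm R k (star T)).
  rewrite inE; apply: (@le_lt_trans _ _ (2^-1)%:E); last exact: ltry.
  by apply/ell1_normP => A; rewrite lee_fin.
pose ev v : ell1 R k (star T) := FnSpace (fin v).
have ev_le v : rnorm (ev v) <= 2^-1 by apply/ell1_rnorm_le => A; exact: row_le.
pose E := ell1_ext ev_le.
have E_le w : rnorm (E w) <= 2^-1 * rnorm w.
  by apply: ell1_op_bound; rewrite ?invr_ge0// => v; rewrite ell1_ext_unit.
(* The inverse of the perturbed identity need only be found on unit vectors. *)
have /choice[n nP] : forall v : star T, exists n, rnorm n <= 2 /\ n + E n = unit_vector R k v.
  move=> v; have [n n2 nE] := near_identity_solve E_le (unit_vector R k v).
  exists n; split=> //; apply: le_trans n2 _.
  by rewrite ler_piMr// unit_vector_norm.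
have n_le v : rnorm (n v) <= 2 by case: (nP v).
have [V VE] : exists V : operator Y (ellinf R k (star T)),
    forall z u, V z u = y (node u) z - y r z.
  pose y' (u : star T) := op_comb 1 (-1) (y (node u)) (y r).
  have y'E u z : y' u z = y (node u) z - y r z.
    by rewrite /= /op_comb_fun scale1r scaleN1r.
  have [|u z|V VE] := @ellinf_family _ _ _ _ y' 2; [by []| |by exists V => z u; rewrite VE].
  rewrite y'E; apply: le_trans (rnormD _ _) _; rewrite rnormN mulr_natl mulr2n.
  by apply: lerD; apply: dual_ball_le; [case: (yP (node u))|case: (yP r)].
pose U0 := ell1_ext x'_le.
exists (op_comp U0 (ell1_ext n_le)), V => w.
pose L := op_comp V (op_comp S U0).
pose IE := op_comb 1 1 (op_id _) E.
have IEE z : IE z = z + E z by rewrite /IE /= /op_comb_fun !scale1r.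
have LE z : L z = Sigma R k (star T) (z + E z).
  rewrite -IEE -[RHS]/(op_comp (Sigma R k (star T)) IE z); apply: ell1_op_ext => v.
  apply: val_inj; apply/funext => u.
  rewrite -[LHS]/(L (unit_vector R k v) u) -[RHS]/(Sigma R k (star T) (IE (unit_vector R k v)) u).
  rewrite (@Sigma_telescope _ (fun t => F t (x' v))).
    rewrite [L _](_ : _ = V (S (U0 (unit_vector R k v))))// VE ell1_ext_unit.
    by case: (yP (node u)) => _ <-; case: (yP r) => _ <-.
  move=> u'; rewrite IEE ell1_ext_unit.
  rewrite [LHS](_ : _ = unit_vector R k v u' + (D (node u') (x' v) - (u' == v)%:R))//.
  rewrite unit_vectorE; case: eqP => _ /=; last by rewrite add0r subr0.
  by rewrite addrC subrK.
have NE z : ell1_ext n_le z + E (ell1_ext n_le z) = z.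
  rewrite -IEE -[LHS]/(op_comp IE (ell1_ext n_le) z) -[RHS]op_idE.
  apply: ell1_op_ext => v; rewrite op_compE IEE ell1_ext_unit op_idE.
  by case: (nP v).
by rewrite -[in RHS](NE w) -LE.
Qed.

End Assembly.
Lemma infinite_point (T : Type) : ([set: T] #= [set: nat])%card -> inhabited T.
Proof.
move=> TN; have : infinite_set [set: T] by rewrite (eq_finite_set TN); exact: infinite_nat.
by move=> /infinite_setN0[t _].
Qed.

Lemma parent_function d (T : porderType d) (r : T) : is_tree T -> well_founded_tree T ->
  (forall t, (r <= t)%O) -> exists par : T -> T, (forall t, t != r -> (par t < t)%O) /\
    forall s t, t != r -> (s < t)%O -> (s <= par t)%O.
Proof.
move=> T_tree T_wf r_le.
have /choice[par parP] : forall t, exists p, t != r ->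
    (p < t)%O /\ forall s, (s < t)%O -> (s <= p)%O.
  move=> t; have [->|tr] := eqVneq t r; first by exists r.
  have [p pt pmax] : exists2 p, (p < t)%O & forall s, (s < t)%O -> (s <= p)%O.
    by apply: (tree_parent T_tree T_wf (s := r)); rewrite lt_neqAle eq_sym tr r_le.
  by exists p.
by exists par; split=> [t /parP[]//|s t /parP[_ H]]; exact: H.
Qed.

(** An operator that is not alpha-Szlenk has a point surviving [omega ^ alpha]
    derivations, hence, for a smaller distance, any multiple of it; the rank of the
    tree is below one of these multiples. *)
Lemma non_szlenk_factors (R : realType) (k : scalar_kind)
    (X Y : completeNormedModType (scalar_field R k)) (alpha : ord) (S : operator X Y)
    d (T : porderType d) :
  ~ is_szlenk alpha S -> is_tree T -> ([set: T] #= [set: nat])%card -> rooted T ->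
  well_founded_tree T -> ord_lt (tree_rank T) (ord_pow omega (OSucc alpha)) ->
  factors_through (Sigma R k (star T)) S.
Proof.
move=> /non_szlenkP[e [e0 [f fe]]] T_tree TN T_rooted T_wf [n T_lt].
have [t0] := infinite_point TN.
have [r r_le] := tree_root T_tree T_rooted t0.
have T_count : countable [set: T] by move: TN; rewrite card_eq_le => /andP[].
have [h [h_inj h_lt]] := tree_enum T_tree T_wf T_count.
have [q q_rank] := rank_fun_exists (tree_gt_wf T_wf).
have [par [par_lt par_max]] := parent_function T_tree T_wf r_le.
have en_gt0 : 0 < e / 2 ^+ n by rewrite divr_gt0 ?exprn_gt0.
apply: (Sigma_factors r_le par_lt par_max h_inj h_lt q_rank en_gt0 (f0 := f)).
have := szlenk_iter_mul n e0 (@adjoint_ball_mid _ _ _ _ S) fe; apply: szlenk_iter_le.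
apply: ord_ltW; apply: ord_lt_le_trans (lt_tree_rank r q_rank) _.
exact: ord_ltW.
Qed.

(** * Lower bounds for the Szlenk index of summation operators *)

Section LowerBound.
Variables (R : realType) (k : scalar_kind).
Local Notation K := (scalar_field R k).
Variables (d : Order.disp_t) (T : porderType d) (r : T).
Hypothesis r_le : forall t, (r <= t)%O.

Local Notation KS := (adjoint (Sigma R k (star T)) @` @dual_ball R k (ellinf R k (star T))).

(** The functionals summing over initial segments; the one of the root vanishes,
    because the root is not among the nodes of [star T]. *)
Lemma segment_functional : exists chi : T -> dual_space (ell1 R k (star T)),
  (forall t, KS (chi t)) /\
  forall t u, chi t (unit_vector R k u) = if (node u <= t)%O then 1 else 0.
Proof.
suff H t : exists f : dual_space (ell1 R k (star T)), KS f /\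
    forall u, f (unit_vector R k u) = if (node u <= t)%O then 1 else 0.
  by have [chi chiP] := choice H; exists chi; split=> t; have [] := chiP t.
have [->|tr] := eqVneq t r.
  exists (adjoint (Sigma R k (star T)) (op_zero _ _)); split; last first.
    move=> u; rewrite ifN//; apply/negP => ur; have := star_neq r_le u.
    by rewrite eq_le ur r_le.
  exists (op_zero _ _) => //; apply/op_norm_le1 => x _.
  by rewrite [X in rnorm X](_ : _ = 0)// rnorm0 ler01.
have [v <-] := star_exists r_le tr.
exists (adjoint (Sigma R k (star T)) (fncoord (ellinf_fnorm R k (star T)) v)).
split; last by move=> u; rewrite [LHS]Sigma_unit.
exists (fncoord (ellinf_fnorm R k (star T)) v) => //.
apply/op_norm_le1 => x; apply: le_trans; exact: fnspace_pt.
Qed.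

Lemma small_coordinates (P : choiceType) (s : seq (ell1 R k P)) (c : R) : 0 < c ->
  exists A : {fset P}, forall w, w \in s -> forall i, i \notin A -> rnorm (w i) <= c.
Proof.
move=> c0; elim: s => [|w s [A HA]]; first by exists fset0.
have [B HB] := ell1_tail w c0; exists (A `|` B)%fset => w'.
rewrite inE => /predU1P[->|w's] i; rewrite inE negb_or => /andP[iA iB]; last exact: HA.
have := HB [fset i]%fset; rewrite big_seq_fset1; apply=> j.
by rewrite inE => /eqP->.
Qed.

Lemma injective_escapes (P : choiceType) (f : nat -> P) (A : {fset P}) :
  injective f -> exists n, f n \notin A.
Proof.
move=> f_inj; apply: contrapT => /forallNP N.
have fA n : f n \in A by apply/negPn/negP; exact: N.
have [i [j [ij]]] := finite_collision (fun n => [` fA n]%fset).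
by move=> /(congr1 val)/f_inj ijE; move: ij; rewrite ijE ltnn.
Qed.

(** A node with infinitely many children of rank at least xi is a weak* limit of
    these children, which stay at distance 1; the family [D] abstracts the sets
    of nodes of given rank. *)
Lemma segment_szlenk (D : ord -> set T) (chi : T -> dual_space (ell1 R k (star T))) :
  (forall t, KS (chi t)) ->
  (forall t u, chi t (unit_vector R k u) = if (node u <= t)%O then 1 else 0) ->
  (forall z t, D (OSucc z) t -> D z t /\ exists c : nat -> T, injective c /\
     forall n, [/\ D z (c n), (t < c n)%O & forall s, (s < c n)%O -> (s <= t)%O]) ->
  (forall (J : Type) (f : J -> ord) t, D (OSup f) t -> forall i, D (f i) t) ->
  forall xi t, D xi t -> szlenk_iter 2^-1 KS xi (chi t).
Proof.
move=> chiK chiE DS Dsup; elim=> [t _|xi IH t Dt|J f IH t Dt]; last first.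
- by split=> // i _; apply: IH; exact: Dsup Dt i.
- have [Dt' [c [c_inj cP]]] := DS _ _ Dt.
  apply/szlenk_derP; split=> [|s e e0]; first exact: IH.
  have /choice[u uP] : forall n, exists u : star T, node u = c n.
    move=> n; apply: (star_exists r_le); have [_ tc _] := cP n.
    by apply: contraTneq tc => ->; rewrite (le_gtF (r_le t)).
  have u_inj : injective u by move=> m n umn; apply: c_inj; rewrite -!uP umn.
  have [A HA] := small_coordinates s (divr_gt0 e0 (ltr0Sn R 1)).
  have [n nA] := injective_escapes A u_inj.
  have [Dc tc cmax] := cP n.
  have diffE w : chi (c n) w = chi t w + w (u n).
    rewrite -[w (u n)]/(fncoord (ell1_fnorm R k (star T)) (u n) w).
    rewrite -[RHS](_ : op_comb 1 1 (chi t) (fncoord (ell1_fnorm R k (star T)) (u n)) w = _).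
      apply: ell1_op_ext => v; rewrite chiE /= /op_comb_fun !scale1r.
      rewrite chiE -[fncoord _ _ _]/(unit_vector R k v (u n)) unit_vectorE.
      rewrite le_eqVlt -{1}uP (inj_eq (@node_inj _ T)) eq_sym.
      case: eqVneq => [<-|uv] /=; first by rewrite uP lt_geF// add0r.
      rewrite addr0; congr (if _ then _ else _); apply/idP/idP; first exact: cmax.
      by move=> /le_lt_trans; apply.
    by rewrite /= /op_comb_fun !scale1r.
  exists (chi (c n)), (chi t); split.
  + exact: IH.
  + exact: IH.
  + move=> w ws; rewrite diffE addrC addKr.
    by apply: le_lt_trans (HA w ws _ nA) _; move: e0; lra.
  + exact: wball_center.
  + exists (unit_vector R k (u n)); first exact: unit_vector_norm.
    rewrite diffE addrC addKr unit_vectorE eqxx rnorm1.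
    by rewrite invf_lt1 ?ltr1n.
exact: chiK.
Qed.

End LowerBound.

(** The form of the lower bound shared by blossomed trees, whose children are
    ordered by rank, and by trees in which every subtree is repeated. *)
Lemma branching_non_szlenk (R : realType) (k : scalar_kind) (alpha : ord) d
    (T : porderType d) (r : T) (q : T -> ord) :
  (forall t, (r <= t)%O) ->
  (forall t z, ord_lt z (q t) -> exists c : nat -> T, injective c /\
     forall n, [/\ ord_le z (q (c n)), (t < c n)%O & forall s, (s < c n)%O -> (s <= t)%O]) ->
  ord_le (ord_pow omega alpha) (q r) -> non_szlenk alpha (Sigma R k (star T)).
Proof.
move=> r_le qc qr; have [chi [chiK chiE]] := segment_functional R k r_le.
have half_gt0 : 0 < 2^-1 :> R by rewrite invr_gt0.
apply: (non_szlenk_iter half_gt0 (f := chi r)).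
apply: (@segment_szlenk _ _ _ _ _ r_le (fun xi t => ord_le xi (q t))) => //.
by move=> z t zt; split; [exact: ord_ltW|exact: qc].
Qed.

Lemma blossomed_non_szlenk (R : realType) (k : scalar_kind) (alpha : ord) d
    (T : porderType d) : ([set: T] #= [set: nat])%card -> blossomed T ->
  ord_le (ord_pow omega alpha) (tree_rank T) -> non_szlenk alpha (Sigma R k (star T)).
Proof.
move=> TN [T_tree _ T_rooted T_wf T_blossom] le_rank.
have [t0] := infinite_point TN.
have [r r_le] := tree_root T_tree T_rooted t0.
have [q q_rank] := rank_fun_exists (tree_gt_wf T_wf).
apply: (@branching_non_szlenk R k alpha _ T r q r_le).
  move=> t z /q_rank[s ts zs].
  have [c tc cs] := tree_nextP T_tree ts.
  have tmax : ~ tree_max [set: T] t.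
    by move=> [_ /(_ s I (ltW ts))] st; move: ts; rewrite st ltxx.
  have [psi [[psi_next psi_inj psi_surj] psi_mono]] := T_blossom t tmax.
  have [m _ mc] := psi_surj c tc.
  exists (fun n => psi (m + n)%N); split.
    by move=> a b /psi_inj ab; apply: (@addnI m); apply: ab; rewrite inE.
  move=> n; have [|tn nmin] := psi_next (m + n)%N; first by [].
  split=> // [|s' s'n].
    have [mq _] := node_rankE c q_rank; have [_ qm] := node_rankE c q_rank.
    have [nq _] := node_rankE (psi (m + n)%N) q_rank.
    apply: ord_le_trans nq; apply: ord_le_trans (psi_mono _ _ (leq_addr n m)).
    rewrite mc; apply: ord_le_trans qm; apply: ord_le_trans zs _.
    exact: rank_fun_le q_rank cs.
  have [//|] := chain_below T_tree (ltW s'n) (ltW tn).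
  rewrite le_eqVlt => /predU1P[->//|ts'].
  by have := nmin _ ts' (ltW s'n) => s'E; move: s'n; rewrite s'E ltxx.
(* The rank of the tree is the successor of that of the root. A power of omega is
   a limit, unless it is 1, and the root of an infinite tree has rank at least 1. *)
have rank_le : ord_le (tree_rank T) (OSucc (q r)).
  by apply: (tree_rank_le q_rank) => t; exact: (rank_fun_le q_rank (r_le t)).
have [//|qr_lt] : ord_le (ord_pow omega alpha) (q r) \/ ord_lt (q r) (ord_pow omega alpha).
  by have [|] := ord_ltVge (q r) (ord_pow omega alpha); [right|left].
have qr_gt0 : ord_lt OZero (q r).
  apply/q_rank; apply: contrapT => N.
  have : infinite_set [set: T] by rewrite (eq_finite_set TN); exact: infinite_nat.
  apply; apply: (@sub_finite_set _ _ [set r]) => // t _ /=.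
  have := r_le t; rewrite le_eqVlt => /predU1P[//|rt].
  by case: N; exists t.
case: (ord_pow_limit alpha) => [le1|lim].
  by apply: ord_le_trans le1 _.
case: (@ord_lt_irr (OSucc (q r))); apply: ord_lt_le_trans (lim _ qr_lt) _.
exact: ord_le_trans le_rank rank_le.
Qed.

(** * Trees of finite sequences *)

(** Keeping the predicate [v] arbitrary covers the tree of all sequences as well as
    well-founded trees. *)
Record ptree (J : choiceType) (v : pred (seq J)) :=
  Ptree { pseq :> seq J; pseqP : v pseq }.

HB.instance Definition _ (J : choiceType) (v : pred (seq J)) := [isSub for @pseq J v].
HB.instance Definition _ (J : choiceType) (v : pred (seq J)) :=
  [Choice of ptree v by <:].

Section PrefixOrder.
Variables (J : choiceType) (v : pred (seq J)).

Definition ptree_le (s t : ptree v) := prefix s t.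

Lemma ptree_le_refl : reflexive ptree_le.
Proof. by move=> s; exact: prefix_refl. Qed.

Lemma prefix_size_comparable (a b t : seq J) : prefix a t -> prefix b t ->
  (size a <= size b)%N -> prefix a b.
Proof.
rewrite !prefixE => /eqP at_ /eqP bt ab; apply/eqP.
by rewrite -{1}bt take_takel.
Qed.

Lemma prefix_anti (a b : seq J) : prefix a b -> prefix b a -> a = b.
Proof.
move=> ab /size_prefix ba; move: ab.
by rewrite prefixE take_oversize// => /eqP.
Qed.

Lemma ptree_le_anti : antisymmetric ptree_le.
Proof. by move=> s t /andP[st ts]; apply: val_inj; exact: prefix_anti. Qed.

Lemma ptree_le_trans : transitive ptree_le.
Proof. by move=> s t u; exact: prefix_trans. Qed.

HB.instance Definition _ := Order.Le_isPOrder.Build (Order.Disp tt tt) (ptree v)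
  ptree_le_refl ptree_le_anti ptree_le_trans.

Lemma ptree_leE (s t : ptree v) : (s <= t)%O = prefix s t.
Proof. by []. Qed.

Lemma ptree_is_tree : is_tree (ptree v).
Proof.
move=> t; apply: wochoice.antisymmetric_wo_chain.
  by move=> a b _ _ /andP[ab ba]; apply/eqP; rewrite eq_le ab.
move=> X Xt [x Xx].
have [n [y [Xy yn]] nmin] := wf_minimal Wf_nat.lt_wf
  (P := fun n => exists y, y \in X /\ size (y : ptree v) = n)
  (ex_intro _ (size x) (ex_intro _ x (conj Xx erefl))).
exists y; split=> // z Xz; have := Xt z Xz; have := Xt y Xy; rewrite !inE => yt zt.
apply: (prefix_size_comparable yt zt); rewrite leqNgt; apply/negP => zy.
by apply: (nmin (size z)); [apply/ssrnat.ltP; rewrite -yn|exists z].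
Qed.

Lemma ptree_below_finite (t : ptree v) : finite_set [set s | (s <= t)%O].
Proof.
apply: (@sub_finite_set _ _ (val @^-1` [set` [seq take n t | n <- iota 0 (size t).+1]])).
  move=> s st; suff : pseq s \in [seq take n t | n <- iota 0 (size t).+1] by [].
  apply/mapP; exists (size s).
    by rewrite mem_iota /= ltnS size_prefix.
  by move: st; rewrite /= ptree_leE prefixE => /eqP.
by apply: finite_preimage => [a b _ _|]; [exact: val_inj|exact: finite_seq].
Qed.

Hypothesis v0 : v [::].

Definition proot : ptree v := Ptree v0.

Lemma proot_le t : (proot <= t)%O.
Proof. by rewrite ptree_leE prefix0s. Qed.

Lemma ptree_rooted : rooted (ptree v).
Proof.
have H s : tree_min [set: ptree v] s -> s = proot by move=> [_ /(_ proot I (proot_le s))].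
by move=> s t /H-> /H->.
Qed.

Lemma ptree_below_child (t : ptree v) j (c : ptree v) : pseq c = rcons t j ->
  (t < c)%O /\ forall s, (s < c)%O -> (s <= t)%O.
Proof.
move=> cE; have tc : (t <= c)%O by rewrite ptree_leE cE prefix_rcons.
split=> [|s sc].
  rewrite lt_neqAle tc andbT; apply/eqP => tcE.
  by have := congr1 size cE; rewrite -tcE size_rcons => /n_Sn.
apply: (@prefix_size_comparable _ _ c); [exact: ltW sc|exact: tc|].
rewrite leqNgt; apply/negP => st; move: sc; rewrite lt_neqAle => /andP[/eqP + sc].
apply; apply/eqP; rewrite eq_le sc.
by apply: (@prefix_size_comparable _ _ c) => //; [exact: prefix_refl|rewrite cE size_rcons].
Qed.

Lemma ptree_wf_tree : well_founded (fun s t : ptree v => (t < s)%O) ->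
  well_founded_tree (ptree v).
Proof.
move=> wf B [Bch _]; have [/eqP|/set0P[x Bx]] := boolP (B == set0).
  by move->; exact: finite_set0.
have [m Bm mmax] := wf_minimal wf (P := B) (ex_intro _ x Bx).
apply: (@sub_finite_set _ _ [set s | (s <= m)%O]); last exact: ptree_below_finite.
move=> s Bs /=; have [//|] := Bch s m Bs Bm.
by rewrite le_eqVlt => /predU1P[->//|/mmax].
Qed.

End PrefixOrder.

(** Well-founded branching is encoded by an inductive type: every node has either
    no children or one for each [j : J]. *)
Inductive wtree (J : Type) := WLeaf | WNode (f : J -> wtree J).

Section WTree.
Variable J : choiceType.
Implicit Types (w : wtree J) (s : seq J).

Fixpoint subtree w s : wtree J :=
  match s, w with
  | [::], _ => w
  | j :: s', WNode f => subtree (f j) s'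
  | _ :: _, WLeaf => WLeaf J
  end.

Fixpoint valid w s : bool :=
  match s, w with
  | [::], _ => true
  | j :: s', WNode f => valid (f j) s'
  | _ :: _, WLeaf => false
  end.

Fixpoint wrank w : ord :=
  if w is WNode f then OSup (fun j => OSucc (wrank (f j))) else OZero.

Lemma valid0 w : valid w [::]. Proof. by case: w. Qed.

Lemma subtree0 w : subtree w [::] = w. Proof. by case: w. Qed.

Lemma subtree_cat w s s' : subtree w (s ++ s') = subtree (subtree w s) s'.
Proof.
by elim: s w => [|j s IH] [|f] //=; case: (s') IH.
Qed.

Lemma valid_cat w s s' : valid w (s ++ s') = valid w s && valid (subtree w s) s'.
Proof. by elim: s w => [|j s IH] [|f] //=; rewrite ?subtree0 ?valid0. Qed.

Lemma wrank_subtree w s : valid w s -> ord_le (wrank (subtree w s)) (wrank w).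
Proof.
elim: s w => [|j s IH] w; first by rewrite subtree0 => _; exact: ord_le_refl.
case: w => [//|f] /IH le1; apply: (@ord_le_sup _ _ (fun i => OSucc (wrank (f i))) j).
exact: ord_le_trans le1 (ord_leS _).
Qed.

Local Notation T w := (ptree (valid w)).

Lemma wtree_child w (t : T w) f : subtree w t = WNode f ->
  forall j, exists2 c : T w, pseq c = rcons t j & subtree w c = f j.
Proof.
move=> tf j; have cv : valid w (rcons t j).
  by rewrite -cats1 valid_cat (pseqP t) tf /= valid0.
exists (Ptree cv) => //=.
by rewrite -cats1 subtree_cat tf /= subtree0.
Qed.

Lemma wtree_above w (s t : T w) : (t < s)%O -> exists f j, subtree w t = WNode f /\
  ord_le (wrank (subtree w s)) (wrank (f j)).
Proof.
rewrite lt_neqAle ptree_leE => /andP[/eqP ts /prefixP[r sE]].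
have := pseqP s; rewrite sE valid_cat (pseqP t) /= => vr.
case: r sE vr => [|j r] sE; first by rewrite cats0 in sE; case: ts; exact: val_inj.
rewrite subtree_cat; case: (subtree w t) => [//|f] /= vr.
by exists f, j; split=> //; exact: wrank_subtree.
Qed.

Definition wtree_rank w (t : T w) := wrank (subtree w t).

Lemma wtree_rank_fun w : rank_fun (@wtree_rank w).
Proof.
move=> t z; split=> [|[s /wtree_above[f [j [tf sj]]] zs]]; last first.
  by rewrite /wtree_rank tf; exists j; exact: ord_le_trans zs sj.
rewrite /wtree_rank; case tf: (subtree w t) => [|f] //= [j zj].
have [c cE cf] := wtree_child tf j; exists c; last by rewrite cf.
by case: (ptree_below_child cE).
Qed.

Lemma wtree_gt_wf w : well_founded (fun s t : T w => (t < s)%O).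
Proof.
suff H a : forall t, wtree_rank t = a -> Acc (fun s t : T w => (t < s)%O) t.
  by move=> t; exact: H erefl.
elim/(well_founded_ind ord_lt_wf): a => a IH t ta; constructor=> s ts.
by apply: (IH (wtree_rank s)) => //; rewrite -ta; exact: rank_fun_lt (@wtree_rank_fun w) ts.
Qed.

Fixpoint hereditary (P : (J -> wtree J) -> Prop) w : Prop :=
  if w is WNode f then P f /\ forall j, hereditary P (f j) else True.

Lemma hereditary_subtree P w s : hereditary P w -> hereditary P (subtree w s).
Proof.
elim: s w => [|j s IH] [|f] //= [_ fP]; exact: IH.
Qed.

End WTree.

(** * Blossomed trees of prescribed rank *)

Definition monotone_branching (f : nat -> wtree nat) :=
  forall m n, (m <= n)%N -> ord_le (wrank (f m)) (wrank (f n)).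

(** Running maxima of an enumeration of the smaller ordinals. Nondecreasing
    sequences are what the definition of a blossomed tree asks of the children. *)
Lemma countable_ord_seq xi z0 : ord_countable xi -> ord_lt z0 xi ->
  exists b : nat -> ord, [/\ forall n, ord_lt (b n) xi,
    forall m n, (m <= n)%N -> ord_le (b m) (b n) &
    forall z, ord_lt z xi -> exists n, ord_le z (b n)].
Proof.
move=> [g gP] z0xi.
pose a n := if pselect (ord_lt (g n) xi) is left _ then g n else z0.
have a_lt n : ord_lt (a n) xi by rewrite /a; case: pselect.
pose max x y := if pselect (ord_le x y) is left _ then y else x.
have max_l x y : ord_le x (max x y).
  by rewrite /max; case: pselect => // _; exact: ord_le_refl.
have max_r x y : ord_le y (max x y).
  rewrite /max; case: pselect => [_|/ord_ltNge/ord_ltW//]; exact: ord_le_refl.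
pose b := fix b n := if n is m.+1 then max (b m) (a m.+1) else a 0%N.
exists b; split.
- elim=> [|n IH]; first exact: a_lt.
  by rewrite /= /max; case: pselect => _; [exact: a_lt|exact: IH].
- move=> m n /subnK <-; elim: (n - m)%N => [|i IH]; first exact: ord_le_refl.
  exact: ord_le_trans IH (max_l _ _).
- move=> z zxi; have [n [zg gz]] := gP z zxi; exists n.
  have za : ord_le z (a n).
    rewrite /a; case: pselect => // -[].
    exact: ord_le_lt_trans gz zxi.
  by apply: ord_le_trans za _; case: n {zg gz} => [|n]; [exact: ord_le_refl|exact: max_r].
Qed.

Lemma monotone_wtree_exists xi : ord_countable xi ->
  exists2 w : wtree nat, hereditary monotone_branching w & ord_eq (wrank w) xi.
Proof.
elim/(well_founded_ind ord_lt_wf): xi => xi IH xi_count.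
have [[z0 z0xi]|/forallNP N] := pselect (exists z0, ord_lt z0 xi); last first.
  exists (WLeaf nat) => //; split=> //=.
  by have [/N|] := ord_ltVge OZero xi.
have [b [b_lt b_mono b_cof]] := countable_ord_seq xi_count z0xi.
have bw n : exists w : wtree nat, hereditary monotone_branching w /\ ord_eq (wrank w) (b n).
  have [|w wm wb] := IH (b n) (b_lt n); last by exists w.
  have [g gP] := xi_count; exists g => z zb; apply: gP.
  exact: ord_lt_le_trans zb (ord_ltW (b_lt n)).
have /choice[w wP] := bw.
exists (WNode w).
  split=> [m n mn|n]; last by case: (wP n).
  have [_ [mb _]] := wP m; have [_ [_ nb]] := wP n.
  exact: ord_le_trans mb (ord_le_trans (b_mono _ _ mn) nb).
have le1 : ord_le (wrank (WNode w)) xi.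
  move=> n; have [_ [wb _]] := wP n; exact: ord_le_lt_trans wb (b_lt n).
split=> //; have [lt1|//] := ord_ltVge (wrank (WNode w)) xi.
have [n zn] := b_cof _ lt1; have [_ [_ bwn]] := wP n.
case: (@ord_lt_irr (wrank (w n))).
apply: (@ord_lt_le_trans (wrank (WNode w))); last exact: ord_le_trans zn bwn.
by exists n; exact: ord_le_refl.
Qed.

Lemma ptree_countable (v : pred (seq nat)) : countable [set: ptree v].
Proof.
apply/countable_injP; exists (fun t => choice.pickle (pseq t)) => s t _ _ st.
exact/val_inj/(pcan_inj choice.pickleK).
Qed.

Lemma infinite_of_injection (T : choiceType) (f : nat -> T) : injective f ->
  infinite_set [set: T].
Proof.
move=> f_inj fin; have [n] := injective_escapes (fset_set [set: T]) f_inj.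
by rewrite in_fset_set// mem_setT.
Qed.

Section MonotoneTree.
Variables (w : wtree nat).
Hypothesis w_mono : hereditary monotone_branching w.
Local Notation T := (ptree (valid w)).

Lemma wtree_next (t : T) f : subtree w t = WNode f ->
  exists psi : nat -> T, set_bij [set: nat] (tree_next t) psi /\
    forall n, subtree w (psi n) = f n.
Proof.
move=> tf; have /choice[psi psiP] : forall n, exists c : T, pseq c = rcons t n /\ subtree w c = f n.
  by move=> n; have [c] := wtree_child tf n; exists c.
exists psi; split; last by move=> n; case: (psiP n).
split=> [n _|m n _ _ mn|c [tc cmin]].
- have [cE _] := psiP n; have [tc cmax] := ptree_below_child cE.
  split=> // s ts; rewrite le_eqVlt => /predU1P[//|/cmax st].
  by have := lt_le_trans ts st; rewrite ltxx.
- have [mE _] := psiP m; have [nE _] := psiP n.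
  by have := congr1 (last 0%N \o @pseq _ _) mn; rewrite /= mE nE !last_rcons.
- have : (t < c)%O := tc; rewrite lt_neqAle => /andP[tc' /prefixP[s cE]].
  case: s cE => [|n s] cE.
    by move: tc'; rewrite cats0 in cE; rewrite -(inj_eq val_inj) /= cE eqxx.
  exists n => //; have [nE _] := psiP n; have [tn _] := ptree_below_child nE.
  by apply: cmin => //; rewrite ptree_leE nE cE -cat_rcons prefix_prefix.
Qed.

Lemma wtree_blossomed : blossomed T.
Proof.
split.
- exact: ptree_is_tree.
- exact: ptree_countable.
- exact: ptree_rooted (valid0 w).
- exact/ptree_wf_tree/wtree_gt_wf.
- move=> t tmax; case tf: (subtree w t) => [|f].
    case: tmax; split=> // s _; rewrite le_eqVlt => /predU1P[//|/wtree_above].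
    by rewrite tf => -[f [j []]].
  have [psi [psi_bij psiE]] := wtree_next tf; exists psi; split=> // m n mn.
  have := hereditary_subtree t w_mono; rewrite tf => -[f_mono _].
  have [le1 _] := node_rankE (psi m) (@wtree_rank_fun _ w).
  have [_ le2] := node_rankE (psi n) (@wtree_rank_fun _ w).
  apply: ord_le_trans le1 _; apply: ord_le_trans le2; rewrite /wtree_rank !psiE.
  exact: f_mono.
Qed.

Lemma wtree_infinite : ord_lt OZero (wrank w) -> ([set: T] #= [set: nat])%card.
Proof.
move=> w0; apply: eq_card_nat; first exact: ptree_countable.
case wE: w w0 => [//|f] _.
have tf : subtree w (proot (valid0 w)) = WNode f by rewrite /= subtree0.
have [psi [[_ psi_inj _] _]] := wtree_next tf; rewrite -wE.
apply: (@infinite_of_injection _ psi) => m n; apply: psi_inj; exact: mem_setT.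
Qed.

End MonotoneTree.

(** A blossomed tree with root of rank [omega ^ beta] has rank
    [omega ^ beta + 1], which is below [omega ^ (beta + 1)]; so its summation operator
    is not beta-Szlenk and factors through all operators of this kind. *)
Lemma universal_exists (R : realType) (k : scalar_kind) (beta : ord) :
  ord_lt beta omega1 -> exists (W Z : completeNormedModType (scalar_field R k))
    (Ups : operator W Z), universal (@non_szlenk R k beta) Ups.
Proof.
move=> /lt_omega1_pow /(omega1_first_uncountable.2) /monotone_wtree_exists[w w_mono [w_le le_w]].
have gt0 := ord_pow_omega_gt0 beta.
pose T := ptree (valid w); pose r : T := proot (valid0 w).
have T_blossomed : blossomed T := wtree_blossomed w_mono.
have [T_tree _ T_rooted T_wf _] := T_blossomed.
have TN : ([set: T] #= [set: nat])%card.
  by apply: wtree_infinite; exact: ord_lt_le_trans gt0 le_w.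
have rankE : wtree_rank r = wrank w by rewrite /wtree_rank /= subtree0.
exists _, _, (Sigma R k (star T)); split.
  apply: blossomed_non_szlenk => //; apply: ord_le_trans le_w _; rewrite -rankE.
  exact/ord_ltW/lt_tree_rank/wtree_rank_fun.
move=> X Y S S_non; apply: (non_szlenk_factors S_non) => //.
have rank_le : ord_le (tree_rank T) (OSucc (wrank w)).
  apply: (tree_rank_le (@wtree_rank_fun _ w)) => t; rewrite -rankE.
  exact: (rank_fun_le (@wtree_rank_fun _ w) (proot_le _ t)).
apply: ord_le_lt_trans rank_le _.
have w_lt : ord_lt (wrank w) (ord_pow omega (OSucc beta)).
  exact: ord_le_lt_trans w_le (ord_powS_gt beta).
case: (ord_pow_limit (OSucc beta)) => [le1|]; last exact.
case: (@ord_lt_irr (OSucc OZero)); apply: ord_lt_le_trans le1.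
exact: ord_le_lt_trans gt0 (ord_powS_gt beta).
Qed.

(** * Weak* compactness *)

Section Compactness.
Variables (R : realType) (k : scalar_kind).
Local Notation K := (scalar_field R k).

(** An ultrafilter contains one color class of every finite coloring, hence is
    Cauchy. *)
Lemma disc_compact (c : R) : compact [set a : K^o | rnorm a <= c].
Proof.
rewrite compact_ultra => F FU Fc.
have small (e : R) : 0 < e -> exists2 A : set K^o, F A &
    forall a b, A a -> A b -> rnorm (a - b) <= e.
  move=> e0; have [Q [q qP]] := scalar_coloring k c e0.
  suff [i Fi] : exists i, F [set a : K^o | q a = i].
    exists ([set a : K^o | rnorm a <= c] `&` [set a : K^o | q a = i]).
      exact: filterI.
    by move=> a b [ac ai] [bc bi]; apply: qP; rewrite ?ai ?bi.
  apply: contrapT => /forallNP N.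
  have H (l : seq Q) : F [set a : K^o | q a \notin l].
    elim: l => [|i l IH]; first by apply: filterE => a.
    have [/N//|Fi] := in_ultra_setVsetC [set a : K^o | q a = i] FU.
    apply: filterS2 IH Fi => a al ai /=; rewrite inE negb_or al andbT.
    exact/eqP.
  have [a] := filter_ex (H (enum Q)).
  by rewrite /= mem_enum.
have [l Fl] : exists l : K^o, F --> l.
  apply/cvg_ex; apply: scalar_complete; apply/cauchy_exP => e e0.
  have eE : of_real k (to_real e) = e by rewrite to_realK// gtr0_real.
  have {}e0 : 0 < to_real e by rewrite -(of_real_lt k) of_real0 eE.
  have [A FA AP] := small (to_real e / 2) (divr_gt0 e0 (ltr0Sn R 1)).
  have [a Aa] := filter_ex FA; exists a; apply: filterS FA => b Ab.
  rewrite -ball_normE /= -rnormK -eE of_real_lt.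
  by apply: le_lt_trans (AP a b Aa Ab) _; rewrite ltr_pdivrMr// ltr_pMr ?ltr1n.
exists l; split=> //=; apply/ler_addgt0Pr => e e0.
have Fb : F (ball l (of_real k e)) by apply: Fl; apply: nbhsx_ballx; exact: of_real_gt0.
have [a [ac]] := filter_ex (filterI Fc Fb).
rewrite -ball_normE /= -rnormK of_real_lt => /ltW la.
rewrite -(subrK a l) addrC; apply: le_trans (rnormD _ _) _; exact: lerD.
Qed.

Variables (X : normedModType K) (b : X -> R).

(** The linear functionals dominated by [b]; with [b x = c * rnorm (S x)] they
    contain [c] times the image of the dual ball under the adjoint of [S]. *)
Definition dominated : set (X -> K^o) :=
  [set phi | linear phi /\ forall x, rnorm (phi x) <= b x].

(** Tychonoff's theorem gives a cluster point of the directed family [E]; linearity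
    passes to it because it involves three evaluations at a time. *)
Lemma dominated_limit (J : Type) (E : J -> set (X -> K^o)) : inhabited J ->
  (forall j, E j !=set0) -> (forall j, E j `<=` dominated) ->
  (forall i j, exists l, E l `<=` E i `&` E j) ->
  exists2 phi, dominated phi & forall j (s : seq X) (c : R), 0 < c ->
    exists2 psi, E j psi & forall x, x \in s -> rnorm (psi x - phi x) < c.
Proof.
move=> [j0] E0 Edom Edir; pose F := filter_from [set: J] E.
have FF : ProperFilter F.
  apply: filter_from_proper; last by move=> j _; exact: E0.
  apply: filter_from_filter; first by exists j0.
  by move=> i j _ _; have [l El] := Edir i j; exists l.
have := @tychonoff X (fun=> K^o) (fun x => [set a : K^o | rnorm a <= b x])
  (fun x => @disc_compact (b x)).
move=> /(_ F FF)[|phi [phib phiF]].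
  by exists j0 => // psi /Edom[].
have near j (s : seq X) (c : R) : 0 < c ->
    exists2 psi, E j psi & forall x, x \in s -> rnorm (psi x - phi x) < c.
  move=> c0; have [psi [Ej psi_near]] : E j `&`
      [set psi : {ptws X -> K^o} | forall x, x \in s -> rnorm (psi x - phi x) < c] !=set0.
    apply: phiF; first by exists j.
    apply: open_nbhs_nbhs; split; last by move=> x _; rewrite subrr rnorm0.
    exact: ptws_near_open.
  by exists psi.
exists phi => //; split=> // a x y.
apply/eqP; rewrite -subr_eq0; apply/eqP/rnorm0_eq0/eqP.
rewrite eq_le rnorm_ge0 andbT; apply/ler_addgt0Pr => e e0; rewrite add0r.
pose c := e / (2 + rnorm (a : K^o)).
have d0 : 0 < 2 + rnorm (a : K^o) by rewrite ltr_wpDr ?rnorm_ge0.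
have [psi /Edom[psi_lin _] psi_near] := near j0 [:: a *: x + y; x; y] c (divr_gt0 e0 d0).
have n1 := psi_near (a *: x + y) (mem_head _ _).
have n2 : rnorm (psi x - phi x) < c by apply: psi_near; rewrite !inE eqxx orbT.
have n3 : rnorm (psi y - phi y) < c by apply: psi_near; rewrite !inE eqxx !orbT.
have -> : phi (a *: x + y) - (a *: phi x + phi y) =
    a *: (psi x - phi x) + (psi y - phi y) - (psi (a *: x + y) - phi (a *: x + y)).
  have alg (u v u' v' z : K) : z - (a * u + v) =
      a * (u' - u) + (v' - v) - (a * u' + v' - z) by ring.
  by rewrite psi_lin; exact: alg.
apply: le_trans (rnormD _ _) _; rewrite rnormN.
apply: le_trans (lerD (rnormD _ _) (ltW n1)) _; rewrite rnormZ.
have -> : e = rnorm (a : K^o) * c + c + c.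
  by rewrite /c; field; rewrite gt_eqF.
by rewrite !lerD// ?ler_wpM2l ?rnorm_ge0// ltW.
Qed.

End Compactness.

(** * Fragmentation over well-founded trees *)

Section RelativelyOpen.
Variables (R : realType) (k : scalar_kind) (X : normedModType (scalar_field R k)).
Local Notation K := (scalar_field R k).
Implicit Types A : set (X -> K^o).

(** Openness relative to the pointwise topology. It composes, so small pieces can
    be cut out one group of coordinates at a time. *)
Definition rel_open A' A := A' `<=` A /\ forall phi, A' phi ->
  exists (s : seq X) (c : R), 0 < c /\
    forall psi, A psi -> (forall x, x \in s -> rnorm (psi x - phi x) < c) -> A' psi.

Lemma rel_open_refl A : rel_open A A.
Proof. by split=> // phi _; exists [::], 1. Qed.

Lemma rel_open_trans A1 A2 A3 : rel_open A1 A2 -> rel_open A2 A3 -> rel_open A1 A3.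
Proof.
move=> [A12 H1] [A23 H2]; split=> [phi /A12/A23//|phi A1phi].
have [s1 [c1 [c1_gt0 P1]]] := H1 phi A1phi.
have [s2 [c2 [c2_gt0 P2]]] := H2 phi (A12 _ A1phi).
exists (s1 ++ s2), (Num.min c1 c2); split; first by rewrite lt_min c1_gt0.
move=> psi A3psi near; apply: P1.
  apply: P2 => // x xs; apply: lt_le_trans (near x _) _; first by rewrite mem_cat xs orbT.
  by rewrite ge_min lexx orbT.
move=> x xs; apply: lt_le_trans (near x _) _; first by rewrite mem_cat xs.
by rewrite ge_min lexx.
Qed.

Lemma rel_open_ball A (phi0 : X -> K^o) (s : seq X) (c : R) :
  rel_open (A `&` [set psi | forall x, x \in s -> rnorm (psi x - phi0 x) < c]) A.
Proof.
split=> [phi []//|phi [_ near0]].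
have [c' [c'0 c'c]] : exists c', 0 < c' /\
    forall x, x \in s -> rnorm (phi x - phi0 x) + c' <= c.
  elim: s near0 => [_|x s IH near0]; first by exists 1.
  have [|c' [c'0 c'c]] := IH; first by move=> y ys; apply: near0; rewrite inE ys orbT.
  have x0 : 0 < c - rnorm (phi x - phi0 x) by rewrite subr_gt0 near0// mem_head.
  exists (Num.min c' (c - rnorm (phi x - phi0 x))); split; first by rewrite lt_min c'0.
  move=> y; rewrite inE => /predU1P[->|ys].
    by rewrite addrC -lerBrDr ge_min lexx orbT.
  by apply: le_trans (c'c y ys); rewrite lerD2l ge_min lexx.
exists s, c'; split=> // psi Apsi near; split=> // x xs.
rewrite -(subrKA (phi x)); apply: le_lt_trans (rnormD _ _) _.
by apply: lt_le_trans (c'c x xs); rewrite addrC ltrD2l near.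
Qed.

End RelativelyOpen.

Section Fragmentation.
Variables (R : realType) (k : scalar_kind) (d : Order.disp_t) (P : porderType d).
Local Notation K := (scalar_field R k).
Local Notation e_ := (unit_vector R k).
Hypothesis P_below : forall t : P, finite_set [set s | (s <= t)%O].
Hypothesis P_chain : forall r s t : P, (r <= t)%O -> (s <= t)%O ->
  (r <= s)%O \/ (s <= r)%O.
Hypothesis P_wf : well_founded (fun s t : P => (t < s)%O).
Variable C : R.
Hypothesis C_ge0 : 0 <= C.
Implicit Types (S : set P) (A : set (ell1 R k P -> K^o)) (F : seq P).

Local Notation B := (dominated (fun x => C * rnorm (Sigma R k P x))).

Definition antichain F := uniq F /\ forall s t, s \in F -> t \in F -> (s <= t)%O -> s = t.

(** The vectors of an antichain, with unimodular coefficients, are mapped by the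
    summation operator into the unit ball, because a branch meets an antichain in
    at most one point. *)
Lemma antichain_sum_le phi F : B phi -> antichain F ->
  \sum_(t <- F) rnorm (phi (e_ t)) <= C.
Proof.
move=> [phi_lin phi_le] [F_uniq F_anti].
have phi0 : phi 0 = 0.
  by have := phi_lin (-1) 0 0; rewrite scaleN1r addr0 oppr0 scaleN1r addNr.
pose s_ t : K := if phi (e_ t) == 0 then 0 else `|phi (e_ t)| / phi (e_ t).
have s_le t : rnorm (s_ t : K^o) <= 1.
  rewrite /s_; case: eqVneq => [_|n0]; first by rewrite rnorm0.
  by rewrite -(of_real_le k) rnormK normf_div normr_id divff ?normr_eq0//; case: (k).
have s_phi t : s_ t * phi (e_ t) = of_real k (rnorm (phi (e_ t))).
  rewrite rnormK /s_; case: eqVneq => [->|n0]; first by rewrite mul0r normr0.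
  by rewrite divfK.
pose x := \sum_(t <- F) s_ t *: e_ t.
have phix : phi x = of_real k (\sum_(t <- F) rnorm (phi (e_ t))).
  rewrite /x; elim: F {F_uniq F_anti x} => [|t F IH]; first by rewrite !big_nil phi0 of_real0.
  by rewrite !big_cons phi_lin IH of_realD; congr (_ + _); rewrite -s_phi.
have Sx u : Sigma R k P x u = \sum_(t <- F) (if (t <= u)%O then s_ t else 0).
  have [L LE] := Sigma_op R k u.
  rewrite -LE /x; elim: F {F_uniq F_anti x phix} => [|t F IH].
    by rewrite !big_nil (linear0 L).
  rewrite !big_cons (linearD L) IH (linearZ_LR L) LE Sigma_unit; congr (_ + _).
  by case: ifP => _; [exact: mulr1|exact: mulr0].
have Sx_le : rnorm (Sigma R k P x) <= 1.
  rewrite -lee_fin fnspace_rnormE; apply/ellinf_normP => // u; rewrite lee_fin Sx.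
  have [[t tF tu]|N] := pselect (exists2 t, t \in F & (t <= u)%O); last first.
    rewrite big1_seq ?rnorm0 ?ler01// => t /andP[_ tF]; rewrite ifN//.
    by apply/negP => tu; apply: N; exists t.
  rewrite (big_rem t)//= tu big1_seq ?addr0// => t' /andP[_].
  rewrite mem_rem_uniq// inE => /andP[t't t'F]; rewrite ifN//; apply/negP => t'u.
  have [le1|le1] := P_chain tu t'u.
    by move: t't; rewrite (F_anti t t' tF t'F le1) eqxx.
  by move: t't; rewrite (F_anti t' t t'F tF le1) eqxx.
have S0 : 0 <= \sum_(t <- F) rnorm (phi (e_ t)).
  by apply: sumr_ge0 => t _; exact: rnorm_ge0.
have <- : rnorm (phi x) = \sum_(t <- F) rnorm (phi (e_ t)).
  by rewrite phix /rnorm ger0_norm ?of_realK// -(of_real0 R k) of_real_le.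
apply: le_trans (phi_le x) _.
by rewrite ler_piMr.
Qed.

Definition fragmented S := forall A (e : R), A `<=` B -> A !=set0 -> 0 < e ->
  exists A', [/\ A' !=set0, rel_open A' A & forall phi psi t, A' phi -> A' psi -> S t ->
    rnorm (phi (e_ t) - psi (e_ t)) <= e].

Lemma fragmented_sub S S' : S `<=` S' -> fragmented S' -> fragmented S.
Proof.
move=> SS' H A e AB A0 e0; have [A' [A'0 A'A A'e]] := H A e AB A0 e0.
by exists A'; split=> // phi psi t phiA psiA /SS'; exact: A'e.
Qed.

Lemma fragmented_union S S' : fragmented S -> fragmented S' -> fragmented (S `|` S').
Proof.
move=> H H' A e AB A0 e0; have [A1 [A10 A1A A1e]] := H A e AB A0 e0.
have A1B : A1 `<=` B by move=> phi /A1A.1/AB.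
have [A2 [A20 A21 A2e]] := H' A1 e A1B A10 e0.
exists A2; split=> //; first exact: rel_open_trans A21 A1A.
by move=> phi psi t phi2 psi2 [St|St]; [apply: A1e => //; exact: A21.1|exact: A2e].
Qed.

Lemma fragmented_seq F : (forall u, u \in F -> fragmented [set t | (u <= t)%O]) ->
  fragmented [set t | exists2 u, u \in F & (u <= t)%O].
Proof.
elim: F => [_|u F IH FP].
  by move=> A e AB A0 e0; exists A; split=> // [|phi psi t _ _ []//]; exact: rel_open_refl.
apply: (@fragmented_sub _ ([set t | (u <= t)%O] `|` [set t | exists2 u, u \in F & (u <= t)%O])).
  by move=> t [v]; rewrite inE => /predU1P[->|vF vt]; [left|right; exists v].
apply: fragmented_union; first by apply: FP; rewrite mem_head.
by apply: IH => v vF; apply: FP; rewrite inE vF orbT.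
Qed.

Lemma fragmented_point t : fragmented [set t].
Proof.
move=> A e AB [phi0 A0] e0.
exists (A `&` [set psi | forall x, x \in [:: e_ t] -> rnorm (psi x - phi0 x) < e / 2]).
split; [|exact: rel_open_ball|].
  by exists phi0; split=> // x _; rewrite subrr rnorm0 divr_gt0.
move=> phi psi _ [_ /(_ _ (mem_head _ _)) h1] [_ /(_ _ (mem_head _ _)) h2] ->.
rewrite -(subrKA (phi0 (e_ t))); apply: le_trans (rnormD _ _) _.
by rewrite (rnormB (phi0 _)) [leRHS]splitr lerD// ltW.
Qed.

(** Fix an antichain nearly realizing the supremum of the antichain sums over the
    set. Nearby, every node incomparable to it has a small value; the remaining
    nodes lie above finitely many nodes of [S]. *)
Lemma fragmented_step S : (forall s t, S s -> (s <= t)%O -> S t) ->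
  (forall u, S u -> fragmented [set t | (u <= t)%O]) -> fragmented S.
Proof.
move=> S_up Su A e AB [phi1 A1] e0.
pose sums := [set x | exists phi F, [/\ A phi, antichain F, {subset F <= [pred t | `[< S t >]]} &
  x = \sum_(t <- F) rnorm (phi (e_ t))]].
have sums_sup : has_sup sums.
  split; first by exists 0, phi1, [::]; split=> //; rewrite big_nil.
  by exists C => _ [phi [F [Aphi F_anti _ ->]]]; apply: antichain_sum_le => //; exact: AB.
have e4 : 0 < e / 4 by rewrite divr_gt0.
have [_ [phi0 [F [A0 F_anti FS ->]]] sup_lt] := sup_adherent e4 sums_sup.
have {FS} FS t : t \in F -> S t by move=> tF; have /asboolP := FS t tF.
pose c := e / 4 / (size F).+1%:R.
have c0 : 0 < c by rewrite divr_gt0 ?ltr0n.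
pose A' := A `&` [set psi | forall x, x \in [seq e_ t | t <- F] -> rnorm (psi x - phi0 x) < c].
have A'0 : A' phi0 by split=> // x _; rewrite subrr rnorm0.
have A'sum psi : A' psi ->
    \sum_(t <- F) rnorm (phi0 (e_ t)) - e / 4 <= \sum_(t <- F) rnorm (psi (e_ t)).
  move=> [_ near]; rewrite lerBlDr.
  apply: (@le_trans _ _ (\sum_(t <- F) (rnorm (psi (e_ t)) + c))).
    rewrite big_seq [leRHS]big_seq; apply: ler_sum => t tF.
    rewrite -[phi0 _](subrK (psi (e_ t))) addrC; apply: le_trans (rnormD _ _) _.
    by rewrite lerD2l rnormB ltW// near// map_f.
  rewrite big_split/= lerD2l big_const_seq count_predT iter_addr_0 -[c *+ _]mulr_natl /c mulrCA.
  by rewrite ger_pMr// ler_pdivrMr// mul1r ler_nat.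
have incomp psi s : A' psi -> S s -> (forall t, t \in F -> ~ (s <= t)%O /\ ~ (t <= s)%O) ->
    rnorm (psi (e_ s)) <= e / 2.
  move=> A'psi Ss sF; have : rnorm (psi (e_ s)) + \sum_(t <- F) rnorm (psi (e_ t)) <= sup sums.
    apply: sup_ubound; first by case: sums_sup.
    exists psi, (s :: F); rewrite big_cons; split=> //; first by case: A'psi.
    - split; first by rewrite /= F_anti.1 andbT; apply/negP => /sF[]; rewrite lexx.
      move=> a b; rewrite !inE => /predU1P[->|aF] /predU1P[->|bF] ab //.
      + by have [] := sF b bF.
      + by have [] := sF a aF.
      + exact: F_anti.2.
    - by move=> a; rewrite inE => /predU1P[->|/FS aS]; exact/asboolP.
  have := A'sum psi A'psi; move: sup_lt; lra.
(* [G] consists of the nodes of [S] below the antichain. *)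
have [G GP] : exists G : seq P, forall t, t \in G <-> S t /\ exists2 u, u \in F & (t <= u)%O.
  have fin : finite_set (\bigcup_(u in [set` F]) [set t | (t <= u)%O] `&` S).
    apply: (@sub_finite_set _ _ (\bigcup_(u in [set` F]) [set t | (t <= u)%O])).
      exact: subIsetl.
    by apply: bigcup_finite => [|u _]; [exact: finite_seq|exact: P_below].
  have /finite_seqP[G GE] := fin; exists G => t.
  have -> : (t \in G) = [set` G] t :> Prop by [].
  rewrite -GE; split=> [[[u uF tu] St]|[St [u uF tu]]]; first by split=> //; exists u.
  by split=> //; exists u.
have G_frag : fragmented [set t | exists2 u, u \in G & (u <= t)%O].
  by apply: fragmented_seq => u /GP[uS _]; exact: Su.
have [|A'' [A''0 A''A' A''e]] := G_frag A' e _ (ex_intro _ phi0 A'0) e0.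
  by move=> phi [/AB].
exists A''; split=> //; first exact: rel_open_trans A''A' (rel_open_ball _ _ _ _).
move=> phi psi t Aphi Apsi St.
have [[u uF tu]|N] := pselect (exists2 u, u \in F & (t <= u)%O \/ (u <= t)%O).
  apply: A''e => //; case: tu => [tu|ut]; last by exists u => //; apply/GP; split; [exact: FS|exists u].
  by exists t => //; apply/GP; split=> //; exists u.
have tF u : u \in F -> ~ (t <= u)%O /\ ~ (u <= t)%O.
  by move=> uF; split=> tu; apply: N; exists u => //; [left|right].
apply: le_trans (rnormD _ _) _; rewrite rnormN [leRHS]splitr.
by apply: lerD; apply: incomp => //; exact: A''A'.1.
Qed.

(** Induction from the leaves: above a node apply the step, then add the node. *)
Lemma fragmented_all : fragmented setT.
Proof.
apply: fragmented_step => // u _.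
elim/(well_founded_ind P_wf): u => u IH.
apply: (@fragmented_sub _ ([set u] `|` [set t | (u < t)%O])).
  by move=> t /=; rewrite le_eqVlt => /predU1P[->|ut]; [left|right].
apply: fragmented_union; first exact: fragmented_point.
apply: fragmented_step => [s t us st|s us]; first exact: lt_le_trans us st.
exact: IH.
Qed.

End Fragmentation.

(** * Operators factoring through well-founded summation *)

Section StableSet.
Variables (R : realType) (k : scalar_kind) (X : normedModType (scalar_field R k)).

(** If no derived set is empty, the derivation has a nonempty fixed point: stop
    after every point that is ever removed has been removed. *)
Lemma stable_set (A : set (dual_space X)) (e : R) : ~ Sz_eps_defined A e ->
  exists2 B : set (dual_space X), B !=set0 & B `<=` A /\ B `<=` szlenk_der e B.
Proof.
move=> /forallNP N.
have /choice[z zP] : forall f : dual_space X, exists z, forall xi,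
    ~ szlenk_iter e A xi f -> ~ szlenk_iter e A z f.
  move=> f; have [[xi nxi]|/forallNP H] := pselect (exists xi, ~ szlenk_iter e A xi f).
    by exists xi.
  by exists OZero => xi /H.
pose xi0 := OSup z; exists (szlenk_iter e A xi0); last split.
- by apply/set0P/eqP; exact: N.
- exact: szlenk_iter_sub.
- move=> f fxi0; apply: contrapT => nf; apply: (zP f (OSucc xi0) nf).
  by case: fxi0 => _; exact.
Qed.

End StableSet.

Section FactorDefined.
Variables (R : realType) (k : scalar_kind) (d : Order.disp_t) (P : porderType d).
Local Notation K := (scalar_field R k).
Hypothesis P_below : forall t : P, finite_set [set s | (s <= t)%O].
Hypothesis P_chain : forall r s t : P, (r <= t)%O -> (s <= t)%O ->
  (r <= s)%O \/ (s <= r)%O.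
Hypothesis P_wf : well_founded (fun s t : P => (t < s)%O).
Variables (W Z : completeNormedModType K) (Ups : operator W Z).
Hypothesis Ups_factors : factors_through Ups (Sigma R k P).

(** A fixed set of the derivation would lift to a minimal weak*-closed set of
    functionals on summable families; a small piece of that set contains all
    lifts of the points near some point of the fixed set, which is then removed
    by one more derivation. *)
Lemma factor_Sz_defined : op_Sz_defined Ups.
Proof.
have [U [V VU]] := Ups_factors.
move=> e e0; apply: contrapT => /stable_set[Q [p0 Qp0] [QK Qder]].
have [M M0 VM] := op_rbound V; have [N N0 UN] := op_rbound U.
pose bd (x : ell1 R k P) := M * rnorm (Sigma R k P x).
pose B := dominated bd.
pose lift (p : dual_space W) (phi : ell1 R k P -> K^o) := forall w, phi (U w) = p w.
have Qlift p : Q p -> exists2 phi, B phi & lift p phi.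
  move=> /QK[z z1 <-]; exists (fun x => z (V (Sigma R k P x))).
    split=> [a x y|x]; first exact: (linearP (op_comp z (op_comp V (Sigma R k P)))).
    apply: le_trans (dual_ball_le z1 _) _; exact: VM.
  by move=> w /=; rewrite VU.
have lift_limit (p : dual_space W) phi (c : seq W -> R -> ell1 R k P -> K^o) :
    (forall s e', 0 < e' -> forall w, w \in s ->
      rnorm (c s e' (U w) - phi (U w)) < e' /\ rnorm (c s e' (U w) - p w : K^o) < e') ->
    lift p phi.
  move=> cP w; apply/eqP; rewrite -subr_eq0; apply/eqP/rnorm0_eq0/eqP.
  rewrite eq_le rnorm_ge0 andbT; apply/ler_addgt0Pr => e' e'0; rewrite add0r.
  have [h1 h2] := cP [:: w] (e' / 2) (divr_gt0 e'0 (ltr0Sn _ 1)) w (mem_head _ _).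
  rewrite -(subrKA (c [:: w] (e' / 2) (U w))); apply: le_trans (rnormD _ _) _.
  by rewrite [leRHS]splitr lerD// ?(ltW h2)// rnormB ltW.
(* By compactness the union of a chain of good sets is good; the complement of a
   maximal one is a minimal closed set lifting [Q]. *)
pose good (D : set {ptws ell1 R k P -> K^o}) := open D /\
  forall p, Q p -> exists phi, [/\ B phi, ~ D phi & lift p phi].
have [F Fgood Ftot|D [[D_open D_good] D_max]] := @Zorn_bigcup _ good.
  split=> [|p Qp]; first by apply: bigcup_open => D /Fgood[].
  have [[D0 FD0]|/forallNP F0] := pselect (exists D, F D); last first.
    by have [phi Bphi pphi] := Qlift p Qp; exists phi; split=> // -[D /F0].
  pose E (D : {D | F D}) := [set phi | [/\ B phi, ~ sval D phi & lift p phi]].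
  have [|[D FD]|D phi [//]|D1 D2|phi Bphi near] := @dominated_limit _ _ _ bd _ E.
  - exact: inhabits (exist _ D0 FD0).
  - by have [_ /(_ p Qp)[phi]] := Fgood D FD; exists phi.
  - have [D12|D21] := Ftot _ _ (svalP D1) (svalP D2).
      by exists D2 => phi [Bphi nD pphi]; split; split=> // /D12.
    by exists D1 => phi [Bphi nD pphi]; split; split=> // /D21.
  exists phi; split=> // [[D FD Dphi]|].
    have [D_open _] := Fgood D FD; have [s [c [c0 cD]]] := ptws_basis D_open Dphi.
    have [psi [_ nD _] psi_near] := near (exist _ D FD) s c c0.
    by apply: nD; exact: cD.
  have /choice[g gP] : forall sc : seq W * R, exists psi, 0 < sc.2 -> lift p psi /\
      forall w, w \in sc.1 -> rnorm (psi (U w) - phi (U w)) < sc.2.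
    move=> [s c]; have [c0|c0] := ltP 0 c; last by exists phi.
    have [psi [_ _ ppsi] psi_near] := near (exist _ D0 FD0) [seq U w | w <- s] c c0.
    by exists psi => _; split=> // w ws; apply: psi_near; exact: map_f.
  apply: (lift_limit _ _ (fun s c => g (s, c))) => s c c0 w ws.
  have [pg gnear] := gP (s, c) c0; split; first exact: gnear.
  by rewrite pg subrr rnorm0.
pose C := B `&` ~` D.
have C0 : C !=set0 by have [phi [Bphi nD _]] := D_good p0 Qp0; exists phi.
have eN : 0 < e / N by rewrite divr_gt0.
have CB : C `<=` B by move=> phi [].
have [A' [[phi0 A'0] [A'C A'open] A'e]] :=
  fragmented_all P_below P_chain P_wf (ltW M0) CB C0 eN.
have [s0 [c0 [c0_gt0 A'near]]] := A'open phi0 A'0.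
pose G : set {ptws ell1 R k P -> K^o} :=
  [set psi | forall x, x \in s0 -> rnorm (psi x - phi0 x) < c0].
have G_open : open G by exact: ptws_near_open.
(* By minimality some point of [Q] has all its lifts in the small piece. *)
have [p [Qp pG]] : exists p, Q p /\ forall phi, C phi -> lift p phi -> G phi.
  apply: contrapT => /forallNP H; apply: (D_max (D `|` G)).
    split; first by move=> psi; left.
    move=> DG; have [_ nD] := A'C _ A'0; apply/nD/DG.
    by right=> x _; rewrite subrr rnorm0.
  split; first exact: openU.
  move=> p Qp; apply: contrapT => N'; apply: (H p); split=> // phi [Bphi nD] pphi.
  by apply: contrapT => nG; apply: N'; exists phi; split=> // -[].
(* By compactness the same holds for all points of [Q] near [p]. *)
have [s [c [c_gt0 sG]]] : exists (s : seq W) (c : R), 0 < c /\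
    forall p' phi, Q p' -> wball p s c p' -> C phi -> lift p' phi -> G phi.
  apply: contrapT => H.
  pose mkJ s c (c_gt0 : 0 < c) : {sc : seq W * R | 0 < sc.2} :=
    exist (fun sc : seq W * R => 0 < sc.2) (s, c) c_gt0.
  pose E (j : {sc : seq W * R | 0 < sc.2}) := [set phi | [/\ C phi, ~ G phi &
    exists p', [/\ Q p', wball p (sval j).1 (sval j).2 p' & lift p' phi]]].
  have [|[[s c] /= c_gt0]|j phi [[]//]|[[s1 c1] /= h1] [[s2 c2] /= h2]|phi Bphi near] :=
      @dominated_limit _ _ _ bd _ E.
  - exact: inhabits (mkJ [::] 1 ltr01).
  - apply: contrapT => E0; apply: H; exists s, c; split=> // p' phi Qp' ps Cphi pphi.
    apply: contrapT => nG; apply: E0; exists phi; split=> //.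
    by exists p'.
  - have h : 0 < Num.min c1 c2 by rewrite lt_min h1.
    exists (mkJ (s1 ++ s2) _ h) => phi [Cphi nG [p' [Qp' ps pphi]]]; split; split=> //.
      exists p'; split=> // w ws; apply: lt_le_trans (ps w _) _.
        by rewrite /= mem_cat ws.
      by rewrite /= ge_min lexx.
    exists p'; split=> // w ws; apply: lt_le_trans (ps w _) _.
      by rewrite /= mem_cat ws orbT.
    by rewrite /= ge_min lexx orbT.
  have j0 := mkJ [::] 1 ltr01.
  have nDphi : ~ D phi.
    move=> /(ptws_basis D_open)[s [c [c_gt0 cD]]].
    by have [psi [[_ nD] _ _] psi_near] := near j0 s c c_gt0; apply: nD; exact: cD.
  have nGphi : ~ G phi.
    move=> /(ptws_basis G_open)[s [c [c_gt0 cG]]].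
    by have [psi [_ nG _] psi_near] := near j0 s c c_gt0; apply: nG; exact: cG.
  apply: nGphi; apply: pG => //.
  have /choice[g gP] : forall sc : seq W * R, exists psi, 0 < sc.2 ->
      forall w, w \in sc.1 -> rnorm (psi (U w) - phi (U w)) < sc.2 /\
        rnorm (psi (U w) - p w : K^o) < sc.2.
    move=> [s c]; have [c_gt0|c_le] := ltP 0 c; last first.
      by exists phi.
    have [psi [_ _ [p' [_ ps ppsi]]] psi_near] :=
      near (mkJ s c c_gt0) [seq U w | w <- s] c c_gt0.
    exists psi => _ w ws; split; first by apply: psi_near; exact: map_f.
    by rewrite ppsi; exact: ps.
  by apply: (lift_limit _ _ (fun s c => g (s, c))) => s c c_gt0; exact: (gP (s, c)).
have /szlenk_derP[_ /(_ s c c_gt0)[g [h [Qg Qh gs hs [x x1 gh]]]]] := Qder p Qp.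
have inA' f : Q f -> wball p s c f -> exists2 phi, A' phi & lift f phi.
  move=> Qf fs; have [phi [Bphi nD fphi]] := D_good f Qf.
  exists phi => //; apply: A'near => //; exact: sG fs _ fphi.
have [phi A'phi gphi] := inA' g Qg gs; have [psi A'psi hpsi] := inA' h Qh hs.
move: gh; rewrite -gphi -hpsi ltNge => /negP; apply.
have lin f : B f -> exists L : operator (ell1 R k P) K^o, forall w, L w = f w.
  move=> [f_lin f_le]; have [S S0 SS] := op_rbound (Sigma R k P).
  pose fL := GRing.isLinear.Build _ _ _ _ _ f_lin.
  pose fl : {linear ell1 R k P -> K^o} := HB.pack f fL.
  have fb : exists N' : K, forall w, `|fl w| <= N' * `|w|.
    apply: (@real_bounded _ _ _ _ _ (M * S)) => w; apply: le_trans (f_le w) _.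
    by rewrite -mulrA ler_wpM2l// ltW.
  by exists (Operator fb).
have [L1 L1E] := lin phi (CB _ (A'C _ A'phi)); have [L2 L2E] := lin psi (CB _ (A'C _ A'psi)).
have := @ell1_op_bound _ _ _ _ (op_comb 1 (-1) L1 L2) (e / N) (ltW eN).
have DE w : op_comb 1 (-1) L1 L2 w = phi w - psi w.
  by rewrite -L1E -L2E /= /op_comb_fun scale1r scaleN1r.
move=> /(_ _ (U x)); rewrite DE => H; apply: le_trans (H _) _.
  by move=> t; rewrite DE; exact: A'e.
apply: (@le_trans _ _ (e / N * (N * rnorm x))).
  by rewrite ler_wpM2l// ltW.
by rewrite mulrA divfK ?gt_eqF// ler_piMr// ltW.
Qed.

End FactorDefined.

(** * Separability *)

(** A metric space is separable iff for every distance its points can be coded by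
    natural numbers so that points with the same code are close. Codes pass to
    subsets and preimages without choosing dense sequences. *)

Section Codes.
Variables (R : realType) (k : scalar_kind).
Local Notation K := (scalar_field R k).

(** The code records an integer bound together with a color for this bound. *)
Lemma scalar_code (e : R) : 0 < e -> exists c : K -> nat,
  forall a b, c a = c b -> rnorm (a - b : K^o) <= e.
Proof.
move=> e0; have /choice[c cP] : forall N : nat, exists c : K -> nat, forall a b : K,
    rnorm (a : K^o) <= N%:R -> rnorm (b : K^o) <= N%:R -> c a = c b -> rnorm (a - b : K^o) <= e.
  move=> N; have [F [q qP]] := scalar_coloring k N%:R e0.
  exists (fun a => nat_of_ord (enum_rank (q a))) => a b aN bN /ord_inj/enum_rank_inj; exact: qP.
pose N (a : K) := Num.bound (rnorm (a : K^o)).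
have NP a : rnorm (a : K^o) <= (N a)%:R by apply/ltW/archi_boundP/rnorm_ge0.
exists (fun a => choice.pickle (N a, c (N a) a)) => a b.
move=> /(pcan_inj choice.pickleK) E.
have Nab : N a = N b := congr1 fst E; have cab : c (N a) a = c (N b) b := congr1 snd E.
by apply: (cP (N a)); [exact: NP|rewrite Nab; exact: NP|rewrite cab Nab].
Qed.

(** The code records a finite set carrying the vector up to [e / 3], with codes of
    the coordinates that are precise enough for the size of this set. *)
Lemma ell1_code (I : choiceType) (e : R) : countable [set: I] -> 0 < e ->
  exists c : ell1 R k I -> nat, forall v w, c v = c w -> rnorm (v - w) <= e.
Proof.
move=> /countable_injP[h h_inj] e0.
have e3 : 0 < e / 3 by rewrite divr_gt0.
have [A AP] := choice (fun w : ell1 R k I => ell1_trunc_cvg w e3).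
have en n : 0 < e / 3 / n.+1%:R by rewrite divr_gt0 ?ltr0n.
have [c cP] := choice (fun n => scalar_code (en n)).
pose code w := choice.pickle [seq (h i, c (size (A w)) (w i)) | i <- A w].
exists code => v w /(pcan_inj choice.pickleK) E.
have sizeE : size (A v) = size (A w) by have := congr1 size E; rewrite !size_map.
have AE : A v = A w.
  apply: val_inj; have /(congr1 (map fst)) := E; rewrite -!map_comp /=.
  by apply: inj_map => i j /= hij; apply: h_inj; rewrite ?inE.
have close i : i \in A v -> rnorm (v i - w i) <= e / 3 / (size (A v)).+1%:R.
  move=> iA; apply: (cP (size (A v))).
  have := E; rewrite -AE => /eq_in_map/(_ i iA)[]; by [].
have trunc_close : rnorm (ell1_trunc v (A v) - ell1_trunc w (A v)) <= e / 3.
  rewrite /ell1_trunc -sumrB; pose m := e / 3 / (size (A v)).+1%:R.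
  apply: (@le_trans _ _ (\sum_(i <- A v) m)).
    have : {subset enum_fset (A v) <= A v} by [].
    elim: (enum_fset (A v)) => [|i s IH] sA; first by rewrite !big_nil rnorm0.
    rewrite !big_cons; apply: le_trans (rnormD _ _) _; apply: lerD; last first.
      by apply: IH => j js; apply: sA; rewrite inE js orbT.
    rewrite -scalerBl rnormZ; apply: le_trans (close i (sA i (mem_head _ _))).
    by rewrite ler_piMr ?rnorm_ge0// unit_vector_norm.
  rewrite big_const_seq count_predT iter_addr_0 -[_ *+ _]mulr_natl /m mulrCA.
  by rewrite ger_pMr// ler_pdivrMr ?ltr0n// mul1r ler_nat.
have := AP v; have := AP w; rewrite -AE => w_close v_close.
set tv := ell1_trunc v _ in v_close trunc_close *.
set tw := ell1_trunc w _ in w_close trunc_close *.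
have -> : v - w = (v - tv) + ((tv - tw) + (tw - w)) by rewrite !subrKA.
have := rnormD (v - tv) ((tv - tw) + (tw - w)); have := rnormD (tv - tw) (tw - w).
by move: v_close w_close trunc_close; rewrite (rnormB w); lra.
Qed.

End Codes.

Section Separable.
Variables (R : realType) (k : scalar_kind).
Local Notation K := (scalar_field R k).
Variables (W Z : completeNormedModType K) (Ups : operator W Z).

(** Derived sets are relatively closed: what is removed at a successor step is
    relatively open. *)
Lemma szlenk_iter_closed (A : set (dual_space W)) e xi f : A f ->
  ~ szlenk_iter e A xi f -> exists s c, 0 < c /\
    forall g, szlenk_iter e A xi g -> ~ wball f s c g.
Proof.
move=> Af; elim: xi => [//|xi IH|J z IH] nf.
  have [fxi|/IH[s [c [c0 H]]]] := pselect (szlenk_iter e A xi f); last first.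
    by exists s, c; split=> // g /szlenk_derP[/H].
  have [s [c [c0 N]]] : exists s c, 0 < c /\ ~ exists g h,
      [/\ szlenk_iter e A xi g, szlenk_iter e A xi h, wball f s c g, wball f s c h & far e g h].
    apply: contrapT => N; apply: nf; apply/szlenk_derP; split=> // s c c0.
    by apply: contrapT => N'; apply: N; exists s, c.
  have c2 : 0 < c / 2 by rewrite divr_gt0.
  exists s, (c / 2); split=> // g /szlenk_derP[_ /(_ s _ c2)[g1 [g2 [A1 A2 gs1 gs2 g12]]]] gs.
  have tri g' : wball g s (c / 2) g' -> wball f s c g'.
    move=> g's v vs; rewrite -(subrKA (g v)) (splitr c).
    by apply: le_lt_trans (rnormD _ _) _; rewrite ltrD ?gs ?g's.
  by apply: N; exists g1, g2; split=> //; exact: tri.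
have [j nj] : exists j, ~ szlenk_iter e A (z j) f.
  by apply: contrapT => /forallNP N; apply: nf; split=> // j _; apply: contrapT => /N.
have [s [c [c0 H]]] := IH j nj; exists s, c; split=> // g [_ /(_ j I)]; exact: H.
Qed.

(** The weak* topology on the image of the dual ball has a countable base, so the
    decreasing family of derived sets, all relatively closed, is stationary from a
    countable ordinal on. *)
Lemma separable_Sz_le_omega1 :
  (forall e : R, 0 < e -> exists c : W -> nat,
     forall v w, c v = c w -> rnorm (Ups v - Ups w) <= e) ->
  op_Sz_defined Ups -> ord_le (op_Sz Ups) omega1.
Proof.
move=> W_code Ups_def [e e0] /=.
set A := adjoint Ups @` @dual_ball R k Z.
pose iA c := szlenk_iter e A (ord_of_cord c).
have pr n : 0 < n.+1%:R^-1 :> R by rewrite invr_gt0 ltr0n.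
have [cW cWP] := choice (fun n => W_code _ (pr n)).
have [cK cKP] := choice (fun n => @scalar_code R k _ (pr n)).
have /choice[rep repP] : forall p : nat * nat, exists w, forall v, cW p.1 v = p.2 ->
    cW p.1 w = p.2.
  move=> [n m]; have [[v vm]|/forallNP N] := pselect (exists v, cW n v = m).
    by exists v.
  by exists 0 => v /= vm; case: (N v).
pose base (x : nat * seq (nat * nat)) : set (dual_space W) :=
  [set g | forall p, p \in x.2 -> cK x.1 (g (rep (x.1, p.1))) = p.2].
have baseP f s c : A f -> 0 < c -> exists x, base x f /\
    forall g, A g -> base x g -> wball f s c g.
  move=> Af c0; pose n := Num.bound (3 / c).
  have nc : n.+1%:R^-1 < c / 3.
    rewrite -[ltRHS]invrK invf_div ltf_pV2 ?posrE ?ltr0n ?divr_gt0//.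
    apply: lt_trans (archi_boundP _) _; first by rewrite divr_ge0 ?(ltW c0).
    by rewrite ltr_nat.
  exists (n, [seq (cW n v, cK n (f (rep (n, cW n v)))) | v <- s]); split.
    by move=> _ /mapP[v vs ->].
  move=> g Ag gx v vs; set w := rep (n, cW n v).
  have cvw : cW n w = cW n v by apply: (repP (n, cW n v) v).
  have := gx (cW n v, cK n (f w)) (map_f _ vs) => /= /cKP fg.
  have A_le h : A h -> rnorm (h v - h w : K^o) <= n.+1%:R^-1.
    move=> [z z1 <-]; rewrite -[X in rnorm X](_ : z (Ups v - Ups w) = _); last first.
      by rewrite (linearB z).
    by apply: le_trans (dual_ball_le z1 _) _; exact: cWP.
  have fw := A_le f Af; rewrite rnormB in fw.
  rewrite -(subrKA (g w)); apply: le_lt_trans (rnormD _ _) _.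
  rewrite -(subrKA (f w) (g w) (- f v)).
  apply: le_lt_trans (lerD (A_le g Ag) (le_trans (rnormD _ _) (lerD fg fw))) _.
  by move: nc; move: (n.+1%:R^-1) => r; lra.
have /choice[cx cxP] : forall x, exists c, (exists c', iA c' `&` base x = set0) ->
    iA c `&` base x = set0.
  by move=> x; have [[c H]|N] := pselect (exists c', iA c' `&` base x = set0);
    [exists c|exists CZero].
pose cs := CSup (fun n => if choice.unpickle n is Some x then cx x else CZero).
have cs_sub c : iA cs `<=` iA c.
  move=> f fcs; apply: contrapT => nf; have Af := szlenk_iter_sub fcs.
  have [s [r [r0 H]]] := szlenk_iter_closed Af nf.
  have [x [fx xs]] := baseP f s r Af r0.
  have : iA (cx x) `&` base x = set0.
    apply: cxP; exists c; apply/seteqP; split=> // g [gc gx].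
    by apply: (H g gc); apply: xs gx; exact: szlenk_iter_sub gc.
  move/seteqP => [/(_ f) + _]; apply; split=> //.
  apply: (szlenk_iter_le (b := ord_of_cord cs)) fcs.
  apply: (@ord_le_sup _ nat (fun n => ord_of_cord
    (if choice.unpickle n is Some x then cx x else CZero)) (choice.pickle x)).
  by rewrite choice.pickleK; exact: ord_le_refl.
have cs_fix xi : iA cs `<=` szlenk_iter e A xi.
  elim: xi => [|xi IH|J z IH] f fcs; first exact: szlenk_iter_sub fcs.
    apply: (@szlenk_iter_subset _ _ _ e e _ _ (OSucc OZero) (lexx e) IH).
    exact: (cs_sub (CSucc cs)).
  by split=> [|j _]; [exact: szlenk_iter_sub fcs|exact: IH].
have [xi xi0] := Ups_def e e0.
have cs0 : iA cs = set0 by apply/seteqP; split=> // f /(cs_fix xi); rewrite xi0.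
apply: ord_le_trans (_ : ord_le (ord_of_cord cs) omega1); last first.
  by apply: ord_ltW; exists (CSucc cs); exact: ord_le_refl.
by apply: (ord_leastP _).2 cs0; exists xi.
Qed.

End Separable.

(** * Nonexistence from omega1 on *)

(** A type of all ordinals below [a]; a choice type on the level of the index
    families of [a], so that it can index the nodes of a tree. *)
Fixpoint ord_index (a : ord) : Type :=
  match a with
  | OZero => void
  | OSucc a' => option (ord_index a')
  | OSup J f => sigT (fun j => ord_index (f j))
  end.

HB.instance Definition _ a := gen_eqMixin (ord_index a).
HB.instance Definition _ a := gen_choiceMixin (ord_index a).

Fixpoint ord_value (a : ord) : ord_index a -> ord :=
  match a with
  | OZero => fun x => match x with end
  | OSucc a' => fun x => if x is Some y then ord_value y else a'
  | OSup J f => fun x => ord_value (projT2 x)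
  end.

Lemma ord_value_onto a z : ord_lt z a -> exists x : ord_index a, ord_eq z (ord_value x).
Proof.
elim: a z => [//|a IH|J f IH] z za; last first.
  by case: za => j /IH[x zx]; exists (existT _ j x).
have [/IH[x zx]|az] := ord_ltVge z a; first by exists (Some x).
by exists None.
Qed.

(** Repeating every subtree infinitely often makes each node a limit of children of
    the same rank. *)
Definition duplicated_branching (D : choiceType) (f : nat * D -> wtree (nat * D)%type) :=
  forall m n x, f (m, x) = f (n, x).

Lemma duplicated_wtree_exists a xi : ord_le xi a ->
  exists2 w : wtree (nat * ord_index a)%type,
    hereditary (@duplicated_branching (ord_index a)) w & ord_le xi (wrank w).
Proof.
elim/(well_founded_ind ord_lt_wf): xi => xi IH xia.
have /choice[w wP] : forall x : ord_index a, exists w : wtree (nat * ord_index a)%type,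
    hereditary (@duplicated_branching (ord_index a)) w /\
    (ord_lt (ord_value x) xi -> ord_le (ord_value x) (wrank w)).
  move=> x; have [xlt|xge] := ord_ltVge (ord_value x) xi.
    by have [|w wd xw] := IH _ xlt; [exact: ord_le_trans (ord_ltW xlt) xia|exists w].
  exists (WLeaf _); split=> // xlt.
  by case: (@ord_lt_irr xi); exact: ord_le_lt_trans xge xlt.
exists (WNode (fun p => w p.2)); first by split=> // j; case: (wP j.2).
have [lt1|//] := ord_ltVge (wrank (WNode (fun p : nat * ord_index a => w p.2))) xi.
have [x [zx xz]] := ord_value_onto (ord_lt_le_trans lt1 xia).
have [_ /(_ (ord_le_lt_trans xz lt1)) xw] := wP x.
case: (@ord_lt_irr (wrank (w x))).
apply: (@ord_lt_le_trans (wrank (WNode (fun p : nat * ord_index a => w p.2)))).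
  by exists (0%N, x); exact: ord_le_refl.
exact: ord_le_trans zx xw.
Qed.

Lemma duplicated_non_szlenk (R : realType) (k : scalar_kind) (beta : ord) (D : choiceType)
    (w : wtree (nat * D)%type) : hereditary (@duplicated_branching D) w ->
  ord_le (ord_pow omega beta) (wrank w) ->
  non_szlenk beta (Sigma R k (star (ptree (valid w)))).
Proof.
move=> w_dup le_w.
apply: (@branching_non_szlenk R k beta _ _ (proot (valid0 w)) (@wtree_rank _ w)).
- exact: proot_le.
- move=> t z zt; case tf: (subtree w t) => [|f]; first by move: zt; rewrite /wtree_rank tf.
  have := hereditary_subtree t w_dup; rewrite tf => -[f_dup _].
  have [[m x] zx] : exists j, ord_le z (wrank (f j)) by move: zt; rewrite /wtree_rank tf.
  have /choice[c cP] : forall n, exists c : ptree (valid w),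
      pseq c = rcons t (n, x) /\ subtree w c = f (n, x).
    by move=> n; have [c] := wtree_child tf (n, x); exists c.
  exists c; split=> [n n' cn|n].
    have [nE _] := cP n; have [n'E _] := cP n'.
    by have := congr1 (last (0%N, x) \o @pseq _ _) cn; rewrite /= nE n'E !last_rcons => -[].
  have [nE nf] := cP n; have [tc cmax] := ptree_below_child nE; split=> //.
  by rewrite /wtree_rank nf (f_dup n m).
- by rewrite /wtree_rank /= subtree0.
Qed.

(** Every node of the tree of all finite sequences has infinitely many children, so
    no segment functional is ever removed. *)
Lemma full_tree_non_szlenk (R : realType) (k : scalar_kind) (beta : ord) :
  non_szlenk beta (Sigma R k (star (@ptree nat xpredT))).
Proof.
have r_le := @proot_le nat xpredT isT.
have [chi [chiK chiE]] := segment_functional R k r_le.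
have half_gt0 : 0 < 2^-1 :> R by rewrite invr_gt0.
apply: (non_szlenk_iter half_gt0 (f := chi (proot isT))).
apply: (@segment_szlenk _ _ _ _ _ r_le (fun _ => setT)) => // z t _; split=> //.
exists (fun n => @Ptree nat xpredT (rcons t n) isT); split.
  by move=> m n /(congr1 (last 0%N \o @pseq _ _)); rewrite /= !last_rcons.
by move=> n; have [tc cmax] := @ptree_below_child _ _ t n (@Ptree nat xpredT (rcons t n) isT) erefl.
Qed.

(** A universal operator would factor through both operators above: through the
    first because its index exists, through the second because its index is at
    most omega1. *)
Lemma universal_lt_omega1 (R : realType) (k : scalar_kind) (beta : ord)
    (W Z : completeNormedModType (scalar_field R k)) (Ups : operator W Z) :
  universal (@non_szlenk R k beta) Ups -> ord_lt beta omega1.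
Proof.
move=> [Ups_non Ups_univ]; have [//|beta_ge] := ord_ltVge beta omega1.
have Ups_def : op_Sz_defined Ups.
  have [w w_dup le_w] := duplicated_wtree_exists (ord_le_refl (ord_pow omega beta)).
  have /Ups_univ Ups_factors := duplicated_non_szlenk (R := R) (k := k) w_dup le_w.
  have T_wf := @wtree_gt_wf _ w; have T_tree := @ptree_is_tree _ (valid w).
  apply: (factor_Sz_defined _ _ _ Ups_factors).
  - move=> u; apply: (@finite_preimage _ _ [set s | (s <= node u)%O] (@node _ _)).
      by move=> a b _ _; exact: node_inj.
    exact: ptree_below_finite.
  - by move=> a b u au bu; exact: (chain_below T_tree au bu).
  - suff H t : forall u, node u = t -> Acc (fun a b : star (ptree (valid w)) => (b < a)%O) u.
      by move=> u; exact: H erefl.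
    elim/(well_founded_ind T_wf): t => t IH u ut; constructor=> v uv.
    by apply: (IH (node v)) => //; rewrite -ut.
case: Ups_non; split=> //.
have [U [V VU]] := Ups_univ _ _ _ (@full_tree_non_szlenk R k beta).
apply: ord_le_trans (ord_le_trans beta_ge (ord_le_pow beta)).
apply: separable_Sz_le_omega1 => // e e0.
have I_count : countable [set: star (@ptree nat xpredT)].
  apply/countable_injP; exists (fun u => choice.pickle (pseq (node u))) => a b _ _.
  by move=> /(pcan_inj choice.pickleK)/val_inj/node_inj.
have [M M0 VM] := op_rbound (op_comp V (Sigma R k (star (@ptree nat xpredT)))).
have [c cP] := @ell1_code R k _ _ I_count (divr_gt0 e0 M0).
exists (fun v => c (U v)) => v w /cP vw.
rewrite -!VU -(linearB (op_comp V (Sigma R k _))); apply: le_trans (VM _) _.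
by rewrite -ler_pdivlMl// mulrC.
Qed.

Theorem theorem6 (R : realType) (k : scalar_kind) :
  (forall (X Y : completeNormedModType (scalar_field R k)) (alpha : ord)
      (T : operator X Y) (d : Order.disp_t) (tree : porderType d),
    ord_lt alpha omega1 ->
    ~ is_szlenk alpha T ->
    is_tree tree -> ([set: tree] #= [set: nat])%card ->
    rooted tree -> well_founded_tree tree ->
    ord_lt (tree_rank tree) (ord_pow omega (OSucc alpha)) ->
    factors_through (Sigma R k (star tree)) T /\
    (blossomed tree -> ord_le (ord_pow omega alpha) (tree_rank tree) ->
      universal (@non_szlenk R k alpha) (Sigma R k (star tree)))) /\
  (forall beta : ord,
    (exists (W Z : completeNormedModType (scalar_field R k)) (Ups : operator W Z),
      universal (@non_szlenk R k beta) Ups) <-> ord_lt beta omega1).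
Proof.
split=> [X Y alpha T d tree _ T_non tree_P tree_N tree_rooted tree_wf rank_lt|beta].
  split=> [|tree_blossomed le_rank]; first exact: non_szlenk_factors T_non _ _ _ _ _.
  split; first exact: blossomed_non_szlenk.
  by move=> X' Y' S S_non; exact: non_szlenk_factors S_non _ _ _ _ _.
split=> [[W [Z [Ups]]]|]; first exact: universal_lt_omega1.
exact: universal_exists.
Qed.
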